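(* Let $n\ge 2$. For a geodesic ball in $\mathbb{S}^n$ of geodesic radius $\theta_1$, let $\lambda_1(\theta_1)$ denote its first Dirichlet eigenvalue. Then $\theta_1^2\,\lambda_1(\theta_1)$ is a decreasing function of $\theta_1$ for $0<\theta_1\le\pi$.
   Context: $\mathbb{S}^n$ is the unit sphere in $\mathbb{R}^{n+1}$ with its standard round metric. $\lambda_1(\theta_1)$ is the first eigenvalue of $-\Delta$ (the Laplace–Beltrami operator of $\mathbb{S}^n$) with Dirichlet boundary conditions (that is, with form domain $H_0^1$) on the open geodesic ball of geodesic radius $\theta_1$. *)

(* Defs.v *)
From HB Require Import structures.
From mathcomp Require Import all_boot all_order all_algebra.
From mathcomp Require Import all_classical all_reals all_analysis.
From mathcomp Require Import measurable_realfun.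

Set Implicit Arguments.
Unset Strict Implicit.
Unset Printing Implicit Defensive.
Import Order.TTheory GRing.Theory Num.Theory.
Import numFieldNormedType.Exports.
Local Open Scope classical_set_scope.
Local Open Scope ring_scope.

(* Product sigma-algebra on 'rV[R]_n, generated by the coordinates (as for
   n.-tuple R). *)
Definition rV_display : measure_display.
Proof. exact: default_measure_display. Qed.

Section measurable_rV.
Context {R : realType}.
Variable n : nat.

Let coord (i : 'I_n) (x : 'rV[R]_n) : R := x ord0 i.

Let rV_set0 : g_sigma_preimage coord set0.
Proof. exact: sigma_algebra0. Qed.

Let rV_setC A : g_sigma_preimage coord A -> g_sigma_preimage coord (~` A).
Proof. exact: sigma_algebraC. Qed.

Let rV_bigcup (F : _^nat) : (forall i, g_sigma_preimage coord (F i)) ->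
  g_sigma_preimage coord (\bigcup_i (F i)).
Proof. exact: sigma_algebra_bigcup. Qed.

HB.instance Definition _ := @isMeasurable.Build rV_display
  'rV[R]_n (g_sigma_preimage coord) rV_set0 rV_setC rV_bigcup.

Lemma measurable_coord (i : 'I_n) :
  measurable_fun [set: 'rV[R]_n] (fun x : 'rV[R]_n => x ord0 i).
Proof.
move=> _ Y mY; rewrite setTI; apply: sub_sigma_algebra => /=.
rewrite -bigcup_seq/=; exists i => /=; first by rewrite mem_index_enum.
by exists Y => //; rewrite setTI.
Qed.

Lemma measurable_fun_rVP d (T : measurableType d) (f : T -> 'rV[R]_n) :
  (forall i, measurable_fun [set: T] (fun t => f t ord0 i)) ->
  measurable_fun [set: T] f.
Proof.
move=> mf.
have H : g_sigma_preimage (fun i => coord i \o f) `<=` measurable.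
  apply: smallest_sub; first exact: sigma_algebra_measurable.
  rewrite -bigcup_seq/=; apply: bigcup_sub => i _ A [B mB <-].
  exact: mf.
move=> _ A mA; apply: H.
by rewrite g_sigma_preimage_comp; exists A.
Qed.

End measurable_rV.

Section lebesgue_measure_rV.
Context {R : realType}.

Definition cons_rV n (p : R * 'rV[R]_n) : 'rV[R]_n.+1 :=
  \row_i oapp (fun j => p.2 ord0 j) p.1 (unlift ord0 i).

Lemma cons_rV0 n (p : R * 'rV[R]_n) : cons_rV p ord0 ord0 = p.1.
Proof. by rewrite mxE unlift_none. Qed.

Lemma cons_rVS n (p : R * 'rV[R]_n) i :
  cons_rV p ord0 (lift ord0 i) = p.2 ord0 i.
Proof. by rewrite mxE liftK. Qed.

Lemma measurable_cons_rV n :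
  measurable_fun [set: R * 'rV[R]_n] (@cons_rV n).
Proof.
apply: measurable_fun_rVP => i.
have [j ->|->] := unliftP ord0 i.
- under eq_fun do rewrite cons_rVS.
  exact: (measurableT_comp (measurable_coord j) measurable_snd).
- under eq_fun do rewrite cons_rV0.
  exact: measurable_fst.
Qed.

End lebesgue_measure_rV.

Section lebesgue_cons.
Context {R : realType} (n : nat).
Variable m : {sigma_finite_measure set 'rV[R]_n -> \bar R}.

Definition lebesgue_cons : set 'rV[R]_n.+1 -> \bar R :=
  pushforward (@lebesgue_measure R \x m)%E (@cons_rV R n).

HB.instance Definition _ := Measure.copy lebesgue_cons
  (measure_function_pushforward__canonical__measure_function_Measure
     (@lebesgue_measure R \x m)%E (@measurable_cons_rV R n)).

Let sigma_finite_lebesgue_cons : sigma_finite setT lebesgue_cons.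
Proof.
have /sigma_finiteP[F [FT ndF Foo]] := sigma_finiteT (@lebesgue_measure R).
have /sigma_finiteP[G [GT ndG Goo]] := sigma_finiteT m.
pose h (x : 'rV[R]_n.+1) : R * 'rV[R]_n :=
  (x ord0 ord0, \row_j x ord0 (lift ord0 j)).
have mh : measurable_fun setT h.
  apply: measurable_fun_pair; first exact: measurable_coord.
  apply: measurable_fun_rVP => i; under eq_fun do rewrite mxE.
  exact: measurable_coord.
have hK : cancel (@cons_rV R n) h.
  move=> [a v]; rewrite /h cons_rV0; congr pair.
  by apply/rowP => j; rewrite mxE cons_rVS.
exists (fun k => h @^-1` (F k `*` G k)).
  apply/seteqP; split=> // x _.
  have [[i _ Fi] [j _ Gj]] : (\bigcup_i F i) (h x).1 /\ (\bigcup_i G i) (h x).2.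
    by rewrite -FT -GT.
  exists (maxn i j) => //; split.
  - by move: Fi; exact/subsetPset/ndF/leq_maxl.
  - by move: Gj; exact/subsetPset/ndG/leq_maxr.
move=> k; have [mF Fk] := Foo k; have [mG Gk] := Goo k; split.
  by rewrite -[X in measurable X]setTI; apply: mh => //; exact: measurableX.
rewrite /lebesgue_cons /pushforward -comp_preimage.
rewrite (_ : h \o _ = id); last by apply/funext => p /=; rewrite hK.
by rewrite preimage_id product_measure1E// lte_mul_pinfty// ge0_fin_numE.
Qed.

HB.instance Definition _ := Measure_isSigmaFinite.Build _ _ _
  lebesgue_cons sigma_finite_lebesgue_cons.

End lebesgue_cons.

Fixpoint lebesgue_rV {R : realType} (n : nat) :
    {sigma_finite_measure set 'rV[R]_n -> \bar R} :=
  if n is n'.+1 then lebesgue_cons (lebesgue_rV n') else \d_(0 : 'rV[R]_0).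

Section sphere.
Context {R : realType} {n : nat}.
Implicit Types (x y p : 'rV[R]_n.+1) (f u v : 'rV[R]_n.+1 -> R)
  (U : set 'rV[R]_n.+1).

(* The library norm on 'rV[R]_n.+1 is the sup norm, so the Euclidean structure
   is spelled out. *)
Definition dot x y : R := \sum_i x ord0 i * y ord0 i.

Definition sphere : set 'rV[R]_n.+1 := [set x | dot x x = 1].

Definition geodesic_ball p (r : R) : set 'rV[R]_n.+1 :=
  [set x | sphere x /\ acos (dot x p) < r].

Lemma measurable_dotxx : measurable_fun setT (fun x => dot x x).
Proof.
apply: measurable_sum => i.
by apply: measurable_funM; exact: measurable_coord.
Qed.

Definition unit_ball : set 'rV[R]_n.+1 := [set x | dot x x <= 1].

Lemma measurable_unit_ball : measurable unit_ball.
Proof.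
rewrite (_ : unit_ball = (fun x => dot x x) @^-1` `]-oo, 1]).
  by rewrite -[X in measurable X]setTI; exact: measurable_dotxx.
by apply/seteqP; split=> x /=; rewrite in_itv.
Qed.

Definition normalize x : 'rV[R]_n.+1 := (Num.sqrt (dot x x))^-1 *: x.

Lemma measurable_normalize : measurable_fun setT normalize.
Proof.
apply: measurable_fun_rVP => i.
rewrite (_ : (fun _ => _) = fun x => powR (Num.sqrt (dot x x)) (-1) * x ord0 i).
  apply: measurable_funM; last exact: measurable_coord.
  apply: (measurableT_comp (measurable_powR (-1))).
  apply: (measurableT_comp (f := @Num.sqrt R)); last exact: measurable_dotxx.
  by apply: continuous_measurable_fun; exact: sqrt_continuous.
by apply/funext => x; rewrite mxE powR_inv1// sqrtr_ge0.
Qed.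

Definition radial_projection_measure : set 'rV[R]_n.+1 -> \bar R :=
  pushforward (mrestr (lebesgue_rV n.+1) measurable_unit_ball) normalize.

HB.instance Definition _ := Measure.copy radial_projection_measure
  (measure_function_pushforward__canonical__measure_function_Measure
     (mrestr (lebesgue_rV n.+1) measurable_unit_ball) measurable_normalize).

(* Surface measure of the unit sphere S^n, as the cone measure:
   sigma(A) = (n+1) * vol {x | 0 < |x| <= 1 and x/|x| in A}
   for A contained in the sphere. *)
Definition sphere_measure : set 'rV[R]_n.+1 -> \bar R :=
  mscale n.+1%:R%:nng radial_projection_measure.

HB.instance Definition _ := Measure.on sphere_measure.

(* C^oo on R^(n+1): all iterated directional derivatives exist and are
   differentiable. As S^n is a closed submanifold, C^oo(S^n) consists of the
   restrictions to S^n of such functions. *)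
Definition smooth f : Prop :=
  forall (es : seq 'rV[R]_n.+1) x,
    differentiable (foldr (fun e (h : 'rV[R]_n.+1 -> R) => 'D_e h) f es) x.

(* Riemannian gradient of f|S^n at x in S^n: the tangential part of the ambient
   gradient. *)
Definition sphere_grad f x : 'rV[R]_n.+1 :=
  let g := \row_i 'D_(delta_mx ord0 i) f x in g - dot g x *: x.

(* C_c^oo(U), for U an open subset of S^n. *)
Definition test_function U f : Prop :=
  smooth f /\
  exists K : set 'rV[R]_n.+1,
    [/\ compact K, K `<=` U & forall x, sphere x -> ~ K x -> f x = 0].

(* u belongs to H_0^1(U), the closure of C_c^oo(U) in H^1, with weak gradient
   g. *)
Definition H10 U u (g : 'rV[R]_n.+1 -> 'rV[R]_n.+1) : Prop :=
  [/\ measurable_fun sphere u, measurable_fun sphere g &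
   exists phi : nat -> 'rV[R]_n.+1 -> R,
   [/\ forall k, test_function U (phi k),
       (\int[sphere_measure]_(x in sphere)
          ((phi k x - u x) ^+ 2)%:E)%E @[k --> \oo] --> 0%E &
       (\int[sphere_measure]_(x in sphere)
          (let d := sphere_grad (phi k) x - g x in dot d d)%:E)%E
         @[k --> \oo] --> 0%E]].

(* Eigenvalues of the self-adjoint operator -Delta on L^2(U) associated with
   the Dirichlet form on H_0^1(U). *)
Definition dirichlet_eigenvalue U (lam : R) : Prop :=
  exists u (g : 'rV[R]_n.+1 -> 'rV[R]_n.+1),
  [/\ H10 U u g,
      ~ {ae sphere_measure, forall x, sphere x -> u x = 0} &
      forall v h, H10 U v h ->
        \int[sphere_measure]_(x in sphere) dot (g x) (h x) =
        lam * \int[sphere_measure]_(x in sphere) (u x * v x)].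

(* The spectrum is discrete and bounded below, so this infimum is a minimum. *)
Definition first_dirichlet_eigenvalue U : R :=
  inf [set lam | dirichlet_eigenvalue U lam].

End sphere.

(* Main.v *)
(** On the ball of radius [r < pi] about [p] in the [n]-sphere the first
    eigenfunction is radial, [u x = f (dot x p)], where
    [(1 - t^2) f'' - n t f' + mu f = 0] on [[cos r, 1]] and [f (cos r) = 0].
    Here [f] is a hypergeometric series in [(1 - t) / 2], and [mu] is the
    supremum of the parameters for which it is positive on [[cos r, 1]].
    Integrating [f' / f] by parts against [phi^2] gives
    [int |grad phi|^2 >= mu int phi^2] for all test functions (Barta), so that
    [mu] is the first eigenvalue.

    For [th1 < th2 < pi] put [c = th2 / th1]. The rescaled eigenfunction
    [th |-> f2 (cos (c th))] lives on the same interval [[0, th1]] as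
    [f1 (cos th)] and has eigenvalue [c^2 mu2], but a smaller drift, because
    [c cot (c th) < cot th]. The Wronskian of the two functions then excludes
    [mu1 <= c^2 mu2].

    For [th2 = pi] the ball is the sphere minus a point, which has zero capacity
    as [n >= 2]: constants belong to [H^1_0] and the first eigenvalue is [0]. *)

Require Import Defs.
From HB Require Import structures.
From mathcomp Require Import all_boot all_order all_algebra.
From mathcomp Require Import all_classical all_reals all_analysis.
From mathcomp Require Import measurable_realfun ring lra.

Set Implicit Arguments.
Unset Strict Implicit.
Unset Printing Implicit Defensive.
Import Order.TTheory GRing.Theory Num.Theory.
Import numFieldNormedType.Exports.
Local Open Scope classical_set_scope.
Local Open Scope ring_scope.

(** * Integration by parts for Lebesgue measure *)

Section borel_rV.
Context {R : realType} {n : nat}.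
Implicit Types (x y : 'rV[R]_n) (U : set 'rV[R]_n).

(** The surface measure is a cone measure, so integration by parts on the sphere is derived from
    Lebesgue measure on the ambient space, through the rotation fields [x_i d_j - x_j d_i]: they are
    divergence free, tangent to every sphere and compatible with radial projection, and radial
    cutoffs are constant along them.

    The first eigenvalue is an infimum over weak eigenvalues, and no compactness or spectral theory
    is used to reach it. One positive solution of the radial equation serves twice: it is a weak
    eigenfunction, and it bounds every other eigenvalue from below.

    The price is paid in [H10], whose elements are limits of smooth test functions. Solutions are
    known on an interval only and are extended to C^1 functions on the line; smooth approximations
    are truncated power series times cutoffs built from [exp (- 1 / z)]. A cutoff of width [d] has
    slope of order [1 / d]. This is harmless at the edge of a ball, where the eigenfunction vanishes
    linearly; at a puncture the constant function does not vanish, and an average over many scales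
    is taken. *)

Lemma measurable_ball_rV x (e : R) : measurable (ball x e).
Proof.
have [e0|e0] := ltP 0 e; last first.
  by rewrite (_ : ball x e = set0)//; apply/seteqP; split => // y [] /lt_le_trans/(_ e0); rewrite ltxx.
rewrite (_ : ball x e = \bigcap_(i in [set: 'I_n])
   ((fun y => y ord0 i) @^-1` (ball (x ord0 i) e))).
  apply: fin_bigcap_measurable => // i _.
  by rewrite -[X in measurable X]setTI; apply: measurable_coord => //; exact: measurable_ball.
apply/seteqP; split => [y [_ yb] i _|y yb]; first exact: yb.
by split => // i j; rewrite (ord1 i); apply: (yb j).
Qed.

(** The sigma-algebra is the one generated by the coordinates. Balls of the sup norm are boxes,
    hence measurable, and an open set is the union of the countably many balls with rational centre
    and radius [1 / (k + 1)] that it contains. *)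
Lemma open_measurable_rV U : open U -> measurable U.
Proof.
move=> oU; pose c (q : 'rV[rat]_n) : 'rV[R]_n := map_mx ratr q.
rewrite (_ : U = \bigcup_(qk : 'rV[rat]_n * nat)
  (if pselect (ball (c qk.1) qk.2.+1%:R^-1 `<=` U) then
   ball (c qk.1) qk.2.+1%:R^-1 else set0)); last first.
  apply/seteqP; split => [x Ux|x [[q k] _] /=]; last first.
    by case: pselect => [h /h//|_ []].
  have /nbhs_ballP[e /= e0 eU] : nbhs x U by exact: open_nbhs_nbhs.
  have e2 : 0 < e / 2 by rewrite divr_gt0.
  have [k ke] := ltr_add_invr e2; rewrite add0r in ke.
  have k0 : 0 < k.+1%:R^-1 :> R by rewrite invr_gt0.
  have hq i : exists q : rat, ratr q \in `](x ord0 i - k.+1%:R^-1), (x ord0 i + k.+1%:R^-1)[.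
    by apply: rat_in_itvoo; rewrite ltrD2l gt0_cp.
  pose q := \row_i projT1 (cid (hq i)).
  have qx : ball x k.+1%:R^-1 (c q).
    split => // i j; rewrite (ord1 i) /c !mxE.
    case: cid => r /=; rewrite in_itv/= => /andP[r1 r2].
    by rewrite /ball/= ltr_distlC r1 r2.
  exists (q, k) => //=; case: pselect => [h|h] /=; first exact: ball_sym.
  case: h; apply: subset_trans eU => y qy.
  rewrite [e]splitr; apply: (@ball_triangle _ _ (c q));
    [exact: (le_ball (ltW ke) qx)|exact: (le_ball (ltW ke) qy)].
apply: countable_bigcupT_measurable; [|move=> i]; first exact: countableP.
by case: pselect => h; [exact: measurable_ball_rV|exact: measurable0].
Qed.

Lemma continuous_measurable_rV (f : 'rV[R]_n -> R) :
  continuous f -> measurable_fun setT f.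
Proof.
move=> /continuousP cf.
apply: (measurability _ (@RGenOpens.measurableE R)) => _ [_ [a [b] ->] <-].
by rewrite setTI; apply: open_measurable_rV; apply: cf; exact: interval_open.
Qed.

End borel_rV.

(** * Lebesgue measure on row vectors: cubes, open sets and Fubini *)

Section lebesgue_rV_theory.
Context {R : realType}.

Lemma preimage_cons_ball n (x : 'rV[R]_n.+1) (e : R) : 0 < e ->
  @cons_rV R n @^-1` ball x e =
  ball (x ord0 ord0) e `*` ball (\row_j x ord0 (lift ord0 j)) e.
Proof.
move=> e0; apply/seteqP; split => [[a v] /= [_ b]|[a v] /= [b0 [_ b]]].
  split; first by have := b ord0 ord0; rewrite cons_rV0.
  by split=> // i j; have := b ord0 (lift ord0 j); rewrite cons_rVS mxE (ord1 i).
split=> // i j; rewrite (ord1 i); have [k ->|->] := unliftP ord0 j.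
  by rewrite cons_rVS; have := b ord0 k; rewrite mxE.
by rewrite cons_rV0.
Qed.

(** Balls of the sup norm are cubes, so the value is a product over the coordinates. It serves to
    show that bounded sets have finite measure and nonempty open sets positive measure. *)
Lemma lebesgue_rV_ball n (x : 'rV[R]_n) (e : R) : 0 < e ->
  lebesgue_rV n (ball x e) = ((e *+ 2) ^+ n)%:E.
Proof.
move=> e0; elim: n x => [|n IH] x.
  rewrite /= expr0 diracE mem_set//; split => // i j; case: j => //.
rewrite /= /lebesgue_cons /pushforward preimage_cons_ball//.
rewrite product_measure1E//=; [|exact: measurable_ball|exact: measurable_ball_rV].
by rewrite IH lebesgue_measure_ball ?ltW// -EFinM exprS.
Qed.

Lemma open_lebesgue_rV_gt0 n (U : set 'rV[R]_n) (x : 'rV[R]_n) : open U -> U x ->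
  (0 < lebesgue_rV n U)%E.
Proof.
move=> oU Ux.
have /nbhs_ballP[e /= e0 eU] : nbhs x U by exact: open_nbhs_nbhs.
apply: (@lt_le_trans _ _ (lebesgue_rV n (ball x e))).
  by rewrite lebesgue_rV_ball// lte_fin exprn_gt0// pmulrn_lgt0.
by apply: le_measure => //; rewrite inE; [exact: measurable_ball_rV|exact: open_measurable_rV].
Qed.

Lemma compact_bounded_rV n (h : 'rV[R]_n -> R) (A : set 'rV[R]_n) :
  compact A -> continuous h -> exists C, forall x, A x -> `|h x| <= C.
Proof.
move=> cA ch; have [->|A0] := eqVneq A set0; first by exists 0.
have [||c cAc cm] := @EVT_max_rV R n (fun x => `|h x|) A _ cA.
- by apply/set0P.
- apply: continuous_subspaceT => x; apply: continuous_comp; first exact: ch.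
  exact: norm_continuous.
by exists `|h c| => x Ax; apply: cm; rewrite inE.
Qed.

Lemma compact_box n (M : R) : compact [set v : 'rV[R]_n | forall i, `[- M, M]%classic (v ord0 i)].
Proof. by apply: (@rV_compact R n (fun=> `[- M, M]%classic)) => i; exact: segment_compact. Qed.

Lemma ball0_box n (M : R) : ball (0 : 'rV[R]_n) M `<=` [set v : 'rV[R]_n | forall i, `[- M, M]%classic (v ord0 i)].
Proof.
move=> v [_ h] i; have := h ord0 i; rewrite /ball/= mxE sub0r normrN.
by rewrite in_itv/= -ler_norml => /ltW.
Qed.

Lemma integrable_supported n (h : 'rV[R]_n -> R) (M : R) :
  continuous h -> (forall x, ~ ball 0 M x -> h x = 0) ->
  (lebesgue_rV n).-integrable setT (EFin \o h).
Proof.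
move=> ch h0.
have [M0|M0] := ltP 0 M; last first.
  rewrite (_ : EFin \o h = cst 0%E); first exact: integrable0.
  apply/funext => x /=; rewrite h0// => -[] /lt_le_trans/(_ M0).
  by rewrite ltxx.
have mh := continuous_measurable_rV ch.
rewrite (_ : EFin \o h = (EFin \o h) \_ (ball 0 M)); last first.
  apply/funext => x; rewrite patchE; case: ifPn => //.
  by rewrite notin_setE /= => /h0 ->.
have [C hC] := compact_bounded_rV (@compact_box n M) ch.
apply/(integrable_mkcond _ (measurable_ball_rV 0 M)).
apply: measurable_bounded_integrable.
- exact: measurable_ball_rV.
- by rewrite [X in (X < _)%E]lebesgue_rV_ball// ltry.
- exact: measurable_funTS.
- exists C; split; first exact: num_real.
  by move=> D CD x /= /ball0_box /hC /le_trans -> //; exact: ltW.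
Qed.

Lemma integral_lebesgue_cons n (h : 'rV[R]_n.+1 -> R) :
  measurable_fun setT h -> (lebesgue_rV n.+1).-integrable setT (EFin \o h) ->
  (@lebesgue_measure R \x lebesgue_rV n)%E.-integrable setT (fun z => (h (cons_rV z))%:E) /\
  (\int[lebesgue_rV n.+1]_x (h x)%:E =
   \int[(@lebesgue_measure R \x lebesgue_rV n)]_z (h (cons_rV z))%:E)%E.
Proof.
move=> mh ih.
have mEh : measurable_fun setT (EFin \o h) by apply/measurable_EFinP.
have ic : (@lebesgue_measure R \x lebesgue_rV n)%E.-integrable setT (fun z => (h (cons_rV z))%:E).
  apply/integrableP; split.
    exact: (measurableT_comp mEh (@measurable_cons_rV R n)).
  have /integrableP[_] := ih.
  rewrite [X in (X < _)%E](@ge0_integral_pushforward _ _ (measurableTypeR R * 'rV[R]_n)%type _ R (@cons_rV R n)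
    (@measurable_cons_rV R n) (@lebesgue_measure R \x lebesgue_rV n)%E setT
    (fun x => `|(EFin \o h) x|%E)) ?preimage_setT//.
  exact: measurableT_comp.
split => //.
rewrite [LHS](@integral_pushforward _ _ (measurableTypeR R * 'rV[R]_n)%type _ R (@cons_rV R n) (@measurable_cons_rV R n)
  (@lebesgue_measure R \x lebesgue_rV n)%E setT (EFin \o h)) ?preimage_setT//.
Qed.

End lebesgue_rV_theory.

Section partial_integration.
Context {R : realType}.

(** The two difference quotients coincide term by term, so directional derivatives restrict to
    affine slices without any differentiability of [f]. *)
Lemma derive_comp_affine (U V W : normedModType R) (f : V -> W) (c : U -> V) (a w : U) (v : V) :
  (forall h : R, c (h *: w + a) = h *: v + c a) ->
  (derivable f (c a) v -> derivable (f \o c) a w) /\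
  'D_w (f \o c) a = 'D_v f (c a).
Proof.
move=> hc; rewrite /derivable /derive.
suff -> : (fun h : R => h^-1 *: ((f \o c \o shift a) (h *: w) - (f \o c) a)) =
  (fun h : R => h^-1 *: ((f \o shift (c a)) (h *: v) - f (c a))) by [].
by apply/funext => h /=; rewrite hc.
Qed.

Lemma continuous_rV (T : topologicalType) n (f : T -> 'rV[R]_n) :
  (forall i, continuous (fun t => f t ord0 i)) -> continuous f.
Proof.
move=> cf t; apply/cvg_ballP => e e0.
have : \forall s \near t, forall j, ball (f t ord0 j) e (f s ord0 j).
  by apply: filter_forall => j; apply: cvg_ball => //; exact: cf.
by apply: filterS => s h; split=> // i j; rewrite (ord1 i).
Qed.

Lemma derive_near0 (V : normedModType R) (f : V -> R) (x v : V) :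
  (\forall y \near x, f y = 0) -> 'D_v f x = 0.
Proof.
move=> f0; have [->|v0] := eqVneq v 0; first exact: derive0.
rewrite (@near_eq_derive _ _ _ f (cst 0) x v); first exact: derive_cst.
by near=> y; near: y.
Unshelve. all: by end_near. Qed.

Lemma derive_outside_ball n (f : 'rV[R]_n -> R) (M : R) (v x : 'rV[R]_n) :
  (forall y, ~ ball 0 M y -> f y = 0) -> ~ ball 0 (M + 1) x -> 'D_v f x = 0.
Proof.
move=> f0 xM; apply: derive_near0.
near=> y; apply: f0 => yM; apply: xM.
apply: (ball_triangle yM); apply: ball_sym; near: y.
exact: nbhsx_ballx.
Unshelve. all: by end_near. Qed.

Lemma integral_derive_supported (f : R -> R) (M : R) :
  (forall x, derivable f x 1) -> continuous ('D_1 f) ->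
  (forall x, M <= `|x| -> f x = 0) ->
  (\int[@lebesgue_measure R]_x ('D_1 f x)%:E = 0)%E.
Proof.
move=> df cf f0.
(* One unit beyond [|M|], so that [f] vanishes in a neighbourhood of every point outside and its
   derivative vanishes there too; the absolute value is taken because [M] may be negative. *)
pose b := `|M| + 1.
have b0 : 0 < b by rewrite ltr_wpDl.
have Mb : M <= b by rewrite (le_trans (ler_norm M))// lerDl.
have out x : b <= `|x| -> 'D_1 f x = 0.
  move=> bx; apply: derive_near0; near=> y; apply: f0.
  have : `|x - y| < 1 by near: y; apply: nbhsx_ballx.
  have := lerB_dist x y; have := ler_norm M; rewrite /b in bx.
  move: bx; clear; lra.
transitivity (\int[@lebesgue_measure R]_(x in `[(- b)%R, b]) ('D_1 f x)%:E)%E.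
  rewrite [RHS]integral_mkcond; apply: eq_integral => x _.
  rewrite patchE; case: ifPn => //; rewrite notin_setE /= in_itv /= => /negP.
  by rewrite -ler_norml -ltNge => /ltW /out ->.
rewrite (@continuous_FTC2 _ _ f).
- by rewrite !f0 ?subee// ?normrN gtr0_norm.
- by rewrite gtrN.
- exact: continuous_subspaceT.
- have cff x : {for x, continuous f} by apply/differentiable_continuous/derivable1_diffP/df.
  split => //; [apply: cvg_at_right_filter|apply: cvg_at_left_filter]; exact: cff.
- by move=> x _; rewrite derive1E.
Unshelve. all: by end_near. Qed.

(** Induction on the dimension by Fubini, with the inner integral over the factor that contains the
    direction [j]: the tail, by the induction hypothesis, or the head coordinate, by the fundamental
    theorem of calculus. *)
Lemma integral_partial_supported n (j : 'I_n) (f : 'rV[R]_n -> R) (M : R) :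
  (forall x, derivable f x (delta_mx ord0 j)) ->
  continuous ('D_(delta_mx ord0 j) f) ->
  (forall x, ~ ball 0 M x -> f x = 0) ->
  (\int[lebesgue_rV n]_x ('D_(delta_mx ord0 j) f x)%:E = 0)%E.
Proof.
elim: n j f => [[]//|n IH] j f df cf f0.
have out x : ~ ball 0 (M + 1) x -> 'D_(delta_mx ord0 j) f x = 0.
  exact: derive_outside_ball.
have [ic ->] := integral_lebesgue_cons (continuous_measurable_rV cf)
   (integrable_supported cf out).
have cons_out (a : R) (v : 'rV[R]_n) : M <= `|a| \/ ~ ball 0 M v -> ~ ball 0 M (cons_rV (a, v)).
  move=> h [M0 b]; case: h => [|h].
    have := b ord0 ord0; rewrite cons_rV0 /ball/= mxE sub0r normrN /=.
    by move=> /lt_le_trans h /h; rewrite ltxx.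
  apply: h; split => // i k; have := b i (lift ord0 k).
  by rewrite (ord1 i) cons_rVS !mxE.
have [k jE|jE] := unliftP ord0 j.
- rewrite -integral12_prod_meas1//; rewrite /fubini_F.
  under eq_integral => a _.
    have lin v h : cons_rV (a, h *: delta_mx ord0 k + v) =
        h *: delta_mx ord0 j + cons_rV (a, v) :> 'rV[R]_n.+1.
      apply/rowP => i; rewrite !mxE eqxx/=.
      have [l ->|->] := unliftP ord0 i.
        by rewrite /= !mxE jE eqxx/= (inj_eq (@lift_inj _ _)).
      by rewrite /= jE (negbTE (neq_lift _ _)) mulr0 add0r.
    have D v := derive_comp_affine f (c := fun v => cons_rV (a, v)) (lin v).
    under eq_integral do rewrite -(D _).2.
    rewrite IH; [|by move=> v; apply: (D v).1|idtac|by move=> v hv /=; apply/f0/cons_out; right].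
      over.
    rewrite (_ : 'D_(delta_mx ord0 k) _ = 'D_(delta_mx ord0 j) f \o (fun v => cons_rV (a, v))); last first.
      by apply/funext => v; rewrite (D v).2.
    move=> v; apply: continuous_comp; last exact: cf.
    apply: continuous_rV => i; have [l ->|->] := unliftP ord0 i => w.
      by under eq_fun do rewrite cons_rVS; exact: coord_continuous.
    rewrite (_ : (fun=> _) = cst a); first exact: cst_continuous.
    by apply/funext => u; rewrite cons_rV0.
  by rewrite integral0.
- rewrite -integral21_prod_meas1//; rewrite /fubini_G.
  under eq_integral => v _.
    have lin a h : cons_rV (h *: 1 + a, v) =
        h *: delta_mx ord0 j + cons_rV (a, v) :> 'rV[R]_n.+1.
      apply/rowP => i; rewrite !mxE eqxx/=.
      have [l ->|->] := unliftP ord0 i.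
        by rewrite /= jE eq_sym (negbTE (neq_lift _ _)) mulr0 add0r.
      by rewrite /= jE eqxx.
    have D a := derive_comp_affine f (c := fun a => cons_rV (a, v)) (lin a).
    under eq_integral do rewrite -(D _).2.
    rewrite (@integral_derive_supported _ M); [|by move=> a; apply: (D a).1|idtac|by move=> a ha /=; apply/f0/cons_out; left].
      over.
    rewrite (_ : 'D_(1 : R) (f \o (fun a : R => cons_rV (a, v))) = 'D_(delta_mx ord0 j) f \o (fun a => cons_rV (a, v))); last first.
      by apply/funext => a; rewrite (D a).2.
    move=> a; apply: continuous_comp; last exact: cf.
    apply: continuous_rV => i; have [l ->|->] := unliftP ord0 i => w.
      rewrite (_ : (fun=> _) = cst (v ord0 l)); first exact: cst_continuous.
      by apply/funext => u; rewrite cons_rVS.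
    by under eq_fun do rewrite cons_rV0; exact: cvg_id.
  by rewrite integral0.
Qed.

End partial_integration.

(** * C^1 and smooth functions *)

Section C1_real.
Context {R : realType}.
Implicit Types (g dg h : R -> R) (a b t : R).

Definition C1_real g dg := (forall t, is_derive t 1 g (dg t)) /\ continuous dg.

(** Near [t] each difference quotient of [g] is one of [h1] or of [h2], and both families tend to
    [d]. This is the differentiability of a piecewise function at a junction. *)
Lemma is_derive_either g h1 h2 t (d : R) :
  h1 t = g t -> h2 t = g t ->
  is_derive t 1 h1 d -> is_derive t 1 h2 d ->
  (\forall y \near t, g y = h1 y \/ g y = h2 y) -> is_derive t 1 g d.
Proof.
move=> E1 E2 D1 D2 ghh.
have cv h : is_derive t 1 h d -> (fun k : R => k^-1 *: ((h \o shift t) (k *: (1 : R)) - h t)) @ 0^' --> d.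
  by move=> [dh <-]; exact: dh.
have c1 := cv _ D1; have c2 := cv _ D2.
have c : (fun k : R => k^-1 *: ((g \o shift t) (k *: (1 : R)) - g t)) @ 0^' --> d.
  apply/cvgrPdist_lt => e e0.
  move/cvgrPdist_lt : c1 => /(_ e e0) n1.
  move/cvgrPdist_lt : c2 => /(_ e e0) n2.
  have n3 : \forall k \near 0^', g ((k *: (1 : R)) + t) = h1 (k *: (1 : R) + t) \/ g ((k *: (1 : R)) + t) = h2 (k *: (1 : R) + t).
    have /nbhs_ballP[r /= r0 rt] := ghh.
    near=> k; apply: rt; rewrite /ball/= opprD addrCA subrr addr0 normrN.
    by rewrite [X in `|X|]mulr1; near: k; exact: dnbhs0_lt.
  near=> k.
  have [/= ->|/= ->] : g (k *: (1 : R) + t) = h1 (k *: (1 : R) + t) \/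
     g (k *: (1 : R) + t) = h2 (k *: (1 : R) + t) by near: k; exact: n3.
  - by rewrite -E1; near: k; exact: n1.
  - by rewrite -E2; near: k; exact: n2.
apply: DeriveDef; first by apply/cvg_ex; exists d.
exact: (cvg_lim _ c).
Unshelve. all: by end_near. Qed.

(** Prolong [g] by its tangent lines at [a] and [b]. Functions known on an interval only (a power
    series, a quotient, an inverse square root) thus become functions on the line, to which the
    global product and chain rules apply. *)
Lemma C1_extension a b g dg : a < b ->
  (forall t, a <= t <= b -> is_derive t 1 g (dg t)) ->
  (forall t, a <= t <= b -> {for t, continuous dg}) ->
  exists G DG, C1_real G DG /\ forall t, a <= t <= b -> G t = g t /\ DG t = dg t.
Proof.
move=> ab Dg cdg.
pose L c t := g c + dg c * (t - c).
pose G t := if t < a then L a t else if b < t then L b t else g t.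
(* [c] clamps [t] to the interval, so [dg \o c] is continuous and constant on either side, as the
   tangent lines demand. *)
pose c t := Num.max a (Num.min t b).
exists G, (dg \o c); split; last first.
  move=> t /andP[at_ tb]; rewrite /G ltNge at_/= ltNge tb/= /c.
  by rewrite min_l// max_r.
have cab t : a <= c t <= b by rewrite /c le_max lexx ge_max (ltW ab) ge_min lexx orbT.
split; last first.
  move=> t; apply: continuous_comp; last by apply: cdg; exact: cab.
  apply: continuous_max; first exact: cst_continuous.
  by apply: continuous_min; [exact: cvg_id|exact: cst_continuous].
have DL u t : is_derive t 1 (L u) (dg u).
  rewrite /L; apply: is_derive_eq.
  by rewrite add0r mul1r subr0 [LHS]mulr1.
have La u : L u u = g u by rewrite /L subrr mulr0 addr0.
move=> t /=.
have [ta|ta|ta] := ltgtP t a.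
- have -> : c t = a by rewrite /c max_l// ge_min (ltW ta).
  apply: (@is_derive_either _ (L a) (L a)); rewrite /G ?ta//.
  by near=> y; left; rewrite ifT//; near: y; exact: lt_nbhsl.
- have [tb|tb|tb] := ltgtP b t.
  + have -> : c t = b by rewrite /c min_r ?ltW// max_r// ltW.
    apply: (@is_derive_either _ (L b) (L b)); rewrite /G ?tb ?ltNge ?(ltW ta)//.
    near=> y; left; rewrite ifF ?ifT//; first by near: y; exact: lt_nbhsr.
    by apply/negbTE; rewrite -leNgt ltW//; near: y; exact: lt_nbhsr.
  + have -> : c t = t by rewrite /c min_l ?ltW// max_r// ltW.
    have Gt : G t = g t by rewrite /G ltNge (ltW ta) ltNge (ltW tb).
    have gt : is_derive t 1 g (dg t) by apply: Dg; rewrite (ltW ta) (ltW tb).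
    apply: (is_derive_either (esym Gt) (esym Gt) gt gt).
    near=> y; left; rewrite /G.
    have -> : (y < a) = false by apply/negbTE; rewrite -leNgt ltW//; near: y; exact: lt_nbhsr.
    have -> // : (b < y) = false by apply/negbTE; rewrite -leNgt ltW//; near: y; exact: lt_nbhsl.
  + subst t; have -> : c b = b by rewrite /c minxx max_r// ltW.
    have Gb : G b = g b by rewrite /G ltNge (ltW ta) ltxx.
    have gb : is_derive b 1 g (dg b) by apply: Dg; rewrite lexx (ltW ab).
    apply: (is_derive_either (etrans (La b) (esym Gb)) (esym Gb) (DL b b) gb).
    near=> y; rewrite /G.
    have -> : (y < a) = false by apply/negbTE; rewrite -leNgt ltW//; near: y; exact: lt_nbhsr.
    by case: ltP; [left|right].
- subst t; have -> : c a = a by rewrite /c min_l ?ltW// max_r.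
  have Ga : G a = g a by rewrite /G ltxx ltNge (ltW ab).
  have ga : is_derive a 1 g (dg a) by apply: Dg; rewrite lexx (ltW ab).
  apply: (is_derive_either (etrans (La a) (esym Ga)) (esym Ga) (DL a a) ga).
  near=> y; rewrite /G.
  have -> : (b < y) = false by apply/negbTE; rewrite -leNgt ltW//; near: y; exact: lt_nbhsl.
  by case: ltP; [left|right].
Unshelve. all: by end_near. Qed.

End C1_real.

Section C1_rV.
Context {R : realType}.

(** The directional derivative is carried as an explicit function, so that the product and chain
    rules below return formulas for it; its continuity in the point is asked direction by
    direction. *)
Definition C1_rV n (f : 'rV[R]_n -> R) (df : 'rV[R]_n -> 'rV[R]_n -> R) :=
  [/\ forall x, differentiable f x,
      forall x v, 'D_v f x = df x v & forall v, continuous (df^~ v)].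

Lemma continuous_sumr (T : topologicalType) k (f : 'I_k -> T -> R) :
  (forall i, continuous (f i)) -> continuous (fun x => \sum_i f i x).
Proof.
move=> cf; rewrite -[index_enum _]/(index_enum _).
elim: (index_enum _) => [|i s IH] x.
  under eq_fun do rewrite big_nil; exact: cst_continuous.
under eq_fun do rewrite big_cons.
by apply: (@continuousD _ _ _ (f i)); [exact: cf|exact: IH].
Qed.

Lemma C1_continuous n (f : 'rV[R]_n -> R) df : C1_rV f df -> continuous f.
Proof. by move=> [Df _ _] x; apply: differentiable_continuous. Qed.

Lemma C1_is_derive n (f : 'rV[R]_n -> R) df x v : C1_rV f df -> is_derive x v f (df x v).
Proof.
by move=> [Df E _]; rewrite -E; apply: derivableP; exact: diff_derivable.
Qed.

Lemma C1_coord n (i : 'I_n) : C1_rV (fun x : 'rV[R]_n => x ord0 i) (fun _ v => v ord0 i).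
Proof.
have Dc x : differentiable (fun x : 'rV[R]_n => x ord0 i) x by exact: differentiable_coord.
split => //; last by move=> v; exact: cst_continuous.
move=> x v; rewrite /derive.
apply: cvg_lim => //; apply: cvg_near_cst.
near=> h; rewrite /= !mxE addrK.
by rewrite /GRing.scale /= mulrA mulVf ?mul1r//; near: h; exact: nbhs_dnbhs_neq.
Unshelve. all: by end_near. Qed.

Lemma C1_cst n (c : R) : C1_rV (fun _ : 'rV[R]_n => c) (fun _ _ => 0).
Proof.
split => // [x v|v]; last exact: cst_continuous.
exact: derive_cst.
Qed.

Lemma C1_mul n (f g : 'rV[R]_n -> R) df dg : C1_rV f df -> C1_rV g dg ->
  C1_rV (fun x => f x * g x) (fun x v => f x * dg x v + g x * df x v).
Proof.
move=> Cf Cg; have cf := C1_continuous Cf; have cg := C1_continuous Cg.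
have [Df Ef cdf] := Cf; have [Dg Eg cdg] := Cg.
split => [x|x v|v].
- exact: differentiableM.
- by have [_ E] := is_deriveM (C1_is_derive x v Cf) (C1_is_derive x v Cg); exact: E.
- move=> x; apply: (@continuousD _ _ _ (fun x => f x * dg x v) (fun x => g x * df x v)).
    by apply: (@continuousM _ _ f (dg^~ v)); [exact: cf|exact: cdg].
  by apply: (@continuousM _ _ g (df^~ v)); [exact: cg|exact: cdf].
Qed.

Lemma C1_sum n k (f : 'I_k -> 'rV[R]_n -> R) df : (forall i, C1_rV (f i) (df i)) ->
  C1_rV (fun x => \sum_i f i x) (fun x v => \sum_i df i x v).
Proof.
move=> Cf.
have E : (fun x => \sum_i f i x) = \sum_i f i by apply/funext => x; rewrite fct_sumE.
have Di i x v : derivable (f i) x v by apply: diff_derivable; have [] := Cf i.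
split=> [x|x v|v x].
- by rewrite E; apply: differentiable_sum => i; have [] := Cf i.
- by rewrite E derive_sum//; apply: eq_bigr => i _; have [_ ->] := Cf i.
- by move: x; apply: continuous_sumr => i x; have [_ _] := Cf i; apply.
Qed.

Lemma C1_comp_real n (g dg : R -> R) (f : 'rV[R]_n -> R) df :
  C1_real g dg -> C1_rV f df -> C1_rV (g \o f) (fun x v => dg (f x) * df x v).
Proof.
move=> [Dg cdg] Cf; have cf := C1_continuous Cf; have [Df Ef cdf] := Cf.
have dgx t : differentiable g t by apply/derivable1_diffP; have [] := Dg t.
have D x : differentiable (g \o f) x by exact: differentiable_comp.
split=> // [x v|v x].
- rewrite deriveE// diff_comp//= -(deriveE _ (Df x)) Ef.
  rewrite deriv1E; last by have [] := Dg (f x).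
  by rewrite derive1E; have [_ ->] := Dg (f x); rewrite /= [LHS]mulrC.
- apply: (@continuousM _ _ (dg \o f) (df^~ v)); last exact: cdf.
  by apply: continuous_comp; [exact: cf|exact: cdg].
Qed.

Lemma derive_coordE n (f : 'rV[R]_n -> R) (x v : 'rV[R]_n) : differentiable f x ->
  'D_v f x = \sum_i v ord0 i * 'D_(delta_mx ord0 i) f x.
Proof.
move=> Df; rewrite deriveE// [in LHS](row_sum_delta v) linear_sum.
by apply: eq_bigr => i _; rewrite linearZ/= deriveE.
Qed.

Lemma C1_comp n m (f : 'rV[R]_n -> R) df (g : 'rV[R]_m -> 'rV[R]_n) dg :
  C1_rV f df -> (forall i, C1_rV (fun x => g x ord0 i) (dg i)) ->
  C1_rV (f \o g) (fun x v => \sum_i dg i x v * df (g x) (delta_mx ord0 i)).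
Proof.
move=> Cf Cg; have cf := C1_continuous Cf; have [Df Ef cdf] := Cf.
have gE : g = \sum_i (fun x => g x ord0 i *: delta_mx ord0 i).
  by apply/funext => x; rewrite fct_sumE; exact: row_sum_delta.
have Dg x : differentiable g x.
  rewrite gE; apply: differentiable_sum => i; apply: differentiableZl.
  by have [] := Cg i.
have cg : continuous g by move=> x; exact: differentiable_continuous.
have D x : differentiable (f \o g) x by exact: differentiable_comp.
split=> // [x v|v x].
- rewrite deriveE// diff_comp//= -deriveE// derive_coordE//.
  apply: eq_bigr => i _; rewrite Ef; congr (_ * _).
  rewrite -deriveE// derive_mx; last exact: diff_derivable.
  by rewrite mxE; have [_ ->] := Cg i.
- move: x; apply: continuous_sumr => i x.
  apply: (@continuousM _ _ ((dg i)^~ v)); first by have [_ _] := Cg i; apply.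
  by apply: (@continuous_comp _ _ _ g (df^~ _)); [exact: cg|exact: cdf].
Qed.

Lemma C1_dot n (p : 'rV[R]_n.+1) : C1_rV (fun x => dot x p) (fun _ v => dot v p).
Proof.
have := C1_sum (fun i => C1_mul (C1_coord i) (C1_cst n.+1 (p ord0 i))).
congr C1_rV; apply/funext => x; apply/funext => v.
by apply: eq_bigr => i _; rewrite mulr0 add0r mulrC.
Qed.

Lemma C1_dotxx n : C1_rV (fun x : 'rV[R]_n.+1 => dot x x) (fun x v => 2 * dot x v).
Proof.
have := C1_sum (fun i : 'I_n.+1 => C1_mul (C1_coord i) (C1_coord i)).
congr C1_rV; apply/funext => x; apply/funext => v.
by rewrite mulr_sumr; apply: eq_bigr => i _; rewrite -mulr2n mulr_natl.
Qed.

End C1_rV.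

(** * Smooth functions of one variable built from [exp (- 1 / z)] *)

Section flat.
Context {R : realType}.
Implicit Types (P : {poly R}) (z w : R).

(** Successive derivatives are witnesses rather than iterates of an operator; closure under sums,
    products and affine substitutions is then a plain induction on [k]. *)
Fixpoint Ck k (f : R -> R) : Prop :=
  if k is k'.+1 then exists f' : R -> R, (forall t : R, is_derive t 1 f (f' t)) /\ Ck k' f' else True.

Definition smooth_real (f : R -> R) := forall k, Ck k f.

Lemma is_derive_unique (f f1 f2 : R -> R) : (forall t : R, is_derive t 1 f (f1 t)) ->
  (forall t : R, is_derive t 1 f (f2 t)) -> f1 = f2.
Proof. by move=> D1 D2; apply/funext => t; have [_ <-] := D1 t; have [_ <-] := D2 t. Qed.

Lemma smooth_realP f : smooth_real f ->
  exists f' : R -> R, (forall t : R, is_derive t 1 f (f' t)) /\ smooth_real f'.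
Proof.
move=> sf; have [f' [Df _]] := sf 1%N; exists f'; split=> // k.
by have [f2 [D2 c2]] := sf k.+1; rewrite (is_derive_unique Df D2).
Qed.

Lemma derive_continuous (f f' : R -> R) : (forall t : R, is_derive t 1 f (f' t)) -> continuous f.
Proof.
by move=> Df t; apply/differentiable_continuous/derivable1_diffP; have [] := Df t.
Qed.

Lemma smooth_C1 f f' : smooth_real f -> (forall t : R, is_derive t 1 f (f' t)) -> C1_real f f'.
Proof.
move=> sf Df; split=> //; have [g [Dg]] := smooth_realP sf.
by move=> /smooth_realP[h [Dh _]]; rewrite (is_derive_unique Df Dg); exact: derive_continuous Dh.
Qed.

Lemma CkW k f : Ck k.+1 f -> Ck k f.
Proof.
by elim: k f => // k IH f [f' [Df /IH c]]; exists f'.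
Qed.

Lemma Ck_cst k (c : R) : Ck k (cst c).
Proof.
elim: k c => // k IH c; exists (cst 0); split=> // t; exact: is_derive_cst.
Qed.

Lemma CkD k f g : Ck k f -> Ck k g -> Ck k (f \+ g).
Proof.
elim: k f g => // k IH f g [f' [Df cf]] [g' [Dg cg]].
exists (f' \+ g'); split; last exact: IH.
by move=> t; apply: is_deriveD.
Qed.

Lemma CkM k f g : Ck k f -> Ck k g -> Ck k (f \* g).
Proof.
elim: k f g => // k IH f g Cf Cg; have [f' [Df cf]] := Cf; have [g' [Dg cg]] := Cg.
exists ((f \* g') \+ (g \* f')); split.
  by move=> t; apply: is_deriveM.
by apply: CkD; apply: IH => //; exact: CkW.
Qed.

Lemma Ck_affine k f (a b : R) : Ck k f -> Ck k (fun t => f (a * t + b)).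
Proof.
elim: k f => // k IH f [f' [Df cf]].
exists (fun t => f' (a * t + b) * a); split; last first.
  by apply: (@CkM k (fun t => f' (a * t + b)) (cst a)); [exact: IH|exact: Ck_cst].
move=> t; apply: (@is_derive1_comp _ f (fun t => a * t + b)).
by apply: is_derive_eq; rewrite addr0 [LHS]mulr1.

Qed.

Lemma Ck_horner k P : Ck k (horner P).
Proof.
elim: k P => // k IH P; exists (horner P^`()); split=> // t.
apply: DeriveDef; first exact: derivable_horner.
by rewrite -derive1E -derivE.
Qed.

(** The polynomial in [1 / z] makes the family closed under differentiation, [P] becoming
    [X^2 (P - P')]; smoothness of [exp (- 1 / z)] extended by zero is then one induction over all
    [P] at once. *)
Definition flat P z : R := if 0 < z then P.[z^-1] * expR (- z^-1) else 0.

Lemma exprn_le_expR k w : 0 <= w -> w ^+ k <= k%:R ^+ k * expR w.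
Proof.
case: k => [|k] w0; first by rewrite !expr0 mul1r (le_trans _ (expR_ge1Dx w))// lerDl.
have -> : expR w = expR (w / k.+1%:R) ^+ k.+1 by rewrite -expRM_natl mulrCA divff ?mulr1.
rewrite -exprMn lerXn2r ?nnegrE ?mulr_ge0 ?expR_ge0//.
rewrite -ler_pdivrMl// mulrC; apply: le_trans (expR_ge1Dx _).
by rewrite lerDr.
Qed.

Lemma horner_le_expR P : exists C, 0 <= C /\ forall w, 0 <= w -> `|P.[w]| <= C * expR w.
Proof.
exists (\sum_(i < size P) `|P`_i| * i%:R ^+ i); split.
  by apply: sumr_ge0 => i _; rewrite mulr_ge0// exprn_ge0.
move=> w w0; rewrite horner_coef mulr_suml (le_trans (ler_norm_sum _ _ _))//.
apply: ler_sum => i _; rewrite normrM -mulrA ler_wpM2l// ger0_norm ?exprn_ge0//.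
exact: exprn_le_expR.
Qed.

Lemma flat_derive P z : is_derive z 1 (flat P) (flat ('X^2 * (P - P^`())) z).
Proof.
have [z0|z0|->] := ltgtP z 0.
- rewrite {2}/flat ltNge (ltW z0)/=.
  apply: (is_derive_either (h1 := cst 0) (h2 := cst 0)); rewrite /flat ?[0 < z]ltNge ?(ltW z0)//.
  near=> y; left; rewrite ltNge (_ : y <= 0)//.
  by rewrite ltW//; near: y; exact: lt_nbhsl.
- have zn0 : z != 0 by rewrite gt_eqF.
  pose g := (horner P \o GRing.inv) \* (expR \o (-%R \o GRing.inv)).
  have Di : is_derive z 1 (@GRing.inv R) (- (z ^- 2)).
    apply: is_derive_eq; first exact: is_deriveV.
    by rewrite [LHS]mulr1.
  have Dh : is_derive z^-1 1 (horner P) (P^`()).[z^-1].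
    apply: DeriveDef; first exact: derivable_horner.
    by rewrite -derive1E -derivE.
  have D1 := is_derive1_comp Dh Di.
  have DN : is_derive z 1 (-%R \o @GRing.inv R) (z ^- 2).
    by rewrite -[z ^- 2]opprK; exact: is_deriveN.
  have D2 := is_derive1_comp (is_derive_expR _) DN.
  have D : is_derive z 1 g (flat ('X^2 * (P - P^`())) z).
    apply: (is_derive_eq (is_deriveM D1 D2)).
    rewrite /flat z0 /= !hornerE /GRing.scale/= !exprVn.
    ring.
  apply: (is_derive_either _ _ D D) => //; rewrite /flat ?z0//.
  near=> y; left; rewrite ifT//; near: y; exact: lt_nbhsr.
- rewrite {2}/flat ltxx.
  (* The extra factor [X^2] yields [|flat P h| <= C h^2], so the difference quotient at [0] tends to
     [0]. *)
  have [C [C0 hC]] := horner_le_expR (P * 'X^2).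
  have fC h : `|flat P h| <= C * h ^+ 2.
    rewrite /flat; case: ltP => h0; last by rewrite normr0 mulr_ge0// sqr_ge0.
    have := hC h^-1; rewrite invr_ge0 (ltW h0) => /(_ isT).
    rewrite hornerM hornerXn normrM (ger0_norm (sqr_ge0 _)).
    rewrite (normrM _ (expR _)) (ger0_norm (expR_ge0 _)) expRN => hh.
    rewrite ler_pdivrMr ?expR_gt0// mulrAC -ler_pdivrMr ?exprn_gt0//.
    by rewrite -exprVn.
  have c : (fun k : R => k^-1 *: ((flat P \o shift (0:R)) (k *: (1 : R)) - flat P 0)) @ 0^' --> (0:R).
    apply/cvgr0Pnorm_lt => e e0; near=> k.
    rewrite /= addr0 [k *: 1]mulr1 {2}/flat ltxx subr0 normrZ.
    have k0 : 0 < `|k| by rewrite normr_gt0; near: k; exact: nbhs_dnbhs_neq.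
    rewrite normfV ltr_pdivrMl//; apply: le_lt_trans (fC k) _.
    rewrite -real_normK ?num_real// expr2 mulrCA ltr_pM2l//.
    apply: (@le_lt_trans _ _ ((C + 1) * `|k|)); first by rewrite ler_wpM2r// lerDl.
    rewrite -ltr_pdivlMl ?ltr_wpDl//.
    by near: k; apply: dnbhs0_lt; rewrite mulr_gt0// invr_gt0 ltr_wpDl.
  apply: DeriveDef; first by apply/cvg_ex; exists 0.
  exact: (cvg_lim _ c).
Unshelve. all: by end_near. Qed.

Lemma flat_smooth P : smooth_real (flat P).
Proof.
move=> k; elim: k P => // k IH P; exists (flat ('X^2 * (P - P^`()))); split => //.
exact: flat_derive.
Qed.
End flat.

(** * The divergence theorem on the sphere *)

Section rotation.
Context {R : realType} {n : nat}.
Notation V := 'rV[R]_n.+1.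
Notation E_ i := (delta_mx ord0 i : V).
Implicit Types (x y : V).

Lemma dotC x y : dot x y = dot y x.
Proof. by apply: eq_bigr => i _; rewrite mulrC. Qed.

Lemma dotDl x y z : dot (x + y : V) z = dot x z + dot y z.
Proof. by rewrite -big_split; apply: eq_bigr => i _; rewrite mxE mulrDl. Qed.

Lemma dotZl a x y : dot (a *: x : V) y = a * dot x y.
Proof. by rewrite mulr_sumr; apply: eq_bigr => i _; rewrite mxE mulrA. Qed.

Lemma dot_delta x i : dot x (E_ i) = x ord0 i.
Proof.
rewrite /dot (bigD1 i)//= mxE !eqxx mulr1 big1 ?addr0// => k ki.
by rewrite mxE eqxx (negbTE ki) mulr0.
Qed.

Lemma dotxx_ge0 x : 0 <= dot x x.
Proof. by apply: sumr_ge0 => i _; rewrite -expr2 sqr_ge0. Qed.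

Lemma dot_ball0 x M : 0 < M -> dot x x < M ^+ 2 -> ball 0 M x.
Proof.
move=> M0 xM; split => // i j; rewrite /ball/= mxE sub0r normrN (ord1 i).
rewrite -(ltr_pXn2r (ltn0Sn 1)) ?nnegrE// ?(ltW M0)// real_normK ?num_real//.
apply: le_lt_trans xM; rewrite /dot (bigD1 j)//= -expr2 lerDl.
by apply: sumr_ge0 => k _; rewrite -expr2 sqr_ge0.
Qed.

Lemma continuous_dotxx : continuous (fun x : V => dot x x).
Proof. exact: C1_continuous (C1_dotxx n). Qed.

Section cutoff.
Variables (F : V -> R) (dF : V -> V -> R) (chi dchi m dm : R -> R).
Hypotheses (CF : C1_rV F dF) (Cchi : C1_real chi dchi) (Cm : C1_real m dm).
Hypothesis chi0 : forall s, 4 <= s -> chi s = 0.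

(** For [m s = s^(-1/2)] on the support of [chi], [g] is the radial projection there, and it stays
    C^1 at the origin. *)
Let g x : V := m (dot x x) *: x.
Let H x := chi (dot x x) * F (g x).

(* The integrand is the rotation field [x_i d_j - x_j d_i] applied to [H]: the
   derivative of [chi] drops out because [|x|^2] is invariant under rotations. *)
Lemma integral_rotation_cutoff i j : i != j ->
  (\int[lebesgue_rV n.+1]_x (chi (dot x x) * (m (dot x x) *
     (x ord0 i * dF (g x) (E_ j) - x ord0 j * dF (g x) (E_ i))))%:E = 0)%E.
Proof.
move=> ij.
have Cg k : C1_rV (fun x => g x ord0 k) (fun x v => m (dot x x) * v ord0 k + x ord0 k * (dm (dot x x) * (2 * dot x v))).
  have -> : (fun x => g x ord0 k) = (fun x => m (dot x x) * x ord0 k).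
    by apply/funext => x; rewrite mxE.
  exact: (C1_mul (C1_comp_real Cm (C1_dotxx n)) (C1_coord k)).
(* Everything except the first summand is [x_l] times a factor that does not depend on [l], hence
   cancels in [x_i dH_j - x_j dH_i]; this covers the derivatives of [chi] and of [m] alike. *)
have [dH CH dHE] : exists2 dH, C1_rV H dH & forall x l, dH x (E_ l) =
   chi (dot x x) * (m (dot x x) * dF (g x) (E_ l)) +
   x ord0 l * (2 * (chi (dot x x) * dm (dot x x) *
     (\sum_k x ord0 k * dF (g x) (E_ k)) + F (g x) * dchi (dot x x))).
  eexists; first exact: (C1_mul (C1_comp_real Cchi (C1_dotxx n)) (C1_comp CF Cg)).
  move=> x l /=; rewrite dot_delta.
  under eq_bigr do rewrite mulrDl.
  rewrite big_split/= (bigD1 l)//= big1 => [|k kl]; last first.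
    by rewrite mxE eqxx (negbTE kl)/= mulr0 mul0r.
  rewrite mxE !eqxx mulr1 addr0.
  have -> : \sum_k x ord0 k * (dm (dot x x) * (2 * x ord0 l)) * dF (g x) (E_ k) =
      dm (dot x x) * (2 * x ord0 l) * \sum_k x ord0 k * dF (g x) (E_ k).
    by rewrite mulr_sumr; apply: eq_bigr => k _; ring.
  ring.
have H0 x : ~ ball 0 2 x -> H x = 0.
  move=> xb; rewrite /H chi0 ?mul0r// leNgt; apply/negP => x4; apply: xb.
  by apply: dot_ball0 => //; rewrite -natrX.
(* For [k != l] the integrand is the partial derivative along [l] of [x_k H], which has compact
   support. *)
have int_k k l : k != l -> (lebesgue_rV n.+1).-integrable setT (fun x => (x ord0 k * dH x (E_ l))%:E) /\
   (\int[lebesgue_rV n.+1]_x (x ord0 k * dH x (E_ l))%:E = 0)%E.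
  move=> kl; have CxH := C1_mul (C1_coord k) CH.
  have [D E cd] := CxH.
  have EE : 'D_(E_ l) (fun x => x ord0 k * H x) = (fun x => x ord0 k * dH x (E_ l)).
    apply/funext => x; rewrite E mxE eqxx/= (negbTE kl) mulr0 addr0//.
  have xH0 x : ~ ball 0 2 x -> x ord0 k * H x = 0 by move=> /H0 ->; rewrite mulr0.
  have c : continuous (fun x => x ord0 k * dH x (E_ l)).
    have -> : (fun x => x ord0 k * dH x (E_ l)) = (fun x => x ord0 k * dH x (E_ l) + H x * (E_ l) ord0 k).
      by apply/funext => y; rewrite mxE eqxx/= (negbTE kl) mulr0 addr0.
    exact: cd.
  have out x : ~ ball 0 (2 + 1) x -> x ord0 k * dH x (E_ l) = 0.
    move=> xo; rewrite -[LHS]/((fun x => x ord0 k * dH x (E_ l)) x) -EE.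
    exact: (derive_outside_ball _ xH0).
  split; first exact: integrable_supported c out.
  transitivity (\int[lebesgue_rV n.+1]_x ('D_(E_ l) (fun x => x ord0 k * H x) x)%:E)%E.
    by apply: eq_integral => x _; congr EFin; exact: (esym (congr1 (fun h => h x) EE)).
  apply: (integral_partial_supported _ _ xH0).
  - by move=> x; apply: diff_derivable; exact: D.
  - by move: c; rewrite -EE.
have [i1 e1] := int_k _ _ ij; have /int_k[i2 e2] : j != i by rewrite eq_sym.
transitivity (\int[lebesgue_rV n.+1]_x ((x ord0 i * dH x (E_ j))%:E - (x ord0 j * dH x (E_ i))%:E)%E)%E; last first.
  by rewrite integralB// e1 e2 subee.
apply: eq_integral => x _; rewrite -EFinB; congr EFin.
by rewrite !dHE; ring.
Qed.

End cutoff.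

Definition punctured_ball : set V := [set x | 0 < dot x x <= 1].

Lemma measurable_punctured_ball : measurable punctured_ball.
Proof.
rewrite (_ : punctured_ball = (fun x => dot x x) @^-1` `]0, 1]).
  by rewrite -[X in measurable X]setTI; exact: measurable_dotxx.
by apply/seteqP; split=> x /=; rewrite in_itv.
Qed.

End rotation.

Section flat_one.
Context {R : realType}.

Definition flat1 : R -> R := flat 1.

Lemma flat1_ge0 z : 0 <= flat1 z.
Proof. by rewrite /flat1 /flat; case: ifP => // _; rewrite hornerC mul1r expR_ge0. Qed.

Lemma flat1_le1 z : flat1 z <= 1.
Proof.
rewrite /flat1 /flat; case: ifPn => // z0; rewrite hornerC mul1r.
by rewrite -[leRHS]expR0 ler_expR oppr_le0 invr_ge0 ltW.
Qed.

Lemma flat1_le0 z : z <= 0 -> flat1 z = 0.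
Proof. by rewrite /flat1 /flat ltNge => ->. Qed.

Lemma flat1_neq0 z : flat1 z != 0 -> 0 < z.
Proof. by apply: contraNT; rewrite -leNgt => /flat1_le0 ->. Qed.

Lemma flat1_ge z : 0 < z -> 1 - z^-1 <= flat1 z.
Proof. by move=> z0; rewrite /flat1 /flat z0 hornerC mul1r; exact: expR_ge1Dx. Qed.

Lemma flat1_cvg1 (u : nat -> R) : u @ \oo --> +oo -> flat1 \o u @ \oo --> (1 : R).
Proof.
move=> uoo.
have u0 : \forall k \near \oo, 0 < u k by move/cvgryPgt : uoo; exact.
have ui : (fun k => (u k)^-1) @ \oo --> (0 : R) by apply/(gtr0_cvgV0 u0).
have cl : (fun k => 1 - (u k)^-1) @ \oo --> (1 : R).
  by rewrite -[X in _ --> X]subr0; apply: cvgB => //; exact: cvg_cst.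
apply: (squeeze_cvgr _ cl (cvg_cst _)).
by near=> k; rewrite /= flat1_le1 andbT flat1_ge//; near: k.
Unshelve. all: by end_near. Qed.

End flat_one.

Lemma inv_sqrt_extension (R : realType) (a b : R) : 0 < a -> a < b ->
  exists m dm, C1_real m dm /\ forall s, a <= s <= b -> m s = (Num.sqrt s)^-1.
Proof.
move=> a0 ab; have [||m [dm [Cm mE]]] := @C1_extension R a b (fun s => (Num.sqrt s)^-1)
      (fun s => - (Num.sqrt s) ^- 2 * (2 * Num.sqrt s)^-1) ab.
- move=> t /andP[t0 _]; have {}t0 : 0 < t by exact: lt_le_trans t0.
  apply: is_derive_eq.
    by apply: is_deriveV; rewrite ?gt_eqF ?sqrtr_gt0//; exact: is_derive1_sqrt.
  by rewrite /GRing.scale/=.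
- move=> t /andP[t0 _]; have {}t0 : 0 < t by exact: lt_le_trans t0.
  have st : Num.sqrt t != 0 by rewrite gt_eqF ?sqrtr_gt0.
  have cs : {for t, continuous (@Num.sqrt R)} by exact: sqrt_continuous.
  apply: (@continuousM _ _ (fun s : R => - (Num.sqrt s) ^- 2) (fun s => (2 * Num.sqrt s)^-1)).
    apply: (@continuousN _ _ _ (fun s : R => (Num.sqrt s) ^- 2)).
    apply: (@continuousV _ _ (fun s : R => (Num.sqrt s) ^+ 2)); first by rewrite expf_neq0.
    by apply: (@continuous_comp _ _ _ (@Num.sqrt R) (fun s => s ^+ 2)) => //; exact: exprn_continuous.
  apply: (@continuousV _ _ (fun s : R => 2 * Num.sqrt s)); first by rewrite mulf_neq0.
  by apply: (@continuousM _ _ (cst 2) (@Num.sqrt R)) => //; exact: cst_continuous.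
by exists m, dm; split => // s /mE[].
Qed.

Section ball_rotation.
Context {R : realType} {n : nat}.
Notation V := 'rV[R]_n.+1.
Notation E_ i := (delta_mx ord0 i : V).
Implicit Types (x y : V).

(* A C^1 approximation, with zero limit at the origin, of the indicator of
   ]0, 1]: it vanishes outside [1/(k+1), 1 + 1/(k+1)]. *)
Definition ball_cutoff k (s : R) := flat1 (k.+1%:R * s + -1) * flat1 (- k.+1%:R ^+ 2 * s + (k.+1%:R + k.+1%:R ^+ 2)).

Lemma ball_cutoff_C1 k : exists d, C1_real (ball_cutoff k) d.
Proof.
have s : smooth_real (ball_cutoff k).
  move=> l; apply: (@CkM _ l (fun s => flat1 (k.+1%:R * s + -1))); apply: Ck_affine; exact: flat_smooth.
by have [d [D _]] := smooth_realP s; exists d; exact: smooth_C1.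
Qed.

Lemma ball_cutoff_ge0 k s : 0 <= ball_cutoff k s.
Proof. by rewrite mulr_ge0// flat1_ge0. Qed.

Lemma ball_cutoff_le1 k s : ball_cutoff k s <= 1.
Proof. by rewrite /ball_cutoff mulr_ile1 ?flat1_ge0 ?flat1_le1. Qed.

Lemma ball_cutoff_neq0 k s : ball_cutoff k s != 0 -> k.+1%:R^-1 <= s <= 2.
Proof.
rewrite mulf_eq0 negb_or => /andP[/flat1_neq0 h1 /flat1_neq0 h2].
have k0 : 0 < k.+1%:R :> R by [].
have k1 : 1 <= k.+1%:R :> R by rewrite ler1n.
apply/andP; split; first by rewrite -div1r ler_pdivrMr// mulrC; lra.
rewrite -(ler_pM2l (exprn_gt0 2 k0)); nra.
Qed.

Lemma ball_cutoff_cvg s : ball_cutoff ^~ s @ \oo --> (if 0 < s <= 1 then 1 else 0 : R).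
Proof.
have kinf : (fun k => k.+1%:R : R) @ \oo --> +oo.
  by apply/cvgryPge => A; near=> k; rewrite ltW// (lt_le_trans _ (_ : k%:R <= _)) ?ler_nat//; near: k; exact: nbhs_infty_gtr.
have [s0|s0] := ltP 0 s; last first.
  rewrite (_ : ball_cutoff ^~ s = cst 0); first exact: cvg_cst.
  apply/funext => k; apply/eqP; apply: contraTT s0 => /ball_cutoff_neq0/andP[+ _].
  by rewrite -ltNge; apply: lt_le_trans.
have [s1|s1] /= := leP s 1.
  rewrite -[X in _ --> X](mulr1 1); apply: cvgM; apply: flat1_cvg1.
    apply/cvgryPge => A; near=> k; rewrite -lerBlDr -ler_pdivrMr//.
    by near: k; move/cvgryPge : kinf; exact.
  (* The argument is [(k + 1) + (k + 1)^2 (1 - s)]: the linear term makes it diverge at [s = 1] as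
     well, so that the limit indicator contains the unit sphere. *)
  apply/cvgryPge => A; near=> k.
  have : A <= k.+1%:R by near: k; move/cvgryPge : kinf; exact.
  have : 0 <= k.+1%:R ^+ 2 * (1 - s) by rewrite mulr_ge0 ?subr_ge0// sqr_ge0.
  move=> /=; move: (k.+1%:R : R) => K; nra.
apply: cvg_near_cst; near=> k.
rewrite /ball_cutoff (@flat1_le0 _ (_ + (_ + _))) ?mulr0//.
have : (s - 1)^-1 <= k.+1%:R by near: k; move/cvgryPge : kinf; exact.
have s10 : 0 < s - 1 by rewrite subr_gt0.
rewrite -div1r ler_pdivrMr//.
have : 0 < k.+1%:R :> R by [].
move: (k.+1%:R : R) => K K0 h; nra.
Unshelve. all: by end_near. Qed.

Lemma sphere_normalize x : 0 < dot x x -> sphere (normalize x).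
Proof.
move=> x0; rewrite /sphere/= /normalize dotZl dotC dotZl mulrA -invfM -expr2.
by rewrite sqr_sqrtr ?ltW// mulVf// gt_eqF.
Qed.

Lemma sphere_coord y i : sphere y -> `|y ord0 i| <= 1.
Proof.
move=> ys; rewrite -(ler_pXn2r (ltn0Sn 1)) ?nnegrE// real_normK ?num_real//.
rewrite expr1n -[leRHS]ys /dot (bigD1 i)//= -expr2 lerDl.
by apply: sumr_ge0 => k _; rewrite -expr2 sqr_ge0.
Qed.

Lemma sphere_bounded (h : V -> R) : continuous h -> exists C, 0 <= C /\ forall y, sphere y -> `|h y| <= C.
Proof.
move=> ch; have [C hC] := compact_bounded_rV (@compact_box R n.+1 1) ch.
have h' y : sphere y -> `|h y| <= C.
  by move=> ys; apply: hC => i /=; rewrite in_itv/= -ler_norml; exact: sphere_coord.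
by exists `|C|; split => // y /h' /le_trans; apply; exact: ler_norm.
Qed.

Variables (F : V -> R) (dF : V -> V -> R).
Hypothesis CF : C1_rV F dF.
Let L i j y := y ord0 i * dF y (E_ j) - y ord0 j * dF y (E_ i).

Lemma continuous_rot i j : continuous (L i j).
Proof.
have [_ _ cd] := CF.
move=> y; apply: (@continuousB _ _ _ (fun y => y ord0 i * dF y (E_ j)) (fun y => y ord0 j * dF y (E_ i))).
  by apply: (@continuousM _ _ (fun y => y ord0 i) (dF^~ (E_ j))); [exact: coord_continuous|exact: cd].
by apply: (@continuousM _ _ (fun y => y ord0 j) (dF^~ (E_ i))); [exact: coord_continuous|exact: cd].
Qed.

(** Dominated convergence along [ball_cutoff], whose integrals vanish by [integral_rotation_cutoff];
    the bound is the maximum of the rotated function on the sphere times the indicator of a cube. *)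
Lemma integral_ball_rotation i j :
  (\int[lebesgue_rV n.+1]_(x in punctured_ball) (L i j (normalize x))%:E = 0)%E.
Proof.
have [->|ij] := eqVneq i j.
  by under eq_integral do rewrite /L subrr; rewrite integral0.
have [C [C0 hC]] := sphere_bounded (@continuous_rot i j).
pose f k x := (ball_cutoff k (dot x x) * L i j (normalize x))%:E.
have mL : measurable_fun setT (fun x => L i j (normalize x)).
  apply: (measurableT_comp (continuous_measurable_rV (@continuous_rot i j))).
  exact: measurable_normalize.
have fint k : (\int[lebesgue_rV n.+1]_x f k x = 0)%E.
  have [d Cd] := ball_cutoff_C1 k.
  have k0 : 0 < k.+1%:R^-1 :> R by rewrite invr_gt0.
  have ab : k.+1%:R^-1 < 4 :> R.
    by rewrite (@le_lt_trans _ _ 1) ?ltr1n// invf_le1// ler1n.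
  (* The interval from [1 / (k + 1)] to [4] contains the support of the cutoff, so [m] is the
     inverse square root wherever the integrand is not zero. *)
  have [m [dm [Cm mE]]] := inv_sqrt_extension k0 ab.
  rewrite -(@integral_rotation_cutoff R n F dF (ball_cutoff k) d m dm CF Cd Cm _ i j ij); last first.
    move=> s s4; apply/eqP; apply: contraLR s4 => /ball_cutoff_neq0 /andP[_ s2].
    by rewrite -ltNge (le_lt_trans s2)// ltr_nat.
  apply: eq_integral => x _; congr EFin.
  have [->|/ball_cutoff_neq0/andP[x1 x2]] := eqVneq (ball_cutoff k (dot x x)) 0; first by rewrite !mul0r.
  have /mE -> : k.+1%:R^-1 <= dot x x <= 4 by rewrite x1 (le_trans x2)// ler_nat.
  by rewrite /L /normalize !mxE; ring.
have cv : (fun k => \int[lebesgue_rV n.+1]_x f k x)%E @ \oo -->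
  (\int[lebesgue_rV n.+1]_x ((fun x => (L i j (normalize x))%:E) \_ punctured_ball) x)%E.
  apply: (@dominated_cvg _ _ _ _ _ _ _ _ (fun x => (C * \1_(ball 0 2) x)%:E)) => //.
  - move=> k; apply/measurable_EFinP/measurable_funM => //.
    have [d [/derive_continuous c _]] := ball_cutoff_C1 k.
    by apply: (measurableT_comp (continuous_measurable_fun c)); exact: measurable_dotxx.
  - move=> x _; rewrite patchE /f.
    have -> : (if x \in punctured_ball then (L i j (normalize x))%:E else 0%E) =
       ((if 0 < dot x x <= 1 then 1 else 0) * L i j (normalize x))%:E.
      have [xb|xb] := boolP (0 < dot x x <= 1); first by rewrite mem_set ?mul1r.
      by rewrite memNset ?mul0r//; exact/negP.
    apply: cvg_EFin; first by near=> k.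
    apply: (@cvgM _ _ _ _ (fun k => ball_cutoff k (dot x x)) (cst _)); first exact: ball_cutoff_cvg.
    exact: cvg_cst.
  - have mb := @measurable_ball_rV R n.+1 0 2.
    apply: (@eq_integrable _ _ _ (lebesgue_rV n.+1) setT measurableT ((EFin \o cst C) \_ (ball 0 2))) => [x _|].
      rewrite patchE indicE /=.
      by case: ifPn => xb; rewrite ?mulr1 ?mulr0.
    apply/(integrable_mkcond _ mb); apply: measurable_bounded_integrable => //.
      by rewrite [X in (X < _)%E]lebesgue_rV_ball// ltry.
    exact: bounded_cst.
  - move=> k x _; rewrite /f abse_EFin lee_fin normrM (ger0_norm (ball_cutoff_ge0 _ _)).
    have [->|/ball_cutoff_neq0/andP[x1 x2]] := eqVneq (ball_cutoff k (dot x x)) 0; first by rewrite mul0r mulr_ge0.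
    have x0 : 0 < dot x x by apply: lt_le_trans x1; rewrite invr_gt0.
    rewrite indicE mem_set ?mulr1; last first.
      by apply: dot_ball0 => //; rewrite (le_lt_trans x2)// -natrX ltr_nat.
    rewrite -[leRHS]mul1r ler_pM// ?ball_cutoff_ge0 ?ball_cutoff_le1//.
    by apply: hC; exact: sphere_normalize.
rewrite integral_mkcond; apply: cvg_unique cv _ => //.
rewrite (_ : (fun k => _) = cst 0%E); first exact: cvg_cst.
by apply/funext => k; exact: fint.
Unshelve. all: by end_near. Qed.

End ball_rotation.

(** Scaling, push-forward and restriction are undone one after the other; the part of the preimage
    of [D] outside [B] is negligible for the restricted measure. *)
Lemma ge0_integral_mscale_pushforward_mrestr d1 d2 (X : measurableType d1)
  (Y : measurableType d2) (R : realType) (mu : {measure set X -> \bar R})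
  (m : {measure set Y -> \bar R}) (B : set X) (mB : measurable B) (phi : X -> Y)
  (k : {nonneg R}) (D : set Y) (f : Y -> \bar R) :
  measurable_fun setT phi ->
  (forall A, measurable A -> m A = mu (phi @^-1` A `&` B)) ->
  measurable D -> measurable_fun setT f -> (forall y, 0 <= f y)%E ->
  (\int[mscale k m]_(y in D) f y =
   k%:num%:E * \int[mu]_(x in phi @^-1` D `&` B) f (phi x))%E.
Proof.
move=> mphi mE mD mf f0.
have mfphi : measurable_fun setT (f \o phi) by exact: measurableT_comp.
have mphiD : measurable (phi @^-1` D) by rewrite -[X in measurable X]setTI; exact: mphi.
rewrite ge0_integral_mscale//; last exact: measurable_funTS.
congr (_ * _)%E.
pose pm := measure_function_pushforward__canonical__measure_function_Measure (mrestr mu mB) mphi.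
rewrite (@eq_measure_integral _ _ _ D pm); last first.
  by move=> A mA _; rewrite mE.
rewrite ge0_integral_pushforward//; last exact: measurable_funTS.
rewrite (@ge0_negligible_integral _ _ _ _ _ (phi @^-1` D `\` B))//; last 4 first.
- exact: measurableD.
- exact: measurable_funTS.
- by move=> x _; exact: f0.
- by rewrite /= /mrestr setDE -setIA setICl setI0 measure0.
rewrite setDD; apply: eq_measure_integral => A mA AB.
by rewrite /= /mrestr setIidl// => x /AB [].
Qed.

Section sphere_integral.
Context {R : realType} {n : nat}.
Notation V := 'rV[R]_n.+1.
Notation E_ i := (delta_mx ord0 i : V).
Notation sigma := (@sphere_measure R n).
Implicit Types (x y : V).

Lemma measurable_sphere : measurable (@sphere R n).
Proof.
rewrite (_ : sphere = (fun x => dot x x) @^-1` [set 1])//.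
by rewrite -[X in measurable X]setTI; exact: measurable_dotxx.
Qed.

(** The convention [0^-1 = 0] gives [normalize 0 = 0], which is not on the sphere; hence the
    integrals over a punctured ball. *)
Lemma normalize_sphere : normalize @^-1` (@sphere R n) = [set x | 0 < dot x x].
Proof.
apply/seteqP; split => x /=; last exact: sphere_normalize.
move=> xs; rewrite lt_neqAle dotxx_ge0 andbT; apply/eqP => x0.
move: xs; rewrite /sphere/= /normalize dotZl dotC dotZl -x0 !mulr0 => /eqP.
by rewrite eq_sym oner_eq0.
Qed.

Lemma ge0_integral_sphere (f : V -> \bar R) : measurable_fun setT f ->
  (forall x, 0 <= f x)%E ->
  (\int[sigma]_(x in sphere) f x = n.+1%:R%:E * \int[lebesgue_rV n.+1]_(x in punctured_ball) f (normalize x))%E.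
Proof.
move=> mf f0.
rewrite (_ : punctured_ball = normalize @^-1` (@sphere R n) `&` unit_ball).
  by apply: ge0_integral_mscale_pushforward_mrestr => //;
    [exact: measurable_unit_ball|exact: measurable_normalize|exact: measurable_sphere].
rewrite normalize_sphere; apply/seteqP; split => x /=; first by move=> /andP[].
by move=> [h1 h2]; apply/andP.
Qed.

Lemma sphere_measure_fin : (sigma sphere < +oo)%E.
Proof.
have := @ge0_integral_sphere (cst 1%E) (measurable_cst _) (fun _ => lee01).
rewrite !integral_cst ?mul1e//; [|exact: measurable_punctured_ball|exact: measurable_sphere].
move=> ->; rewrite lte_mul_pinfty//.
have h : (lebesgue_rV n.+1 (@punctured_ball R n) <= lebesgue_rV n.+1 (ball (0%R : V) 2%R))%E.
  apply: le_measure; rewrite ?inE; [exact: measurable_punctured_ball|exact: measurable_ball_rV|].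
  move=> x /andP[_ x1]; apply: dot_ball0 => //; apply: (le_lt_trans x1).
  by rewrite -natrX ltr1n.
by apply: le_lt_trans h _; rewrite lebesgue_rV_ball// ltry.
Qed.

Lemma integrable_sphere_bounded (f : V -> R) C : measurable_fun sphere f ->
  (forall x, sphere x -> `|f x| <= C) -> sigma.-integrable sphere (EFin \o f).
Proof.
move=> mf fC; apply: measurable_bounded_integrable => //.
- exact: measurable_sphere.
- exact: sphere_measure_fin.
- exists C; split; first exact: num_real.
  by move=> D CD x /fC /le_trans; apply; exact: ltW.
Qed.

Lemma integrable_sphere_continuous (f : V -> R) : continuous f ->
  sigma.-integrable sphere (EFin \o f).
Proof.
move=> cf; have [C [_ hC]] := sphere_bounded cf.
apply: integrable_sphere_bounded hC.
by apply: measurable_funTS; exact: continuous_measurable_rV.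
Qed.

(** [ge0_integral_sphere] is for nonnegative functions, so positive and negative parts are treated
    apart; boundedness on the sphere makes both finite and the subtraction legitimate. *)
Lemma sphere_integral0 (f : V -> R) : continuous f ->
  (\int[lebesgue_rV n.+1]_(x in punctured_ball) (f (normalize x))%:E = 0)%E ->
  (\int[sigma]_(x in sphere) (f x)%:E = 0)%E.
Proof.
move=> cf f0; have mf := continuous_measurable_rV cf.
have mE : measurable_fun setT (EFin \o f) by exact/measurable_EFinP.
have [ip im] : (\int[sigma]_(x in sphere) ((EFin \o f)^\+ x) \is a fin_num)%E /\ (\int[sigma]_(x in sphere) ((EFin \o f)^\- x) \is a fin_num)%E.
  have i := integrable_sphere_continuous cf.
  rewrite !ge0_fin_numE ?integral_ge0//; split.
    by apply: integral_funepos_lt_pinfty => //; exact: measurable_sphere.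
  by apply: integral_funeneg_lt_pinfty => //; exact: measurable_sphere.
rewrite integralE in f0; rewrite integralE.
move: ip im f0.
have mp := measurable_funepos mE; have mm := measurable_funeneg mE.
rewrite (ge0_integral_sphere mp)// (ge0_integral_sphere mm)//.
have -> : ((fun x => (f (normalize x))%:E)^\+ = (fun x => (EFin \o f)^\+ (normalize x)))%E.
  exact: (@funepos_comp _ _ _ (EFin \o f) normalize).
have -> : ((fun x => (f (normalize x))%:E)^\- = (fun x => (EFin \o f)^\- (normalize x)))%E.
  exact: (@funeneg_comp _ _ _ (EFin \o f) normalize).
set A := integral _ _ _; set B := integral _ _ _.
move=> NA NB AB.
have fin (X : \bar R) : (n.+1%:R%:E * X)%E \is a fin_num -> X \is a fin_num.
  have N0 : (0 < n.+1%:R%:E :> \bar R)%E by rewrite lte_fin.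
  by case: X => [r//| |]; rewrite (gt0_muley N0, gt0_muleNy N0).
have fA := fin _ NA; have fB := fin _ NB.
rewrite -muleBr//; last by rewrite fin_num_adde_defl// fin_numN.
by rewrite AB mule0.
Qed.

Lemma sphere_rotation (F : V -> R) dF i j : C1_rV F dF ->
  (\int[sigma]_(y in sphere) (y ord0 i * dF y (E_ j) - y ord0 j * dF y (E_ i))%:E = 0)%E.
Proof.
by move=> CF; apply: sphere_integral0; [exact: (continuous_rot CF)|exact: (integral_ball_rotation CF)].
Qed.

Lemma C1_linear (f : V -> R) df x v : C1_rV f df -> df x v = \sum_i v ord0 i * df x (E_ i).
Proof.
by move=> [Df E _]; rewrite -E derive_coordE//; apply: eq_bigr => i _; rewrite E.
Qed.

(** The field [p - (y.p) y] has divergence [- n (y.p)] on the sphere. Applying the rotation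
    [y_i d_j - y_j d_i] to [y_i Q] and summing over [i] gives, as [|y| = 1],
    [d_j Q - y_j (n Q + dQ y y)]; weighting by [p_j] and summing over [j] yields the integrand. *)
Lemma sphere_divergence (Q : V -> R) dQ (p : V) : C1_rV Q dQ ->
  (\int[sigma]_(y in sphere) (dQ y (p - dot y p *: y) - n%:R * dot y p * Q y)%:E = 0)%E.
Proof.
move=> CQ; have cQ := C1_continuous CQ; have [_ _ cd] := CQ.
pose L (k : 'I_n.+1 * 'I_n.+1) y :=
  y ord0 k.1 * (Q y * (E_ k.2) ord0 k.1 + y ord0 k.1 * dQ y (E_ k.2)) -
  y ord0 k.2 * (Q y * (E_ k.1) ord0 k.1 + y ord0 k.1 * dQ y (E_ k.1)).
pose g k y := p ord0 k.2 * L k y.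
have CF i := C1_mul CQ (C1_coord i).
have cL k : continuous (L k) by exact: (continuous_rot (CF k.1)).
have ig k : sigma.-integrable sphere (fun y => (g k y)%:E).
  apply: (integrable_sphere_continuous (f := g k)).
  move=> y; apply: (@continuousM _ _ (cst (p ord0 k.2)) (L k)); first exact: cst_continuous.
  exact: cL.
have g0 k : (\int[sigma]_(y in sphere) (g k y)%:E = 0)%E.
  under eq_integral do rewrite /g EFinM.
  rewrite integralZl ?(sphere_rotation _ _ (CF k.1)) ?mule0//; first exact: measurable_sphere.
  exact: (integrable_sphere_continuous (cL k)).
transitivity (\int[sigma]_(y in sphere) (\sum_k (g k y)%:E)%E)%E; last first.
  by rewrite (integral_sum measurable_sphere)// big1.
apply: eq_integral => y; rewrite inE => ys; rewrite sumEFin; congr EFin.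
transitivity (\sum_j p ord0 j * (dQ y (E_ j) - y ord0 j * (n%:R * Q y + dQ y y))).
  have -> : dQ y (p - dot y p *: y) = dQ y p - dot y p * dQ y y.
    rewrite 3!(C1_linear _ _ CQ) mulr_sumr -sumrB; apply: eq_bigr => i _.
    by rewrite !mxE mulrBl mulrA.
  under [RHS]eq_bigr do rewrite mulrBr mulrA [p ord0 _ * y ord0 _]mulrC.
  rewrite sumrB -mulr_suml -(C1_linear _ p CQ) -/(dot y p); ring.
transitivity (\sum_j \sum_i g (i, j) y); last first.
  by rewrite exchange_big pair_bigA/=; apply: eq_bigr => -[].
apply: eq_bigr => j _; rewrite /g/= -mulr_sumr; congr (_ * _).
rewrite /L/= sumrB; under eq_bigr do rewrite mulrDr mulrA.
rewrite big_split/= (bigD1 j)//= big1 ?addr0 => [|i ij]; last first.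
  by rewrite mxE eqxx/= (negbTE ij) mulr0.
under eq_bigr do rewrite mulrA.
rewrite -mulr_suml -/(dot y y) ys -mulr_sumr big_split/= mxE !eqxx.
under eq_bigr do rewrite mxE !eqxx mulr1.
rewrite -(C1_linear _ y CQ) sumr_const card_ord mulrSr -[Q y *+ n]mulr_natl /=; ring.
Qed.

End sphere_integral.

(** * Spherical gradients, radial functions and Green's formula *)

Section gradient.
Context {R : realType} {n : nat}.
Notation V := 'rV[R]_n.+1.
Notation E_ i := (delta_mx ord0 i : V).
Notation sigma := (@sphere_measure R n).
Implicit Types (x y p v w : V).

Lemma dotDr x v w : dot x (v + w) = dot x v + dot x w.
Proof. by rewrite dotC dotDl !(dotC x). Qed.

Lemma dotZr a x v : dot x (a *: v) = a * dot x v.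
Proof. by rewrite dotC dotZl (dotC x). Qed.

Lemma dotNr x v : dot x (- v) = - dot x v.
Proof. by rewrite -scaleN1r dotZr mulN1r. Qed.

Lemma dotNl x v : dot (- v) x = - dot v x.
Proof. by rewrite dotC dotNr dotC. Qed.

(** Expand [|a v - w|^2 >= 0] and divide by [a]. The free weight takes the place of square roots and
    is made small in the density arguments. *)
Lemma cauchy_schwarz2 v w a : 0 < a -> 2 * dot v w <= a * dot v v + a^-1 * dot w w.
Proof.
move=> a0; have h := dotxx_ge0 (a *: v - w).
rewrite dotDl !dotDr !dotNl !dotNr !dotZl !dotZr (dotC w v) in h.
rewrite -(ler_pM2l a0) mulrDr (mulrA a a^-1) mulfV ?gt_eqF// mul1r.
move: h; set A := dot v v; set B := dot v w; set C := dot w w; nra.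
Qed.

Lemma sphere_dot_bound x p : sphere x -> sphere p -> -1 <= dot x p <= 1.
Proof.
move=> xs ps; have h1 := cauchy_schwarz2 x p ltr01; have h2 := cauchy_schwarz2 x (- p) ltr01.
move: h1 h2; rewrite !dotNr dotNl xs ps invr1; lra.
Qed.

(** For [x] on the sphere this is the spherical gradient of the height function [dot x p]. *)
Definition tangent p x : V := p - dot x p *: x.

Lemma dot_tangent x p : sphere x -> dot x (tangent p x) = 0.
Proof. by move=> xs; rewrite dotDr dotNr dotZr xs mulr1 subrr. Qed.

Lemma dot_tangent_p x p : sphere p -> dot (tangent p x) p = 1 - dot x p ^+ 2.
Proof. by move=> ps; rewrite dotDl dotNl dotZl ps expr2. Qed.

Lemma tangent_sqr x p : sphere x -> sphere p ->
  dot (tangent p x) (tangent p x) = 1 - dot x p ^+ 2.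
Proof.
move=> xs ps; rewrite {2}/tangent dotDr dotNr dotZr dot_tangent_p// (dotC _ x) dot_tangent//.
by rewrite mulr0 subr0.
Qed.

Lemma C1_smooth (f : V -> R) : smooth f -> C1_rV f (fun x v => 'D_v f x).
Proof.
move=> sf; split=> [x|//|v x]; first exact: (sf [::]).
by apply: differentiable_continuous; exact: (sf [:: v]).
Qed.

Lemma dot_grad_row (f : V -> R) x v : smooth f ->
  dot (\row_i 'D_(E_ i) f x) v = 'D_v f x.
Proof.
move=> /C1_smooth Cf; rewrite (C1_linear _ _ Cf); apply: eq_bigr => i _.
by rewrite mxE mulrC.
Qed.

Lemma sphere_grad_tangent (f : V -> R) p x : smooth f -> sphere x ->
  dot (sphere_grad f x) (tangent p x) = 'D_(tangent p x) f x.
Proof.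
move=> sf xs; rewrite /sphere_grad dotDl dot_grad_row// dotNl dotZl dot_tangent//.
by rewrite mulr0 subr0.
Qed.

(** Each derivative along [e] contributes a constant factor [dot e p], so every iterated derivative
    has the shape [c * G (dot x p)] with [G] smooth. *)
Lemma radial_smooth (F : R -> R) p : smooth_real F -> smooth (fun x => F (dot x p)).
Proof.
move=> sF es.
have : exists c G, smooth_real G /\
   foldr (fun e (h : V -> R) => 'D_e h) (fun x => F (dot x p)) es = fun x => c * G (dot x p).
  elim: es => [|e es [c [G [sG /= ->]]]] /=.
    by exists 1, F; split => //; apply/funext => x; rewrite mul1r.
  have [dG [DG sdG]] := smooth_realP sG.
  exists (c * dot e p), dG; split => //; apply/funext => x.
  have [_ -> _] := C1_mul (C1_cst n.+1 c) (C1_comp_real (smooth_C1 sG DG) (C1_dot p)).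
  by rewrite mulr0 addr0 mulrAC mulrA.
move=> [c [G [sG ->]]] x.
have [dG [DG sdG]] := smooth_realP sG.
by have [D _ _] := C1_mul (C1_cst n.+1 c) (C1_comp_real (smooth_C1 sG DG) (C1_dot p)).
Qed.

Lemma sphere_grad_radial (F dF : R -> R) p x : C1_real F dF ->
  sphere_grad (fun x => F (dot x p)) x = dF (dot x p) *: tangent p x.
Proof.
move=> CF; have [_ E _] := C1_comp_real CF (C1_dot p).
have -> : sphere_grad (fun x => F (dot x p)) x =
    (\row_i (dF (dot x p) * p ord0 i)) - dot (\row_i (dF (dot x p) * p ord0 i)) x *: x.
  rewrite /sphere_grad (_ : \row_i _ = \row_i (dF (dot x p) * p ord0 i))//.
  by apply/rowP => i; rewrite !mxE E (dotC (delta_mx _ _)) dot_delta.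
have -> : \row_i (dF (dot x p) * p ord0 i) = dF (dot x p) *: p by apply/rowP => i; rewrite !mxE.
by rewrite dotZl (dotC p) scalerBr scalerA.
Qed.

Lemma sphere_grad_test_radial (F dF : R -> R) p x : sphere x -> sphere p -> C1_real F dF ->
  dot (sphere_grad (fun x => F (dot x p)) x) (sphere_grad (fun x => F (dot x p)) x) =
  dF (dot x p) ^+ 2 * (1 - dot x p ^+ 2).
Proof.
by move=> xs ps CF; rewrite (sphere_grad_radial _ _ CF) dotZl dotZr tangent_sqr//; ring.
Qed.

(** Divergence theorem for the product [psi * G (dot y p)]. The bracket is the divergence of
    [G (dot y p)] times the tangent field; for [G = f'] it is the Laplacian of [f (dot y p)]. *)
Lemma sphere_ibp (psi : V -> R) dpsi (G dG : R -> R) p : sphere p ->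
  C1_rV psi dpsi -> C1_real G dG ->
  (\int[sigma]_(y in sphere) (G (dot y p) * dpsi y (tangent p y) +
     psi y * (dG (dot y p) * (1 - dot y p ^+ 2) - n%:R * dot y p * G (dot y p)))%:E = 0)%E.
Proof.
move=> ps Cpsi CG.
rewrite -(sphere_divergence p (C1_mul Cpsi (C1_comp_real CG (C1_dot p)))).
apply: eq_integral => y; rewrite inE => ys; congr EFin => /=.
by rewrite -/(tangent p y) dot_tangent_p//; ring.
Qed.

End gradient.

(** * The radial equation *)

Section subgeometric.
Context {R : realType}.
Implicit Types (c : nat -> R) (x q : R).

(** Radius of convergence at least [1], put as explicit bounds so that tails can be estimated
    uniformly. *)
Definition subgeometric c := forall q, 1 < q -> exists C, 0 <= C /\ forall k, `|c k| <= C * q ^+ k.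

Definition psum c x := limn (pseries c x).

Lemma pseries_psum c x k : pseries c x k = \sum_(0 <= i < k) c i * x ^+ i.
Proof. by []. Qed.

(** The new factor [k + 1] is absorbed by [(q / r)^k] for some [r] between [1] and [q], by
    Bernoulli's inequality. *)
Lemma subgeometric_diffs c : subgeometric c -> subgeometric (pseries_diffs c).
Proof.
move=> sc q q1; pose r := (1 + q) / 2.
have r1 : 1 < r by rewrite /r; lra.
have rq : r < q by rewrite /r; lra.
have r0 : 0 < r by lra.
have [C [C0 hC]] := sc r r1.
pose d := q / r - 1.
have d0 : 0 < d by rewrite subr_gt0 ltr_pdivlMr// mul1r.
have bern k : 1 + k%:R * d <= (q / r) ^+ k.
  elim: k => [|k IH]; first by rewrite mul0r addr0 expr0.
  have -> : q / r = 1 + d by rewrite /d addrC subrK.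
  rewrite exprS; have := IH; rewrite (_ : q / r = 1 + d); last by rewrite /d addrC subrK.
  rewrite -natr1; have : 0 <= k%:R :> R by [].
  move: (k%:R) ((1 + d) ^+ k) => a b; nra.
have dd : 0 < 1 + d^-1 by rewrite addr_gt0 ?invr_gt0.
exists (C * r * (1 + d^-1)); split.
  by apply: mulr_ge0; [apply: mulr_ge0 => //; exact: ltW|exact: ltW].
move=> k; rewrite /pseries_diffs normrM ger0_norm//.
have h1 : k.+1%:R <= (1 + d^-1) * (q / r) ^+ k.
  apply: (@le_trans _ _ ((1 + d^-1) * (1 + k%:R * d))).
    have -> : (1 + d^-1) * (1 + k%:R * d) = 1 + k%:R * d + d^-1 + k%:R by field; rewrite gt_eqF.
    rewrite -natr1.
    have : 0 <= d^-1 by rewrite invr_ge0 ltW.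
    have : 0 <= k%:R * d by rewrite mulr_ge0// ltW.
    move: (k%:R) (k%:R * d) (d^-1) => *; lra.
  by rewrite ler_pM2l ?bern.
have rk : 0 < r ^+ k by rewrite exprn_gt0.
apply: (le_trans (ler_wpM2l _ (hC k.+1))) => //.
have -> : C * r * (1 + d^-1) * q ^+ k = (1 + d^-1) * (q / r) ^+ k * (C * r ^+ k.+1).
  by rewrite expr_div_n exprS; field; rewrite !gt_eqF.
by rewrite ler_wpM2r// mulr_ge0// exprn_ge0// ltW.
Qed.

(** Comparison with a geometric series. The tail bound involves only [C], [r] and [N], hence is
    uniform in [x] and in any parameter of the coefficients. *)
Lemma pseries_tail c C q x r : 0 <= C -> 0 <= q -> (forall k, `|c k| <= C * q ^+ k) ->
  q * `|x| <= r -> r < 1 ->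
  cvgn (pseries c x) /\ forall N, `|psum c x - pseries c x N| <= C * r ^+ N / (1 - r).
Proof.
move=> C0 q0 hc qx r1.
have r0 : 0 <= r by rewrite (le_trans _ qx)// mulr_ge0.
have ht k : `|c k * x ^+ k| <= C * r ^+ k.
  rewrite normrM normrX (le_trans (ler_wpM2r _ (hc k)))//.
  by rewrite -mulrA ler_wpM2l// -exprMn lerXn2r// nnegrE mulr_ge0.
have cv : cvgn (pseries c x).
  apply: normed_cvg; apply: (series_le_cvg (v_ := geometric C r)).
  - by move=> k; exact: normr_ge0.
  - by move=> k; apply: mulr_ge0 => //; exact: exprn_ge0.
  - by move=> k; exact: ht.
  - by apply: is_cvg_geometric_series; rewrite ger0_norm.
split => // N.
have r10 : 0 < 1 - r by rewrite subr_gt0.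
have part M : `|pseries c x (N + M) - pseries c x N| <= C * r ^+ N / (1 - r).
  rewrite (_ : pseries c x (N + M)%N - pseries c x N = \sum_(N <= i < N + M) c i * x ^+ i); last first.
    by rewrite !pseries_psum (@big_cat_nat _ _ _ N)//= ?leq_addr// addrAC subrr add0r.
  rewrite (le_trans (ler_norm_sum _ _ _))//.
  apply: (@le_trans _ _ (\sum_(N <= i < N + M) C * r ^+ i)); first exact: ler_sum.
  rewrite ler_pdivlMr//.
  suff -> : (\sum_(N <= i < N + M) C * r ^+ i) * (1 - r) = C * r ^+ N - C * r ^+ (N + M).
    by rewrite lerBlDr lerDl mulr_ge0// exprn_ge0.
  elim: M => [|M IH]; first by rewrite addn0 big_geq// mul0r subrr.
  by rewrite addnS big_nat_recr/= ?leq_addr// mulrDl IH exprS; ring.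
have lim : (fun M => `|pseries c x (M + N)%N - pseries c x N|) @ \oo --> `|psum c x - pseries c x N|.
  apply: cvg_norm; apply: cvgB; last exact: cvg_cst.
  by rewrite (cvg_shiftn N (pseries c x)); exact: cv.
rewrite -(cvg_lim _ lim)//.
apply: limr_le; first by apply/cvg_ex; eexists; exact: lim.
by apply: nearW => M /=; rewrite addnC.
Qed.

Lemma subgeometric_cvg c x : subgeometric c -> `|x| < 1 -> cvgn (pseries c x).
Proof.
move=> sc x1; pose r := (1 + `|x|) / 2.
have r1 : r < 1 by rewrite /r; lra.
have x0 : 0 <= `|x| by [].
have r0 : 0 < r by rewrite /r; lra.
have xr : `|x| < r by rewrite /r; lra.
have [xz|xz] := eqVneq x 0.
  have [C [C0 hC]] := sc 2 (ltr1n _ 2).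
  by apply: (pseries_tail C0 _ hC (r := 0) _ _).1; rewrite ?xz ?normr0 ?mulr0.
have xp : 0 < `|x| by rewrite normr_gt0.
have [|C [C0 hC]] := sc (r / `|x|); first by rewrite ltr_pdivlMr// mul1r.
by apply: (pseries_tail C0 _ hC (r := r) _ _).1; rewrite ?divr_ge0 ?(ltW r0)// divfK// gt_eqF.
Qed.

Lemma psum_derive c x : subgeometric c -> `|x| < 1 ->
  is_derive x 1 (psum c) (psum (pseries_diffs c) x).
Proof.
move=> sc x1; pose K := (1 + `|x|) / 2.
have x0 : 0 <= `|x| by [].
have K0 : 0 <= K by rewrite /K; lra.
have K1 : `|K| < 1 by rewrite ger0_norm// /K; lra.
apply: (@pseries_snd_diffs _ c K); try exact: subgeometric_cvg.
- by apply: subgeometric_cvg => //; exact: subgeometric_diffs.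
- by apply: subgeometric_cvg => //; do 2 apply: subgeometric_diffs.
- by rewrite (ger0_norm K0) /K; lra.
Qed.

End subgeometric.

(** * The hypergeometric series solving the radial equation *)

Section hypergeometric.
Context {R : realType}.
Variable n : nat.
Hypothesis n0 : (0 < n)%N.
Implicit Types (mu M s q : R) (k : nat).

(* Taylor coefficients of the solution, regular at [0], of
   [s (1 - s) y'' + n/2 (1 - 2 s) y' + mu y = 0]. *)
Fixpoint hyp_coef mu k : R :=
  if k is k'.+1 then
    hyp_coef mu k' * ((k'%:R * (k'%:R + n%:R - 1) - mu) / ((k'%:R + 1) * (k'%:R + n%:R / 2)))
  else 1.

Let n1 : 1 <= n%:R :> R. Proof. by rewrite ler1n. Qed.

Lemma hyp_den_gt0 k : 0 < (k%:R + 1) * (k%:R + n%:R / 2) :> R.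
Proof.
have k0 : 0 <= k%:R :> R by [].
apply: mulr_gt0; move: n1 k0; lra.
Qed.

Lemma hypS mu k : (k%:R + 1) * (k%:R + n%:R / 2) * hyp_coef mu k.+1 =
  (k%:R * (k%:R + n%:R - 1) - mu) * hyp_coef mu k.
Proof.
by rewrite /= [RHS]mulrC mulrCA; congr (_ * _); rewrite mulrC divfK// gt_eqF// hyp_den_gt0.
Qed.

(** The ratio of consecutive coefficients tends to [1] uniformly for [|mu| <= M]. It is at most [B]
    always and at most [q] from the index [K] on, so [C = B ^ K] works. Uniformity in [mu] is needed
    for continuity of the solution in [mu]. *)
Lemma hyp_majorant M q : 0 <= M -> 1 < q -> exists C, 0 <= C /\
  forall mu k, `|mu| <= M -> `|hyp_coef mu k| <= C * q ^+ k.
Proof.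
move=> M0 q1; pose B := 2 + 2 * M + q.
have B1 : 1 <= B by rewrite /B; lra.
have B0 : 0 <= B by rewrite (le_trans _ B1).
(* Beyond [K] one has [(q - 1) k >= n + M], which makes the ratio at most [q]. *)
pose K := (Num.truncn ((n%:R + M) / (q - 1))).+1.
have KP : (n%:R + M) / (q - 1) < K%:R by exact: truncnS_gt.
have num mu k : `|mu| <= M -> `|k%:R * (k%:R + n%:R - 1) - mu| <= k%:R * (k%:R + n%:R - 1) + M.
  move=> muM; rewrite (le_trans (ler_normB _ _))// lerD// ger0_norm// mulr_ge0//.
  by rewrite -addrA addr_ge0// subr_ge0.
have step mu k (D : R) : `|mu| <= M -> k%:R * (k%:R + n%:R - 1) + M <= D * ((k%:R + 1) * (k%:R + n%:R / 2)) ->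
    `|hyp_coef mu k.+1| <= `|hyp_coef mu k| * D.
  move=> muM hD; rewrite /= normrM ler_wpM2l// normrM normfV (gtr0_norm (hyp_den_gt0 k)).
  by rewrite ler_pdivrMr ?hyp_den_gt0// (le_trans (num _ _ muM)).
have crude mu k : `|mu| <= M -> `|hyp_coef mu k| <= B ^+ k.
  move=> muM; elim: k => [|k IH]; first by rewrite /= normr1.
  rewrite exprSr (le_trans (step _ _ B muM _))// ?ler_wpM2r//.
  have k0 : 0 <= k%:R :> R by [].
  have := n1; have := hyp_den_gt0 k; rewrite /B.
  move: (k%:R) (n%:R) k0 => a b a0 X0 b1.
  have X1 : 1 / 2 <= (a + 1) * (a + b / 2) by nra.
  have X2 : a * (a + b - 1) <= 2 * ((a + 1) * (a + b / 2)) by nra.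
  move: X0 X1 X2; set X := (a + 1) * _; set Y := a * _ => X0 X1 X2; nra.
exists (B ^+ K); split; first exact: exprn_ge0.
move=> mu k muM; elim: k => [|k IH]; first by rewrite expr0 mulr1 /= normr1 exprn_ege1.
have [kK|Kk] := ltnP k K.
  apply: (le_trans (crude _ _ muM)); apply: (@le_trans _ _ (B ^+ K)).
    by rewrite ler_weXn2l.
  by rewrite ler_peMr ?exprn_ge0// exprn_ege1// ltW.
rewrite exprSr mulrA (le_trans (step _ _ q muM _))// ?ler_wpM2r//; last lra.
have k0 : 0 <= k%:R :> R by [].
have kk : (n%:R + M) <= (q - 1) * k%:R.
  rewrite mulrC -ler_pdivrMr ?subr_gt0// (le_trans (ltW KP))// ler_nat//.
have k1 : 1 <= k%:R :> R by rewrite ler1n (leq_trans _ Kk).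
have := n1; move: (k%:R) (n%:R) k0 k1 kk => a b; nra.
Qed.

Lemma hyp_subgeometric mu : subgeometric (hyp_coef mu).
Proof.
move=> q q1; have [C [C0 hC]] := hyp_majorant (normr_ge0 mu) q1.
by exists C; split=> // k; apply: hC.
Qed.

Definition hyp_fun mu := psum (hyp_coef mu).
Definition hyp_fun1 mu := psum (pseries_diffs (hyp_coef mu)).
Definition hyp_fun2 mu := psum (pseries_diffs (pseries_diffs (hyp_coef mu))).

Lemma hyp_fun_derive mu s : `|s| < 1 -> is_derive s 1 (hyp_fun mu) (hyp_fun1 mu s).
Proof. by apply: psum_derive; exact: hyp_subgeometric. Qed.

Lemma hyp_fun1_derive mu s : `|s| < 1 -> is_derive s 1 (hyp_fun1 mu) (hyp_fun2 mu s).
Proof. by apply: psum_derive; apply: subgeometric_diffs; exact: hyp_subgeometric. Qed.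

Lemma hyp_fun2_continuous mu s : `|s| < 1 -> {for s, continuous (hyp_fun2 mu)}.
Proof.
move=> s1; apply/differentiable_continuous/derivable1_diffP.
have : is_derive s 1 (hyp_fun2 mu) (psum (pseries_diffs (pseries_diffs (pseries_diffs (hyp_coef mu)))) s).
  by apply: psum_derive => //; do 2 apply: subgeometric_diffs; exact: hyp_subgeometric.
by case.
Qed.

(** With [N], [N + 1] and [N + 2] terms for the second derivative, the first derivative and the
    function, the recursion cancels everything but two terms of order [N]. These tend to zero as
    general terms of convergent series. *)
Lemma hyp_ode mu s : `|s| < 1 ->
  s * (1 - s) * hyp_fun2 mu s + n%:R / 2 * (1 - 2 * s) * hyp_fun1 mu s + mu * hyp_fun mu s = 0.
Proof.
move=> s1.
pose a := hyp_coef mu; pose b := pseries_diffs a; pose c := pseries_diffs b.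
have sa : subgeometric a by exact: hyp_subgeometric.
have sb := subgeometric_diffs sa; have sc := subgeometric_diffs sb.
have ca := subgeometric_cvg sa s1; have cb := subgeometric_cvg sb s1.
have cc := subgeometric_cvg sc s1.
have res N : s * (1 - s) * pseries c s N + n%:R / 2 * (1 - 2 * s) * pseries b s N.+1 +
   mu * pseries a s N.+2 = - (s * (c N * s ^+ N)) - n%:R / 2 * (b N.+1 * s ^+ N.+1).
  have S2 k (e : nat -> R) : \sum_(0 <= i < k.+1) e i = \sum_(0 <= i < k) e i + e k.
    by rewrite big_nat_recr.
  elim: N => [|N IH].
    have h0 := hypS mu 0; have h1 := hypS mu 1.
    rewrite !pseries_psum !S2 !big_geq// /c /b /pseries_diffs.
    rewrite -/a in h0 h1; move: h0 h1.
    move: (a 0%N) (a 1%N) (a 2%N) => a0 a1 a2 h0 h1.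
    apply/eqP; rewrite -subr_eq0; apply/eqP.
    transitivity ((0%:R + 1) * (0%:R + n%:R / 2) * a1 - (0%:R * (0%:R + n%:R - 1) - mu) * a0
      + s * ((1%:R + 1) * (1%:R + n%:R / 2) * a2 - (1%:R * (1%:R + n%:R - 1) - mu) * a1)).
      by rewrite -!natr1; field.
    by rewrite h0 h1 !subrr mulr0 addr0.
  have h := hypS mu N.+2; rewrite -/a in h.
  rewrite !pseries_psum in IH *.
  rewrite (S2 N.+2) (S2 N.+1 (fun i => b i * _)) (S2 N (fun i => c i * _)).
  move: IH; move: (\sum_(0 <= i < N) _) (\sum_(0 <= i < N.+1) _) (\sum_(0 <= i < N.+2) _).
  rewrite /c /b /pseries_diffs => A1 A2 A3 IH.
  rewrite !mulrDr !addrA; apply/eqP; rewrite -subr_eq0; apply/eqP.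
  transitivity (s * (1 - s) * A1 + n%:R / 2 * (1 - 2 * s) * A2 + mu * A3 -
     (- (s * (N.+1%:R * (N.+2%:R * a N.+2) * s ^+ N)) - n%:R / 2 * (N.+2%:R * a N.+2 * s ^+ N.+1)) +
     s ^+ N.+2 * ((N.+2%:R + 1) * (N.+2%:R + n%:R / 2) * a N.+3 - (N.+2%:R * (N.+2%:R + n%:R - 1) - mu) * a N.+2)).
    by rewrite !exprS -!natr1; field.
  by rewrite h IH !subrr mulr0 addr0.
have lim : (fun N => s * (1 - s) * pseries c s N + n%:R / 2 * (1 - 2 * s) * pseries b s N.+1 +
   mu * pseries a s N.+2) @ \oo --> s * (1 - s) * hyp_fun2 mu s + n%:R / 2 * (1 - 2 * s) * hyp_fun1 mu s + mu * hyp_fun mu s.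
  apply: cvgD; first apply: cvgD; apply: cvgM; try exact: cvg_cst.
  - exact: cc.
  - by rewrite (cvg_shiftS (pseries b s)); exact: cb.
  - by rewrite (cvg_shiftS (fun k => pseries a s k.+1)) (cvg_shiftS (pseries a s)); exact: ca.
apply: cvg_unique lim _ => //.
rewrite (_ : (fun N => _) = (fun N => - (s * (c N * s ^+ N)) - n%:R / 2 * (b N.+1 * s ^+ N.+1))); last by apply/funext => N; exact: res.
have -> : (0 : R) = - (s * 0) - n%:R / 2 * 0 by rewrite !mulr0 subr0 oppr0.
apply: cvgB; first apply: cvgN; apply: cvgM; try exact: cvg_cst.
- exact: (cvg_series_cvg_0 cc).
- by rewrite (cvg_shiftS (fun k => b k * s ^+ k)); exact: (cvg_series_cvg_0 cb).
Qed.

End hypergeometric.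

Section monotone.
Context {R : realType}.
Implicit Types (f df : R -> R) (a b : R).

Lemma mvt_derive f df a b : a < b -> (forall x, a <= x <= b -> is_derive x 1 f (df x)) ->
  exists2 c, a < c < b & f b - f a = df c * (b - a).
Proof.
move=> ab Df; have [||c] := @MVT R f df a b ab.
- by move=> x; rewrite in_itv/= => /andP[ax xb]; apply: Df; rewrite !ltW.
- apply: continuous_in_subspaceT => x; rewrite inE/= in_itv/= => xab.
  by apply/differentiable_continuous/derivable1_diffP; have [] := Df x xab.
by rewrite in_itv/= => cab E; exists c.
Qed.

Lemma derive_ge0_le f df a b : a <= b -> (forall x, a <= x <= b -> is_derive x 1 f (df x)) ->
  (forall x, a < x < b -> 0 <= df x) -> f a <= f b.
Proof.
rewrite le_eqVlt => /predU1P[-> //|ab] Df df0.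
have [c cab E] := mvt_derive ab Df.
by rewrite -subr_ge0 E mulr_ge0 ?df0// subr_ge0 ltW.
Qed.

Lemma derive_gt0_lt f df a b : a < b -> (forall x, a <= x <= b -> is_derive x 1 f (df x)) ->
  (forall x, a < x < b -> 0 < df x) -> f a < f b.
Proof.
move=> ab Df df0; have [c cab E] := mvt_derive ab Df.
by rewrite -subr_gt0 E mulr_gt0 ?df0// subr_gt0.
Qed.

Lemma derive_le_sub f df a b m : a <= b -> (forall x, a <= x <= b -> is_derive x 1 f (df x)) ->
  (forall x, a < x < b -> df x <= m) -> f b <= f a + m * (b - a).
Proof.
rewrite le_eqVlt => /predU1P[-> //|ab] Df df0; first by rewrite subrr mulr0 addr0.
have [c cab E] := mvt_derive ab Df.
by rewrite -lerBlDl E ler_wpM2r ?df0// subr_ge0 ltW.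
Qed.

End monotone.

Section radial_solution.
Context {R : realType}.
Variable n : nat.
Implicit Types (mu t th : R) (f : R -> R).

(* [f (dot x p)] satisfies [- Delta u = mu u] on the sphere of dimension [n.+1]. *)
Definition radial_solution mu t1 f f1 f2 := forall t, t1 <= t <= 1 ->
  [/\ is_derive t 1 f (f1 t), is_derive t 1 f1 (f2 t) &
   (1 - t ^+ 2) * f2 t - n.+1%:R * t * f1 t + mu * f t = 0].

Lemma ltr_cos_pi th1 th2 : 0 <= th1 -> th1 < th2 -> th2 <= pi -> cos th2 < cos th1.
Proof.
move=> h0 h12 hp; rewrite ltr_cos// in_itv/=; apply/andP; split => //.
- by rewrite (le_trans (ltW h12)).
- by rewrite (le_trans h0)// ltW.
Qed.

Lemma cos_itv th th1 : 0 <= th <= th1 -> th1 <= pi -> cos th1 <= cos th <= 1.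
Proof.
move=> /andP[t0 tt] tpi; rewrite cos_le1 andbT; move: tt; rewrite le_eqVlt => /predU1P[-> //|tt].
by rewrite ltW// ltr_cos_pi.
Qed.

Lemma is_derive_sinX k th :
  is_derive th 1 (fun x : R => sin x ^+ k.+1) (k.+1%:R * sin th ^+ k * cos th).
Proof.
apply: (@is_derive1_comp R (fun y => y ^+ k.+1) sin).
apply: DeriveDef; first exact: exprn_derivable.
by rewrite exp_derive /GRing.scale/= mulr1.
Qed.

Section fixed.
Variables (mu th1 : R) (f f1 f2 : R -> R).
Hypotheses (th0 : 0 < th1) (thpi : th1 < pi) (mu0 : 0 <= mu).
Hypothesis sol : radial_solution mu (cos th1) f f1 f2.

Let solc th : 0 <= th <= th1 ->
  [/\ is_derive (cos th) 1 f (f1 (cos th)), is_derive (cos th) 1 f1 (f2 (cos th)) &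
   (1 - cos th ^+ 2) * f2 (cos th) - n.+1%:R * cos th * f1 (cos th) + mu * f (cos th) = 0].
Proof. by move=> h; apply: sol; apply: cos_itv => //; exact: ltW. Qed.

Lemma radial_cos th : 0 <= th <= th1 -> is_derive th 1 (f \o cos) (- sin th * f1 (cos th)).
Proof.
move=> /solc[D _ _]; apply: (is_derive_eq (is_derive1_comp D (is_derive_cos th))).
by rewrite mulrC.
Qed.

(** For [u = f \o cos] this is [(sin^n u')' = - mu sin^n u] up to sign: the radial equation in
    divergence form, [sin^n] being the density of geodesic spheres in dimension [n.+1]. *)
Lemma radial_flux th : 0 <= th <= th1 ->
  is_derive th 1 (fun x => sin x ^+ n.+1 * f1 (cos x)) (mu * sin th ^+ n * f (cos th)).
Proof.
move=> /solc[D D1 E].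
have Ds := is_derive_sinX n th.
apply: (is_derive_eq (is_deriveM Ds (is_derive1_comp D1 (is_derive_cos th)))).
rewrite /GRing.scale/=.
transitivity (- sin th ^+ n * (sin th ^+ 2 * f2 (cos th) - n.+1%:R * cos th * f1 (cos th))).
  by rewrite exprS; ring.
rewrite sin2cos2 (_ : _ - _ = - (mu * f (cos th))); first by ring.
by apply/eqP; rewrite -addr_eq0 E.
Qed.

(** The flux vanishes at [0] and is nondecreasing because [f >= 0]. Strictness comes from an
    interval next to [0], where [f (cos x)] is positive by continuity since [f 1 > 0]. *)
Lemma radial_flux_gt0 th : 0 < mu -> (forall t, cos th1 <= t <= 1 -> 0 <= f t) ->
  0 < f 1 -> 0 < th <= th1 -> 0 < f1 (cos th).
Proof.
move=> mup fge0 f10 /andP[tp tth].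
pose Q x := sin x ^+ n.+1 * f1 (cos x).
have fc (x : R) : 0 <= x <= th1 -> 0 <= f (cos x).
  by move=> h; apply: fge0; apply: cos_itv => //; exact: ltW.
have [e e0 [eth he]] : exists2 e, 0 < e & e <= th /\ forall x, 0 <= x <= e -> 0 < f (cos x).
  have : {for (0 : R), continuous (f \o cos)}.
    apply/differentiable_continuous/derivable1_diffP.
    by have [|? _] := @radial_cos 0 _; rewrite ?lexx ?ltW.
  move=> /(_ [set y | 0 < y]) [].
    by apply: lt_nbhsr; rewrite /= cos0.
  move=> e /= e0 he; exists (Num.min th (e / 2)).
    by rewrite lt_min tp divr_gt0.
  split; first by rewrite ge_min lexx.
  move=> x /andP[x0 xe]; apply: he => /=.
  rewrite sub0r normrN ger0_norm//.
  by move: xe; rewrite le_min => /andP[_]; lra.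
have Q0 : Q 0 = 0 by rewrite /Q sin0 expr0n/= mul0r.
have DQ x : 0 <= x <= th1 -> is_derive x 1 Q (mu * sin x ^+ n * f (cos x)).
  exact: radial_flux.
have Qe : 0 < Q e.
  rewrite -Q0; apply: (derive_gt0_lt e0 (df := fun x => mu * sin x ^+ n * f (cos x))).
    by move=> x /andP[x0 xe]; apply: DQ; rewrite x0 (le_trans xe)// (le_trans eth).
  move=> x /andP[x0 xe]; rewrite !mulr_gt0//.
    rewrite exprn_gt0// sin_gt0_pi// x0 (lt_trans xe)// (le_lt_trans eth)//.
    exact: le_lt_trans thpi.
  by apply: he; rewrite !ltW.
have Qth : 0 < Q th.
  apply: (lt_le_trans Qe); apply: (derive_ge0_le eth (df := fun x => mu * sin x ^+ n * f (cos x))).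
    by move=> x /andP[xe xt]; apply: DQ; rewrite (le_trans (ltW e0) xe) (le_trans xt).
  move=> x /andP[xe xt]; have x0 : 0 < x by exact: lt_trans xe.
  rewrite mulr_ge0 ?fc ?mulr_ge0 ?exprn_ge0// ?(ltW x0) ?(le_trans (ltW xt))// ltW// sin_gt0_pi//.
  by rewrite x0 (lt_trans xt)// (le_lt_trans tth).
move: Qth; rewrite /Q pmulr_rgt0// exprn_gt0// sin_gt0_pi// tp.
exact: le_lt_trans thpi.
Qed.

Lemma cos_onto t : cos th1 <= t <= 1 -> exists2 th, 0 <= th <= th1 & t = cos th.
Proof.
move=> /andP[t1 t2]; have tN : -1 <= t <= 1 by rewrite t2 (le_trans (cos_geN1 th1)).
exists (acos t); last by rewrite acosK.
rewrite acos_ge0//= leNgt; apply/negP => h.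
have := ltr_cos_pi (ltW th0) h (acos_lepi tN).
by rewrite acosK// ltNge t1.
Qed.

Lemma radial_increasing : 0 < mu -> (forall t, cos th1 <= t <= 1 -> 0 <= f t) ->
  0 < f 1 -> forall a b, cos th1 <= a -> a < b -> b <= 1 -> f a < f b.
Proof.
move=> mup fge0 f10 a b ta ab b1.
apply: (derive_gt0_lt ab (df := f1)) => x /andP[xa xb].
  by have [] // := sol (t := x) _; rewrite (le_trans ta xa) (le_trans xb).
have [|th /andP[t0 t1] xE] := @cos_onto x.
  by rewrite (le_trans ta (ltW xa)) (le_trans (ltW xb)).
rewrite xE; apply: radial_flux_gt0 => //; rewrite t1 andbT lt_neqAle t0 andbT.
by apply: contraTneq xb => t00; rewrite xE -t00 cos0 -leNgt.
Qed.

(* Integrating the flux identity [radial_flux] over [0, th1 / 2] and then once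
   more over [th1 / 2, th1]: a large [mu] forces a zero of [f]. *)
Lemma radial_bound : (forall t, cos th1 <= t <= 1 -> 0 < f t) ->
  mu * (th1 / 2 * (sin (th1 / 2) ^+ n.+1 / n.+1%:R)) < 1.
Proof.
move=> fgt0; have [mup|mup] := ltP 0 mu; last first.
  have s0 : 0 <= sin (th1 / 2) ^+ n.+1.
    rewrite exprn_ge0// ltW// sin_gt0_pi//; rewrite divr_gt0//=.
    by move: th0 thpi; lra.
  apply: (@le_lt_trans _ _ 0) => //; apply: mulr_le0_ge0 => //.
  by apply: mulr_ge0; [rewrite divr_ge0// ltW|rewrite divr_ge0].
have f10 : 0 < f 1 by apply: fgt0; rewrite lexx cos_le1.
have fge0 t : cos th1 <= t <= 1 -> 0 <= f t by move=> /fgt0/ltW.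
pose al := th1 / 2; have al0 : 0 < al by rewrite divr_gt0.
have alth : al < th1 by rewrite /al; move: th0; lra.
have fcos x : 0 <= x <= th1 -> 0 < f (cos x).
  by move=> h; apply: fgt0; apply: cos_itv => //; exact: ltW.
have fal : 0 < f (cos al) by apply: fcos; rewrite !ltW.
pose k := sin al ^+ n.+1 / n.+1%:R.
pose Q x := sin x ^+ n.+1 * f1 (cos x).
have DQ x : 0 <= x <= th1 -> is_derive x 1 Q (mu * sin x ^+ n * f (cos x)).
  exact: radial_flux.
have sinp x : 0 < x <= th1 -> 0 < sin x.
  by move=> /andP[x0 xt]; rewrite sin_gt0_pi// x0 (le_lt_trans xt).
have Qal : mu * f (cos al) * k <= Q al.
  (* The subtracted term has derivative [mu f (cos al) sin^n cos], at most that of the flux because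
     [f (cos x) >= f (cos al)] and [cos x <= 1]; the factor [cos] is inserted to have a closed
     primitive. *)
  pose D x := Q x - mu * f (cos al) / n.+1%:R * sin x ^+ n.+1.
  have D0 : D 0 = 0 by rewrite /D /Q sin0 expr0n/= mul0r mulr0 subrr.
  have : D 0 <= D al.
    apply: (derive_ge0_le (ltW al0) (df := fun x => mu * sin x ^+ n * (f (cos x) - f (cos al) * cos x))).
      move=> x /andP[x0 xe].
      have Ds := is_derive_sinX n x.
      have xth : 0 <= x <= th1 by rewrite x0 (le_trans xe)// ltW.
      have DD := is_deriveB (DQ x xth) (is_deriveZ (mu * f (cos al) / n.+1%:R) Ds).
      apply: (is_derive_eq DD); rewrite /GRing.scale/=.
      have : n.+1%:R != 0 :> R by rewrite pnatr_eq0.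
      by move: (n.+1%:R : R) => N N0; field.
    move=> x /andP[x0 xe]; rewrite !mulr_ge0//; first by rewrite exprn_ge0// ltW// sinp// x0 (le_trans (ltW xe))// ltW.
    rewrite subr_ge0; apply: (@le_trans _ _ (f (cos al))).
      by rewrite ler_piMr ?cos_le1// ltW.
    apply/ltW/radial_increasing => //.
    - by apply/ltW/ltr_cos_pi => //; [exact: ltW|exact: ltW].
    - by apply: ltr_cos_pi; [exact: ltW|exact: xe|rewrite ltW// (lt_trans alth)].
  rewrite D0 /D subr_ge0; apply: le_trans; rewrite /k le_eqVlt; apply/orP; left; apply/eqP; ring.
have Qx x : al <= x <= th1 -> mu * f (cos al) * k <= Q x.
  move=> /andP[ax xt]; apply: (le_trans Qal).
  apply: (derive_ge0_le ax (df := fun x => mu * sin x ^+ n * f (cos x))).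
    by move=> y /andP[ya yx]; apply: DQ; rewrite (le_trans (ltW al0) ya) (le_trans yx).
  move=> y /andP[ya yx]; have y0 : 0 < y by exact: lt_trans ya.
  have yt : 0 <= y <= th1 by rewrite (ltW y0) (le_trans (ltW yx)).
  rewrite mulr_ge0 ?(ltW (fcos _ yt))// mulr_ge0// exprn_ge0// ltW// sinp// y0.
  by have /andP[] := yt.
(* Since [sin x <= 1], the flux is at most [sin x * f1 (cos x)], which is minus the derivative of
   [f \o cos]. *)
have Fb : f (cos th1) <= f (cos al) + - (mu * f (cos al) * k) * (th1 - al).
  apply: (derive_le_sub (ltW alth) (f := f \o cos) (df := fun x => - sin x * f1 (cos x))).
    by move=> x /andP[ax xt]; apply: radial_cos; rewrite (le_trans (ltW al0) ax).
  move=> x /andP[ax xt]; have x0 : 0 < x by exact: lt_trans ax.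
  have sx : 0 < sin x by rewrite sinp// x0 ltW.
  rewrite mulNr lerN2; apply: (le_trans (Qx x _)); first by rewrite !ltW.
  rewrite /Q exprS mulrAC; apply: ler_piMr.
    by rewrite mulr_ge0 ?(ltW sx)// ltW// radial_flux_gt0// x0 ltW.
  by apply: exprn_ile1; [exact: ltW|exact: sin_le1].
have := fcos th1; rewrite lexx (ltW th0) => /(_ isT) h.
have h2 : 0 < f (cos al) * (1 - mu * (th1 / 2 * k)).
  apply: (lt_le_trans h); apply: (le_trans Fb); rewrite /al le_eqVlt; apply/orP; left; apply/eqP.
  by move: (k) => K; field.
by move: h2; rewrite pmulr_rgt0// subr_gt0.
Qed.

End fixed.
End radial_solution.

Section radial_existence.
Context {R : realType}.
Variable n : nat.
Implicit Types (mu t th s : R).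

Let a := @hyp_coef R n.+1.

Lemma hyp_continuous k mu0 : {for mu0, continuous ((@hyp_coef R n.+1) ^~ k)}.
Proof.
elim: k => [|k IH]; first exact: cst_continuous.
rewrite /=; apply: (@continuousM _ _ ((@hyp_coef R n.+1) ^~ k)) => //.
apply: (@continuousM _ _ (fun mu => k%:R * (k%:R + n.+1%:R - 1) - mu) (cst _)); last exact: cst_continuous.
by apply: (@continuousB _ _ _ (cst _) id); [exact: cst_continuous|exact: cvg_id].
Qed.

(** The tails are small uniformly in [s] and in [mu] within distance [1] of [mu0], by
    [hyp_majorant]; the finite head has coefficients polynomial in [mu]. *)
Lemma hyp_fun_unif_continuous mu0 s1 e : 0 <= s1 -> s1 < 1 -> 0 < e ->
  exists2 d, 0 < d & forall mu s, `|mu - mu0| < d -> `|s| <= s1 ->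
    `|hyp_fun n.+1 mu s - hyp_fun n.+1 mu0 s| < e.
Proof.
move=> s0 s11 e0.
(* Chosen so that [q > 1] while [r = q * s1 < 1]. *)
pose q : R := 2 / (1 + s1); pose r := q * s1.
have q1 : 1 < q by rewrite /q ltr_pdivlMr; lra.
have q0 : 0 <= q by lra.
have r0 : 0 <= r by rewrite mulr_ge0.
have r1 : r < 1 by rewrite /r /q mulrAC ltr_pdivrMr; lra.
have M0 : 0 <= `|mu0| + 1 by rewrite addr_ge0.
have [C [C0 hC]] := hyp_majorant (ltn0Sn n) M0 q1.
have e3 : 0 < e / 3 by rewrite divr_gt0.
have [N hN] : exists N, C * r ^+ N / (1 - r) < e / 3.
  have : (fun N => C * r ^+ N / (1 - r)) @ \oo --> C * 0 / (1 - r).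
    apply: cvgM; last exact: cvg_cst.
    apply: cvgM; first exact: cvg_cst.
    by apply: cvg_expr; rewrite ger0_norm.
  rewrite mulr0 mul0r => /cvgr0Pnorm_lt /(_ _ e3) [N _ h].
  by exists N; apply: (le_lt_trans (ler_norm _)); apply: h => /=.
pose S mu := \sum_(i < N) `|a mu i - a mu0 i|.
have cS : {for mu0, continuous S}.
  apply: (continuous_sumr (f := fun i mu => `|a mu i - a mu0 i|)) => i nu.
  apply: (@continuous_comp _ _ _ (fun mu => a mu i - a mu0 i) (@Num.norm R R)); last exact: norm_continuous.
  by apply: (@continuousB _ _ _ (a ^~ i) (cst _)); [exact: hyp_continuous|exact: cst_continuous].
have S0 : S mu0 = 0 by rewrite /S big1// => i _; rewrite subrr normr0.
have [d d0 hd] : exists2 d, 0 < d & forall mu, `|mu - mu0| < d -> S mu < e / 3.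
  move/cvgrPdist_lt : cS => /(_ _ e3) /nbhs_ballP [d /= d0 hd]; exists d => // mu hmu.
  have := hd mu; rewrite /ball/= distrC => /(_ hmu).
  by rewrite S0 sub0r normrN; apply: le_lt_trans; exact: ler_norm.
exists (Num.min d 1); first by rewrite lt_min d0 ltr01.
move=> mu s; rewrite lt_min => /andP[hmud hmu1] hs.
have hmu : `|mu| <= `|mu0| + 1.
  have -> : mu = mu0 + (mu - mu0) by ring.
  by rewrite (le_trans (ler_normD _ _))// lerD2l ltW.
have qs : q * `|s| <= r by rewrite /r ler_wpM2l.
have T nu : `|nu| <= `|mu0| + 1 -> `|hyp_fun n.+1 nu s - pseries (a nu) s N| < e / 3.
  move=> hnu; apply: le_lt_trans hN.
  exact: (pseries_tail C0 q0 (fun k => hC nu k hnu) qs r1).2.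
have T1 := T _ hmu; have T2 : `|hyp_fun n.+1 mu0 s - pseries (a mu0) s N| < e / 3.
  by apply: T; rewrite lerDl.
have T3 : `|pseries (a mu) s N - pseries (a mu0) s N| < e / 3.
  apply: le_lt_trans (hd _ hmud); rewrite !pseries_psum !big_mkord -sumrB.
  apply: (le_trans (ler_norm_sum _ _ _)); apply: ler_sum => i _.
  rewrite -mulrBl normrM ler_piMr// normrX exprn_ile1//.
  by rewrite (le_trans hs)// ltW.
have -> : hyp_fun n.+1 mu s - hyp_fun n.+1 mu0 s =
   (hyp_fun n.+1 mu s - pseries (a mu) s N) + (pseries (a mu) s N - pseries (a mu0) s N)
   - (hyp_fun n.+1 mu0 s - pseries (a mu0) s N) by ring.
rewrite (le_lt_trans (ler_normB _ _))//; have := ler_normD (hyp_fun n.+1 mu s - pseries (a mu) s N) (pseries (a mu) s N - pseries (a mu0) s N).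
move: T1 T2 T3; lra.
Qed.

(** Known as [2F1(a, b; (n + 1) / 2; (1 - t) / 2)] with [a + b = n] and [a b = - mu]. The
    substitution sends the pole [t = 1] to [0], and the disc of convergence covers every cap of
    radius less than [pi]. *)
Definition radial mu t := hyp_fun n.+1 mu ((1 - t) / 2).
Definition radial1 mu t := - (hyp_fun1 n.+1 mu ((1 - t) / 2) / 2).
Definition radial2 mu t := hyp_fun2 n.+1 mu ((1 - t) / 2) / 4.

Lemma half_arg_bound t1 t : - 1 < t1 -> t1 <= t <= 1 -> `|(1 - t) / 2| <= (1 - t1) / 2 /\ (1 - t1) / 2 < 1.
Proof. by move=> h /andP[h1 h2]; rewrite ger0_norm ?divr_ge0 ?subr_ge0//; lra. Qed.

Lemma is_derive_half t : is_derive t 1 (fun t : R => (1 - t) / 2) (- 2^-1).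
Proof.
by apply: is_derive_eq; rewrite scaler0 scaler0 add0r add0r mul1r [LHS]mulrN1.
Qed.

Lemma radialP mu t1 : - 1 < t1 -> radial_solution n mu t1 (radial mu) (radial1 mu) (radial2 mu).
Proof.
move=> h t ht; have [s1 s2] := half_arg_bound h ht; have s3 := le_lt_trans s1 s2.
have Dh := is_derive_half t.
split.
- rewrite (_ : radial mu = hyp_fun n.+1 mu \o (fun t => (1 - t) / 2))//.
  apply: (is_derive_eq (@is_derive1_comp R (hyp_fun n.+1 mu) (fun t => (1 - t) / 2) t _ _ (hyp_fun_derive (ltn0Sn n) mu s3) Dh)).
  by rewrite mulrN.
- have D1 := @is_derive1_comp R (hyp_fun1 n.+1 mu) (fun t => (1 - t) / 2) t _ _ (hyp_fun1_derive (ltn0Sn n) mu s3) Dh.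
  have -> : radial1 mu = (- 2^-1) *: (hyp_fun1 n.+1 mu \o (fun t => (1 - t) / 2)).
    apply/funext => x; rewrite /radial1 -[RHS]/(- 2^-1 * hyp_fun1 n.+1 mu ((1 - x) / 2)).
    by rewrite mulNr mulrC.
  apply: (is_derive_eq (is_deriveZ (- 2^-1) D1)).
  by rewrite /GRing.scale/= /radial2; field.
- by rewrite -[RHS](hyp_ode (ltn0Sn n) mu s3) /radial /radial1 /radial2; field.
Qed.

Lemma psum_eq (c : nat -> R) x v : (forall N, pseries c x N.+1 = v) -> psum c x = v.
Proof.
move=> h; apply: cvg_lim => //; rewrite -(cvg_shiftS (pseries c x)).
by rewrite (_ : (fun N => _) = cst v); [exact: cvg_cst|apply/funext => N; exact: h].
Qed.

Lemma radial_at1 mu : radial mu 1 = 1.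
Proof.
rewrite /radial subrr mul0r; apply: psum_eq => N.
rewrite pseries_psum big_nat_recl//= expr0 mulr1 big1 ?addr0// => i _.
by rewrite expr0n/= mulr0.
Qed.

Lemma radial_mu0 t : radial 0 t = 1.
Proof.
have h k : a 0 k.+1 = 0.
  elim: k => [|k IH]; first by rewrite /a/= mul0r subrr mul0r mulr0.
  by rewrite /a /= -/(hyp_coef _ _ k.+1) -/a IH mul0r.
apply: psum_eq => N.
rewrite pseries_psum big_nat_recl//= expr0 mulr1 big1 ?addr0// => i _.
by have := h i; rewrite /a /= => ->; rewrite mul0r.
Qed.

End radial_existence.

(** * The parameter whose solution first vanishes at a given radius *)

Section first_zero.
Context {R : realType}.
Variable n : nat.
Implicit Types (mu t th : R).

Lemma radial_unif_continuous mu0 t1 e : -1 < t1 -> t1 <= 1 -> 0 < e -> exists2 d, 0 < d &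
  forall mu t, `|mu - mu0| < d -> t1 <= t <= 1 -> `|radial n mu t - radial n mu0 t| < e.
Proof.
move=> h h1 e0.
have [|||d d0 hd] := @hyp_fun_unif_continuous R n mu0 ((1 - t1) / 2) e => //; [lra|lra|].
by exists d => // mu t hmu ht; apply: hd => //; have [] := half_arg_bound h ht.
Qed.

(** The set [Z] is bounded by [radial_bound]. At its supremum the solution is nonnegative by
    continuity in the parameter, hence monotone in [t]. Were it positive at [t1], it would be
    bounded below by that value, and a slightly larger parameter would still belong to [Z]. *)
Lemma radial_first_zero th1 : 0 < th1 -> th1 < pi -> exists2 mu, 0 < mu &
  radial n mu (cos th1) = 0 /\ forall t, cos th1 < t <= 1 -> 0 < radial n mu t.
Proof.
move=> th0 thpi; pose t1 := cos th1.
have t1N : -1 < t1 by rewrite -cospi ltr_cos_pi// ltW.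
have t11 : t1 < 1 by rewrite -cos0 ltr_cos_pi// ltW.
have sol mu : radial_solution n mu t1 (radial n mu) (radial1 n mu) (radial2 n mu) by exact: radialP.
pose Z := [set mu : R | 0 <= mu /\ forall t, t1 <= t <= 1 -> 0 < radial n mu t].
have Z0 : Z 0 by split=> // t _; rewrite radial_mu0.
pose k := th1 / 2 * (sin (th1 / 2) ^+ n.+1 / n.+1%:R).
have k0 : 0 < k.
  rewrite !mulr_gt0 ?divr_gt0// ?invr_gt0// exprn_gt0// sin_gt0_pi//.
  by apply/andP; split; lra.
have Zub mu : Z mu -> mu <= k^-1.
  move=> [mu0 mup]; have := radial_bound th0 thpi mu0 (sol mu) mup.
  by rewrite -/k -ltr_pdivlMr// mul1r => /ltW.
have supZ : has_sup Z by split; [exists 0|exists k^-1].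
pose m := sup Z.
have m0 : 0 <= m by apply: ub_le_sup => //; case: supZ.
have rge0 t : t1 <= t <= 1 -> 0 <= radial n m t.
  move=> ht; rewrite leNgt; apply/negP => r0.
  have [|d d0 hd] := @radial_unif_continuous m t1 (- radial n m t) t1N (ltW t11).
    by rewrite oppr_gt0.
  have [mu [mu0 mup] dmu] := sup_adherent d0 supZ.
  have mum : mu <= m by apply: ub_le_sup => //; case: supZ.
  have := hd mu t; rewrite ler0_norm ?subr_le0// opprB => /(_ _ ht).
  rewrite -/m in dmu.
  have h : m - mu < d by lra.
  move=> /(_ h) /(le_lt_trans (ler_norm _)); have := mup _ ht; lra.
have r1 : 0 < radial n m 1 by rewrite radial_at1.
have inc : 0 < m -> forall t, t1 < t <= 1 -> radial n m t1 < radial n m t.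
  by move=> mp t /andP[h1 h2]; exact: (radial_increasing th0 thpi m0 (sol m) mp rge0 r1).
have rt1 : radial n m t1 = 0.
  apply/eqP; rewrite eq_le rge0 ?lexx ?(ltW t11)// andbT leNgt; apply/negP => rp.
  have rmin t : t1 <= t <= 1 -> radial n m t1 <= radial n m t.
    move=> /andP[]; rewrite le_eqVlt => /predU1P[-> //|h1] h2.
    have [mp|mp] := ltP 0 m; first by apply/ltW/inc => //; rewrite h1.
    have -> : m = 0 by apply/eqP; rewrite eq_le mp m0.
    by rewrite !radial_mu0.
  have [d d0 hd] := @radial_unif_continuous m t1 (radial n m t1) t1N (ltW t11) rp.
  have : Z (m + d / 2).
    split; first by rewrite addr_ge0// divr_ge0// ltW.
    move=> t ht; have := hd (m + d / 2) t.
    rewrite addrAC subrr add0r ger0_norm ?divr_ge0 ?(ltW d0)// => /(_ _ ht).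
    have h : d / 2 < d by lra.
    move=> /(_ h); rewrite ltr_norml => /andP[h1 _]; have := rmin t ht; lra.
  move=> /(ub_le_sup supZ.2); rewrite -/m; lra.
have mp : 0 < m.
  rewrite lt_neqAle m0 andbT; apply/eqP => mE; move/eqP: rt1; rewrite -mE radial_mu0.
  by rewrite oner_eq0.
by exists m => //; split=> // t ht; rewrite -rt1; exact: inc.
Qed.

(* [f] and [f1] are defined and regular on all of [R], hence the separate
   derivative [df] of [f], which agrees with [f1] only on [t1, 1]. *)
Definition radial_eigenpair mu t1 f df f1 f2 :=
  [/\ C1_real f df, C1_real f1 f2,
     forall t, t1 <= t <= 1 -> df t = f1 t /\ (1 - t ^+ 2) * f2 t - n.+1%:R * t * f1 t + mu * f t = 0,
     f t1 = 0 & forall t, t1 < t <= 1 -> 0 < f t].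

Lemma radial_eigenpair_solution mu t1 f df f1 f2 :
  radial_eigenpair mu t1 f df f1 f2 -> radial_solution n mu t1 f f1 f2.
Proof.
move=> [[Df _] [Df1 _] E _ _] t ht; have [<- e] := E t ht.
by split => //; exact: Df1.
Qed.

(** The extended [f] is only C^1, whereas test functions are smooth; the last clause provides
    truncations of the series, close to [f] together with their derivatives, as smooth
    substitutes. *)
Lemma radial_eigenpair_exists th1 : 0 < th1 -> th1 < pi ->
  exists mu f df f1 f2, [/\ 0 < mu, radial_eigenpair mu (cos th1) f df f1 f2 &
   forall e : R, 0 < e -> exists P : {poly R}, forall t, cos th1 <= t <= 1 ->
     `|P.[t] - f t| <= e /\ `|P^`().[t] - f1 t| <= e].
Proof.
move=> th0 thpi; have [mu mu0 [r0 rp]] := radial_first_zero th0 thpi.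
pose t1 := cos th1.
have t1N : -1 < t1 by rewrite -cospi ltr_cos_pi// ltW.
have t11 : t1 < 1 by rewrite -cos0 ltr_cos_pi// ltW.
have sol : radial_solution n mu t1 (radial n mu) (radial1 n mu) (radial2 n mu) by exact: radialP.
have c2 t : t1 <= t <= 1 -> {for t, continuous (radial2 n mu)}.
  move=> ht; have [s1 s2] := half_arg_bound t1N ht.
  apply: (@continuousM _ _ (hyp_fun2 n.+1 mu \o (fun t => (1 - t) / 2)) (cst _)); last exact: cst_continuous.
  apply: continuous_comp; last by apply: hyp_fun2_continuous => //; exact: le_lt_trans s2.
  by apply/differentiable_continuous/derivable1_diffP; have [] := is_derive_half t.
have [||F1 [F2 [CF1 E1]]] := @C1_extension R t1 1 (radial1 n mu) (radial2 n mu) t11.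
- by move=> t /sol[].
- exact: c2.
have [||F [DF [CF E]]] := @C1_extension R t1 1 (radial n mu) (radial1 n mu) t11.
- by move=> t /sol[].
- by move=> t /sol[_ D _]; apply/differentiable_continuous/derivable1_diffP; have [] := D.
exists mu, F, DF, F1, F2; split=> //.
  split=> //.
  - move=> t ht; have [_ _ <-] := sol t ht.
    by have [-> ->] := E t ht; have [-> ->] := E1 t ht.
  - have [-> _] : F t1 = radial n mu t1 /\ DF t1 = radial1 n mu t1 by apply: E; rewrite lexx ltW.
    exact: r0.
  - move=> t /andP[h1 h2]; have [-> _] : F t = radial n mu t /\ DF t = radial1 n mu t by apply: E; rewrite (ltW h1).
    by apply: rp; rewrite h1.
move=> e e0.
pose s1 := (1 - t1) / 2.
have s10 : 0 <= s1 by rewrite /s1; lra.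
have s11 : s1 < 1 by rewrite /s1; lra.
pose q : R := 2 / (1 + s1); pose r := q * s1.
have q1 : 1 < q by rewrite /q ltr_pdivlMr; lra.
have q0 : 0 <= q by lra.
have r0' : 0 <= r by rewrite mulr_ge0.
have r1 : r < 1 by rewrite /r /q mulrAC ltr_pdivrMr; lra.
have unif (c : nat -> R) : subgeometric c -> exists N0, forall N, (N0 <= N)%N -> forall s, `|s| <= s1 ->
   `|psum c s - pseries c s N| <= e.
  move=> sc; have [C [C0 hC]] := sc q q1.
  have : (fun N => C * r ^+ N / (1 - r)) @ \oo --> C * 0 / (1 - r).
    apply: cvgM; last exact: cvg_cst.
    apply: cvgM; first exact: cvg_cst.
    by apply: cvg_expr; rewrite ger0_norm.
  rewrite mulr0 mul0r => /cvgr0Pnorm_lt /(_ _ e0) [N0 _ h].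
  exists N0 => N hN s hs.
  have qs : q * `|s| <= r by rewrite /r ler_wpM2l.
  apply: (le_trans ((pseries_tail C0 q0 hC qs r1).2 N)).
  by apply: (le_trans (ler_norm _)); apply/ltW/h.
have sa := hyp_subgeometric (ltn0Sn n) mu.
have [N1 h1] := unif _ sa; have [N2 h2] := unif _ (subgeometric_diffs sa).
pose N := maxn N1 N2.
(* [N + 1] coefficients, so that the derivative of [A] is the partial sum of the differentiated
   series with [N] terms. *)
pose A : {poly R} := \poly_(i < N.+1) hyp_coef n.+1 mu i.
have AE s : A.[s] = pseries (hyp_coef n.+1 mu) s N.+1.
  by rewrite horner_poly pseries_psum big_mkord.
have AE' s : A^`().[s] = pseries (pseries_diffs (hyp_coef n.+1 mu)) s N.
  rewrite pseries_psum big_mkord.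
  have -> : A^`() = \poly_(i < N) ((i.+1)%:R * hyp_coef n.+1 mu i.+1).
    apply/polyP => i; rewrite coef_deriv !coef_poly ltnS mulr_natl.
    by case: ifP => // _; rewrite mul0rn.
  by rewrite horner_poly.
exists (A \Po ((2^-1)%:P - (2^-1)%:P * 'X)) => t ht.
have [s1' s2'] := half_arg_bound t1N ht.
have tE : ((2^-1)%:P - (2^-1)%:P * 'X).[t] = (1 - t) / 2 by rewrite !hornerE; ring.
have [-> _] := E t ht; have [-> _] := E1 t ht; split.
  rewrite horner_comp tE AE distrC; apply: h1 => //.
  by rewrite (leq_trans (leq_maxl _ N2)).
have dE : ((2^-1)%:P - (2^-1)%:P * 'X : {poly R})^`().[t] = - 2^-1.
  by rewrite derivB derivC derivM derivC derivX !hornerE; ring.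
rewrite deriv_comp hornerM horner_comp tE AE' dE /radial1.
have -> : pseries (pseries_diffs (hyp_coef n.+1 mu)) ((1 - t) / 2) N * - 2^-1 - - (hyp_fun1 n.+1 mu ((1 - t) / 2) / 2)
   = (hyp_fun1 n.+1 mu ((1 - t) / 2) - pseries (pseries_diffs (hyp_coef n.+1 mu)) ((1 - t) / 2) N) / 2 by ring.
rewrite normrM (@ger0_norm _ 2^-1)//.
have h : `|hyp_fun1 n.+1 mu ((1 - t) / 2) - pseries (pseries_diffs (hyp_coef n.+1 mu)) ((1 - t) / 2) N| <= e.
  by apply: h2 => //; exact: leq_maxr.
have := normr_ge0 (hyp_fun1 n.+1 mu ((1 - t) / 2) - pseries (pseries_diffs (hyp_coef n.+1 mu)) ((1 - t) / 2) N).
move: h; lra.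
Qed.

End first_zero.

(** * Sturm comparison *)

Section sturm.
Context {R : realType}.
Variable n : nat.
Implicit Types (mu t th x : R).

(** The inequality [c cot (c x) < cot x] with denominators cleared. In this form it vanishes at [0]
    and has derivative [(c^2 - 1) sin x sin (c x)]. *)
Lemma sin_scaled_gt0 c x : 1 < c -> 0 < x -> c * x < pi ->
  0 < cos x * sin (c * x) - c * sin x * cos (c * x).
Proof.
move=> c1 x0 cx.
have c0 : 0 < c by exact: lt_trans c1.
pose E y := cos y * sin (c * y) - c * sin y * cos (c * y).
have E0 : E 0 = 0 by rewrite /E mulr0 sin0 !mulr0 mul0r subrr.
have Dm (y : R) : is_derive y 1 ( *%R c : R -> R) c.
  by apply: is_derive_eq; rewrite [LHS]mulr1.
rewrite -[X in X < _]E0 -/(E x).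
apply: (derive_gt0_lt x0 (df := fun y => (c ^+ 2 - 1) * (sin y * sin (c * y)))).
  move=> y _.
  have Ds := is_derive1_comp (is_derive_sin (c * y)) (Dm y).
  have Dc := is_derive1_comp (is_derive_cos (c * y)) (Dm y).
  have D := is_deriveB (is_deriveM (is_derive_cos y) Ds) (is_deriveZ c (is_deriveM (is_derive_sin y) Dc)).
  have -> : E = cos * (sin \o *%R c) - c *: (sin * (cos \o *%R c)).
    by apply/funext => z; rewrite /E -[RHS]/(cos z * sin (c * z) - c * (sin z * cos (c * z))) mulrA.
  by apply: (is_derive_eq D); rewrite /GRing.scale/=; ring.
move=> y /andP[y0 yx]; have cy : c * y < pi by rewrite (lt_trans _ cx)// ltr_pM2l.
rewrite mulr_gt0//; first by rewrite subr_gt0 exprn_egt1.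
rewrite mulr_gt0// sin_gt0_pi//; last by rewrite cy mulr_gt0.
by rewrite y0 (le_lt_trans _ cy)// ler_peMl// ltW.
Qed.

(** [W] is the weighted Wronskian [sin^(n+1) (F' H - F H')]. It vanishes at [0] with the sine and at
    [th1] because [F] and [H] do. If the conclusion failed, [W'] would be [F] times the sum of a
    nonnegative eigenvalue term and a positive drift term, against the mean value theorem. *)
Lemma sturm_comparison mu1 mu2 th1 th2 f df f1 f2 h dh h1 h2 :
  0 < th1 -> th1 < th2 -> th2 < pi -> 0 <= mu1 -> 0 < mu2 ->
  radial_eigenpair n.+1 mu1 (cos th1) f df f1 f2 ->
  radial_eigenpair n.+1 mu2 (cos th2) h dh h1 h2 ->
  th2 ^+ 2 * mu2 < th1 ^+ 2 * mu1.
Proof.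
move=> th10 th12 th2pi mu10 mu20 ef eh.
have sf := radial_eigenpair_solution ef; have sh := radial_eigenpair_solution eh.
have [_ _ _ f0 fp] := ef; have [_ _ _ h0 hp] := eh.
have th20 : 0 < th2 by exact: lt_trans th12.
have th1pi : th1 < pi by exact: lt_trans th12 _.
rewrite ltNge; apply/negP => muc.
pose c := th2 / th1.
have c1 : 1 < c by rewrite ltr_pdivlMr// mul1r.
have c0 : 0 < c by exact: lt_trans c1.
have cth : c * th1 = th2 by rewrite /c divfK// gt_eqF.
have mule : mu1 <= c ^+ 2 * mu2.
  by rewrite /c expr_div_n mulrAC ler_pdivlMr ?exprn_gt0// mulrC.
have csub x : 0 <= x <= th1 -> 0 <= c * x <= th2.
  by move=> /andP[x0 xt]; rewrite mulr_ge0 ?(ltW c0)//= -cth ler_pM2l.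
pose F := f \o cos; pose H x := h (cos (c * x)).
pose QF x := sin x ^+ n.+2 * f1 (cos x).
pose u x := sin (c * x) * h1 (cos (c * x)).
pose P x := sin x ^+ n.+1 * u x.
pose W x := c * (F x * P x) - QF x * H x.
have W0 : W 0 = 0 by rewrite /W /P /QF sin0 !expr0n/= !mul0r !mulr0 subrr.
have W1 : W th1 = 0 by rewrite /W /F /H /= f0 cth h0 mul0r !mulr0 subrr.
have Dm (y : R) : is_derive y 1 ( *%R c : R -> R) c.
  by apply: is_derive_eq; rewrite [LHS]mulr1.
pose dW x := F x * ((c ^+ 2 * mu2 - mu1) * sin x ^+ n.+1 * H x +
    c * n.+1%:R * sin x ^+ n * h1 (cos (c * x)) * (cos x * sin (c * x) - c * sin x * cos (c * x))).
have DW x : 0 <= x <= th1 -> is_derive x 1 W (dW x).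
  move=> hx; have hcx := csub x hx.
  have DF := radial_cos th1pi sf hx.
  have DQ := radial_flux th1pi sf hx.
  have ci := cos_itv hcx (ltW th2pi).
  have [Dh Dh1 eqh] := sh _ ci.
  have Dcc := is_derive1_comp (is_derive_cos (c * x)) (Dm x).
  have Dsc := is_derive1_comp (is_derive_sin (c * x)) (Dm x).
  have DH := @is_derive1_comp R h (cos \o *%R c) x _ _ Dh Dcc.
  have Dh1c := @is_derive1_comp R h1 (cos \o *%R c) x _ _ Dh1 Dcc.
  have DP := is_deriveM (is_derive_sinX n x) (is_deriveM Dsc Dh1c).
  have D := is_deriveB (is_deriveZ c (is_deriveM DF DP)) (is_deriveM DQ DH).
  apply: (is_derive_eq D).
  rewrite /GRing.scale/=.
  rewrite -[((sin \o *%R c) * (h1 \o (cos \o *%R c))) x]/(sin (c * x) * h1 (cos (c * x))).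
  rewrite -[((fun x0 : R => sin x0 ^+ n.+1) * _) x]/(sin x ^+ n.+1 * (sin (c * x) * h1 (cos (c * x)))).
  rewrite -sin2cos2 in eqh.
  (* The computed derivative differs from [dW x] by a multiple of the equation for [h] at
     [cos (c * x)]. *)
  transitivity (dW x - c ^+ 2 * f (cos x) * sin x ^+ n.+1 *
    (sin (c * x) ^+ 2 * h2 (cos (c * x)) - n.+2%:R * cos (c * x) * h1 (cos (c * x)) + mu2 * h (cos (c * x)))); last first.
    by rewrite eqh mulr0 subr0.
  rewrite /dW /F /H /= -[n.+2%:R]natr1 !exprS.
  by move: (n.+1%:R : R) (sin x ^+ n) => N S; ring.
have [y /andP[y0 y1] E] := mvt_derive th10 (df := dW) DW.
have : 0 < dW y.
  have hcy := csub y; have cy : 0 < c * y by rewrite mulr_gt0.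
  have cy2 : c * y < th2 by rewrite -cth ltr_pM2l.
  have yp : 0 < sin y by rewrite sin_gt0_pi// y0 (lt_trans y1).
  have ypi : y < pi by exact: lt_trans th1pi.
  rewrite /dW mulr_gt0//.
    by apply: fp; rewrite cos_le1 andbT; apply: ltr_cos_pi => //; exact: ltW.
  rewrite ltr_wpDl//.
    rewrite mulr_ge0//; first by rewrite mulr_ge0 ?subr_ge0// exprn_ge0// ltW.
    apply/ltW/hp; rewrite cos_le1 andbT; apply: ltr_cos_pi => //; exact: ltW.
  rewrite mulr_gt0//; last by apply: sin_scaled_gt0 => //; exact: lt_trans th2pi.
  rewrite mulr_gt0//; first by rewrite mulr_gt0 ?exprn_gt0// mulr_gt0.
  apply: (radial_flux_gt0 th20 th2pi (ltW mu20) sh) => //.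
  - move=> t /andP[]; rewrite le_eqVlt => /predU1P[<- _|t1 t2]; first by rewrite h0.
    by apply/ltW/hp; rewrite t1.
  - by apply: hp; rewrite lexx andbT -cos0; apply: ltr_cos_pi => //; exact: ltW.
  - by rewrite cy ltW.
move: E; rewrite W0 W1 subrr subr0 => /esym/eqP; rewrite mulf_eq0 (gt_eqF th10) orbF.
by move=> /eqP ->; rewrite ltxx.
Qed.

End sturm.

(** * Barta's lower bound *)

Section sobolev.
Context {R : realType} {n : nat}.
Notation V := 'rV[R]_n.+1.
Notation E_ i := (delta_mx ord0 i : V).
Notation sigma := (@sphere_measure R n).
Notation "'Int' f" := (\int[sigma]_(x in sphere) (f x)%:E)%E (at level 10, f at level 8).
Implicit Types (x y p v w : V) (U : set V) (u f : V -> R) (g h : V -> V).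

Lemma measurable_dot g h : measurable_fun sphere g -> measurable_fun sphere h ->
  measurable_fun (@sphere R n) (fun x => dot (g x) (h x)).
Proof.
move=> mg mh; apply: measurable_sum => i; apply: measurable_funM.
  exact: (measurableT_comp (measurable_coord i) mg).
exact: (measurableT_comp (measurable_coord i) mh).
Qed.

Lemma measurable_fun_rV_on g :
  (forall i, measurable_fun (@sphere R n) (fun x => g x ord0 i)) -> measurable_fun sphere g.
Proof.
move=> mg; have mS := @measurable_sphere R n.
apply: (eq_measurable_fun (fun x => if x \in sphere then g x else 0)).
  by move=> x xs; rewrite xs.
apply: measurable_funTS; apply: measurable_fun_rVP => i.
have := (measurable_restrictT (fun x => g x ord0 i) mS).1 (mg i).
apply: eq_measurable_fun => x _; rewrite patchE.
by case: ifP => //; rewrite mxE.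
Qed.

(** The integrals are extended nonnegative numbers, so measurability suffices. The [L^2] estimates
    below go through this form, with [b = 0] when a single term is enough. *)
Lemma le_Int_lincomb (a b : R) f1 f2 f3 : 0 <= a -> 0 <= b ->
  measurable_fun sphere f1 -> measurable_fun sphere f2 -> measurable_fun sphere f3 ->
  (forall x, 0 <= f1 x) -> (forall x, 0 <= f2 x) -> (forall x, 0 <= f3 x) ->
  (forall x, sphere x -> f1 x <= a * f2 x + b * f3 x) ->
  (Int f1 <= a%:E * Int f2 + b%:E * Int f3)%E.
Proof.
move=> a0 b0 m1 m2 m3 p1 p2 p3 le; have mS := @measurable_sphere R n.
have M (f : V -> R) : measurable_fun sphere f -> measurable_fun sphere (EFin \o f) by move=> ?; exact/measurable_EFinP.
have P (f : V -> R) : (forall x, 0 <= f x) -> forall x, sphere x -> (0 <= (f x)%:E)%E by move=> h x _; rewrite lee_fin.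
rewrite -!ge0_integralZl ?lee_fin//; [|exact: M|exact: P|exact: M|exact: P].
rewrite -ge0_integralD//.
- apply: ge0_le_integral => //.
  + exact: P.
  + exact: M.
  + by apply: emeasurable_funD; apply: emeasurable_funM; by [exact: measurable_cst|exact: M].
- by move=> x _; rewrite mule_ge0 ?lee_fin.
- by apply: emeasurable_funM; [exact: measurable_cst|exact: M].
- by move=> x _; rewrite mule_ge0 ?lee_fin.
- by apply: emeasurable_funM; [exact: measurable_cst|exact: M].
Qed.

Lemma continuous_dot_fun (g h : V -> V) : (forall i, continuous (fun x => g x ord0 i)) ->
  (forall i, continuous (fun x => h x ord0 i)) -> continuous (fun x => dot (g x) (h x)).
Proof.
move=> cg ch; apply: continuous_sumr => i x.
by apply: (@continuousM _ _ (fun x => g x ord0 i) (fun x => h x ord0 i)); [exact: cg|exact: ch].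
Qed.

Lemma continuous_sphere_grad (f : V -> R) i : smooth f -> continuous (fun x => sphere_grad f x ord0 i).
Proof.
move=> /C1_smooth [_ _ cd] x.
rewrite (_ : (fun x => _) = (fun x => 'D_(E_ i) f x - dot (\row_k 'D_(E_ k) f x) x * x ord0 i)); last first.
  by apply/funext => y; rewrite !mxE.
apply: (@continuousB _ _ _ ('D_(E_ i) f)); first exact: cd.
apply: (@continuousM _ _ (fun x => dot (\row_k 'D_(E_ k) f x) x)); last exact: coord_continuous.
apply: continuous_dot_fun => k; last exact: coord_continuous.
by rewrite (_ : (fun x => _) = 'D_(E_ k) f); [exact: cd|apply/funext => y; rewrite mxE].
Qed.

Lemma measurable_sphere_grad (f : V -> R) : smooth f -> measurable_fun sphere (sphere_grad f).
Proof.
move=> sf; apply: measurable_fun_rV_on => i.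
exact: (measurable_funTS (continuous_measurable_rV (continuous_sphere_grad (i := i) sf))).
Qed.

Lemma smooth_measurable (f : V -> R) : smooth f -> measurable_fun sphere f.
Proof.
by move=> sf; exact: (measurable_funTS (continuous_measurable_rV (C1_continuous (C1_smooth sf)))).
Qed.

Lemma measurable_subv g h : measurable_fun sphere g -> measurable_fun sphere h ->
  measurable_fun (@sphere R n) (fun x => g x - h x).
Proof.
move=> mg mh; apply: measurable_fun_rV_on => i.
rewrite (_ : (fun x => _) = (fun x => g x ord0 i - h x ord0 i)); last first.
  by apply/funext => x; rewrite !mxE.
apply: measurable_funB.
  exact: (measurableT_comp (measurable_coord i) mg).
exact: (measurableT_comp (measurable_coord i) mh).
Qed.

Lemma H10_approx U u g (e : R) : H10 U u g -> 0 < e -> exists phi, [/\ test_function U phi,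
   (Int (fun x => (phi x - u x) ^+ 2) <= e%:E)%E &
   (Int (fun x => dot (sphere_grad phi x - g x) (sphere_grad phi x - g x)) <= e%:E)%E].
Proof.
move=> [mu mg [phi [tphi c1 c2]]] e0.
have near (a : nat -> \bar R) : (forall k, 0 <= a k)%E -> a @ \oo --> 0%E -> \forall k \near \oo, (a k <= e%:E)%E.
  move=> a0 /fine_cvgP[fa /cvgr0Pnorm_le/(_ _ e0) h].
  near=> k; have : `|(fine \o a) k| <= e by near: k.
  have fk : a k \is a fin_num by near: k.
  by rewrite /= ger0_norm ?fine_ge0// => h'; rewrite -(fineK fk) lee_fin.
have n1 := near _ (fun k => integral_ge0 _ (fun x _ => _)) c1.
have n2 := near _ (fun k => integral_ge0 _ (fun x _ => _)) c2.
have [k [h1 h2]] : exists k, (Int (fun x => (phi k x - u x) ^+ 2) <= e%:E)%E /\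
   (Int (fun x => dot (sphere_grad (phi k) x - g x) (sphere_grad (phi k) x - g x)) <= e%:E)%E.
  apply: (@filter_ex _ (nbhs \oo) _); near=> k; split; near: k.
  - by apply: n1 => k x; rewrite lee_fin sqr_ge0.
  - by apply: n2 => k x; rewrite lee_fin dotxx_ge0.
by exists (phi k).
Unshelve. all: by end_near. Qed.

(** Choosing a test function for each [e = 1 / (k + 1)] recovers the approximating sequence of the
    definition. *)
Lemma H10_intro U u g : measurable_fun sphere u -> measurable_fun sphere g ->
  (forall e : R, 0 < e -> exists phi, [/\ test_function U phi,
   (Int (fun x => (phi x - u x) ^+ 2) <= e%:E)%E &
   (Int (fun x => dot (sphere_grad phi x - g x) (sphere_grad phi x - g x)) <= e%:E)%E]) ->
  H10 U u g.
Proof.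
move=> mu mg h; split => //.
have k0 k : 0 < k.+1%:R^-1 :> R by rewrite invr_gt0.
pose phi k := projT1 (cid (h _ (k0 k))).
have hphi k := projT2 (cid (h _ (k0 k))).
have sq (a : nat -> \bar R) : (forall k, 0 <= a k)%E -> (forall k, a k <= (k.+1%:R^-1)%:E)%E -> a @ \oo --> 0%E.
  move=> a0 ak; apply: (squeeze_cvge (f := cst 0%E) (h := fun k => (k.+1%:R^-1)%:E)).
  - by near=> k; rewrite a0 ak.
  - exact: cvg_cst.
  - by apply: cvg_EFin; [near=> k|exact: cvg_harmonic].
exists phi; split.
- by move=> k; have [] := hphi k.
- apply: sq => k; first by apply: integral_ge0 => x _; rewrite lee_fin sqr_ge0.
  by have [] := hphi k.
- apply: sq => k; first by apply: integral_ge0 => x _; rewrite lee_fin dotxx_ge0.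
  by have [] := hphi k.
Unshelve. all: by end_near. Qed.

End sobolev.

Section barta.
Context {R : realType} {m : nat}.
Notation V := 'rV[R]_m.+2.
Notation sigma := (@sphere_measure R m.+1).
Notation "'Int' f" := (\int[sigma]_(x in sphere) (f x)%:E)%E (at level 10, f at level 8).
Implicit Types (x y p v w : V) (U : set V) (u : V -> R) (g h : V -> V).

Lemma geodesic_ballE p r x : 0 <= r -> r <= pi -> sphere p -> sphere x ->
  (acos (dot x p) < r) = (cos r < dot x p).
Proof.
move=> r0 rpi ps xs; have xp := sphere_dot_bound xs ps.
apply/idP/idP => h.
  rewrite -[ltRHS](@acosK R)//; apply: ltr_cos_pi => //; exact: acos_ge0.
rewrite ltNge; apply/negP; rewrite le_eqVlt => /predU1P[rE|].
  by move: h; rewrite {1}rE acosK// ltxx.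
move=> /(ltr_cos_pi r0)/(_ (acos_lepi xp)); rewrite acosK// => h'.
by have := lt_trans h h'; rewrite ltxx.
Qed.

(** The height attains its minimum on the compact support, strictly above [cos r]. This gap keeps
    the support away from the edge, where the eigenfunction vanishes and its logarithmic derivative
    is singular. *)
Lemma test_function_support p r phi : 0 < r -> r <= pi -> sphere p ->
  test_function (geodesic_ball p r) phi ->
  exists2 tau, cos r < tau < 1 & exists2 K : set V, closed K &
   (forall x, sphere x -> ~ K x -> phi x = 0) /\ forall x, K x -> tau <= dot x p.
Proof.
move=> r0 rpi ps [_ [K [cK KU phi0]]].
have cr1 : cos r < 1 by rewrite -cos0 ltr_cos_pi.
have Kcl : closed K by apply: compact_closed => //; exact: norm_hausdorff.
have [K0|K0] := eqVneq K set0.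
  exists ((cos r + 1) / 2); first by apply/andP; split; lra.
  by exists K => //; split => // x; rewrite K0.
have [||c cKc cm] := @EVT_min_rV R m.+2 (fun x => dot x p) K _ cK.
- exact/set0P.
- by apply: continuous_subspaceT; exact: (C1_continuous (C1_dot p)).
rewrite inE in cKc; have [cs cr] := KU _ cKc.
rewrite (geodesic_ballE (ltW r0) rpi ps cs) in cr.
(* The midpoint guarantees [tau < 1] even if the support is reduced to [p]. *)
exists (Num.min (dot c p) ((cos r + 1) / 2)).
  rewrite lt_min cr/= gt_min; apply/andP; split; first lra.
  by apply/orP; right; lra.
exists K => //; split=> // x Kx; rewrite ge_min cm//.
by rewrite inE.
Qed.

Lemma continuous_tangent_derive p (phi : V -> R) dphi : C1_rV phi dphi ->
  continuous (fun y => dphi y (tangent p y)).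
Proof.
move=> Cphi.
rewrite (_ : (fun y => _) = fun y => \sum_i (tangent p y) ord0 i * dphi y (delta_mx ord0 i)); last first.
  by apply/funext => y; exact: (C1_linear _ _ Cphi).
have [_ _ cd] := Cphi.
apply: continuous_sumr => i y.
apply: (@continuousM _ _ (fun y => tangent p y ord0 i) (dphi^~ _)); last exact: cd.
rewrite (_ : (fun y => _) = fun y => p ord0 i - dot y p * y ord0 i); last first.
  by apply/funext => z; rewrite !mxE.
apply: (@continuousB _ _ _ (cst (p ord0 i)) (fun y => dot y p * y ord0 i)); first exact: cst_continuous.
apply: (@continuousM _ _ (fun y => dot y p) (fun y => y ord0 i)); last exact: coord_continuous.
exact: (C1_continuous (C1_dot p)).
Qed.

(* Integration by parts of [G = f1 / f] against [phi ^ 2], completing a square. *)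
Lemma barta_test p r mu f df f1 f2 phi : sphere p -> 0 < r -> r < pi -> 0 <= mu ->
  radial_eigenpair m mu (cos r) f df f1 f2 ->
  test_function (geodesic_ball p r) phi ->
  (mu%:E * Int (fun x => phi x ^+ 2) <= Int (fun x => dot (sphere_grad phi x) (sphere_grad phi x)))%E.
Proof.
move=> ps r0 rpi mu0 [[Df cdf] [Df1 cf2] E f0 fp] tphi.
have [tau /andP[tau1 tau2] [K _ [phi0 Ktau]]] := test_function_support r0 (ltW rpi) ps tphi.
have [sphi _] := tphi.
have fpos t : tau <= t <= 1 -> 0 < f t.
  by move=> /andP[h1 h2]; apply: fp; rewrite (lt_le_trans tau1 h1).
have Et t : tau <= t <= 1 -> df t = f1 t /\ (1 - t ^+ 2) * f2 t - m.+1%:R * t * f1 t + mu * f t = 0.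
  by move=> /andP[h1 h2]; apply: E; rewrite (le_trans (ltW tau1) h1).
have cf : continuous f by exact: derive_continuous Df.
have cf1 : continuous f1 by exact: derive_continuous Df1.
(* [G] is the logarithmic derivative of [f], extended from the interval above [tau], where [f] is
   positive. *)
have [||G [dG [CG EG]]] := @C1_extension R tau 1 (fun t => f1 t / f t)
   (fun t => (f2 t * f t - f1 t ^+ 2) / f t ^+ 2) tau2.
- move=> t ht; have ft := fpos t ht; have [dfE _] := Et t ht.
  have Di : is_derive t 1 (fun t => (f t)^-1) (- (f t) ^- 2 *: df t).
    by apply: is_deriveV; rewrite ?gt_eqF.
  apply: (is_derive_eq (is_deriveM (Df1 t) Di)).
  by rewrite /GRing.scale/= dfE; field; rewrite gt_eqF.
- move=> t ht; have ft := fpos t ht.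
  apply: (@continuousM _ _ (fun t => f2 t * f t - f1 t ^+ 2) (fun t => (f t ^+ 2)^-1)).
    apply: (@continuousB _ _ _ (fun t => f2 t * f t) (fun t => f1 t ^+ 2)).
      by apply: (@continuousM _ _ f2 f); [exact: cf2|exact: cf].
    by apply: (@continuousM _ _ f1 f1); exact: cf1.
  apply: (@continuousV _ _ (fun t => f t ^+ 2)); first by rewrite expf_neq0// gt_eqF.
  by apply: (@continuousM _ _ f f); exact: cf.
have Cphi := C1_smooth sphi.
have Cphi2 := C1_mul Cphi Cphi.
have := sphere_ibp ps Cphi2 CG; set I := (fun y : V => _).
move=> I0.
pose grad2 x := dot (sphere_grad phi x) (sphere_grad phi x).
have cgrad2 : continuous grad2.
  by apply: continuous_dot_fun => i; exact: continuous_sphere_grad.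
pose J x := mu * phi x ^+ 2.
have cphi := C1_continuous Cphi.
have cJ : continuous J.
  move=> x; apply: (@continuousM _ _ (cst mu) (fun x => phi x ^+ 2)); first exact: cst_continuous.
  by apply: (@continuousM _ _ phi phi); exact: cphi.
have mS := @measurable_sphere R m.+1.
have iJ := integrable_sphere_continuous cJ.
have ig := integrable_sphere_continuous cgrad2.
have cp := C1_continuous (C1_dot p).
have cG : continuous (fun y => G (dot y p)).
  move=> x; apply: (@continuous_comp _ _ _ (fun y => dot y p) G); first exact: cp.
  exact: (derive_continuous CG.1).
have cdG : continuous (fun y => dG (dot y p)).
  move=> x; apply: (@continuous_comp _ _ _ (fun y => dot y p) dG); first exact: cp.
  exact: CG.2.
have cc (c : R) : continuous (fun _ : V => c) by exact: cst_continuous.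
have cM (k l : V -> R) : continuous k -> continuous l -> continuous (fun x => k x * l x).
  by move=> h1 h2 x; exact: (continuousM (h1 x) (h2 x)).
have cD (k l : V -> R) : continuous k -> continuous l -> continuous (fun x => k x + l x).
  by move=> h1 h2 x; exact: (continuousD (h1 x) (h2 x)).
have cB (k l : V -> R) : continuous k -> continuous l -> continuous (fun x => k x - l x).
  by move=> h1 h2 x; exact: (continuousB (h1 x) (h2 x)).
have cT := @continuous_tangent_derive p _ _ Cphi.
have cI : continuous (fun y : V => G (dot y p) * (phi y * 'D_(tangent p y) phi y + phi y * 'D_(tangent p y) phi y) +
   phi y * phi y * (dG (dot y p) * (1 - dot y p ^+ 2) - m.+1%:R * dot y p * G (dot y p))).
  apply: (cD _ _ _ _); first by apply: (cM _ _ cG); apply: (cD _ _ _ _); exact: (cM _ _ cphi).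
  apply: (cM _ _ _ _); first exact: (cM _ _ cphi).
  apply: (cB _ _ _ _); last by apply: (cM _ _ _ cG); exact: (cM _ _ (cc _)).
  by apply: (cM _ _ cdG); apply: (cB _ _ (cc _)); exact: (cM _ _ cp cp).
have iI := integrable_sphere_continuous cI.
have -> : (mu%:E * Int (fun x => phi x ^+ 2) = Int J)%E.
  have iphi2 : sigma.-integrable sphere (fun x => (phi x ^+ 2)%:E).
    apply: (integrable_sphere_continuous (f := fun x => phi x ^+ 2)) => x.
    by apply: (@continuousM _ _ phi phi); exact: cphi.
  by rewrite -(integralZl mS iphi2); apply: eq_integral.
rewrite -[leLHS]adde0 -I0 -(integralD mS iJ iI).
apply: le_integral => //.
- exact: integrableD.
- move=> x; rewrite inE => xs; rewrite /I -EFinD lee_fin.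
  have [phix|phix] := eqVneq (phi x) 0.
    by rewrite /J phix !(mul0r, mulr0, addr0, expr0n) /= ?mulr0; exact: dotxx_ge0.
  have xt : tau <= dot x p <= 1.
    have [_ ->] := andP (sphere_dot_bound xs ps); rewrite andbT; apply: Ktau.
    by apply: contrapT => /(phi0 _ xs) /eqP; rewrite (negbTE phix).
  have [-> ->] := EG _ xt; have ft := fpos _ xt; have [_ ode] := Et _ xt.
  have sg := sphere_grad_tangent p sphi xs.
  rewrite /grad2 /J; move: (sphere_grad phi x) sg => S sg.
  (* By the equation for [f], this square is exactly the gap between the two integrands. *)
  have := dotxx_ge0 (S - (phi x * (f1 (dot x p) / f (dot x p))) *: tangent p x).
  rewrite dotDl !dotDr !dotNl !dotNr !dotZl !dotZr tangent_sqr// (dotC (tangent p x)) sg.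
  move: ode ft; set t := dot x p; set D := 'D__ _ _; set Q := dot S S; set a := phi x.
  move: (f t) (f1 t) (f2 t) => F F1 F2 ode F0.
  move=> h; rewrite -subr_ge0.
  apply: le_trans h _; rewrite le_eqVlt; apply/orP; left; apply/eqP.
  set Z := (X in X = 0) in ode.
  transitivity (Q - (a * (F1 / F) * D + a * (F1 / F) * D) + (a * (F1 / F)) ^+ 2 * (1 - t ^+ 2) - a ^+ 2 / F * Z).
    rewrite ode mulr0 subr0; ring.
  by rewrite /Z; field; rewrite gt_eqF.
Qed.

End barta.

(** * From test functions to [H10] and to all eigenvalues *)

Section rayleigh.
Context {R : realType} {n : nat}.
Notation V := 'rV[R]_n.+1.
Notation sigma := (@sphere_measure R n).
Notation "'Int' f" := (\int[sigma]_(x in sphere) (f x)%:E)%E (at level 10, f at level 8).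
Implicit Types (x y p v w : V) (U : set V) (u : V -> R) (g h : V -> V).

Lemma Int_continuous_lty (f : V -> R) : continuous f -> (Int f < +oo)%E.
Proof.
move=> cf; have i := integrable_sphere_continuous cf.
have h := integrable_fin_num (@measurable_sphere R n) i.
by rewrite -(fineK h) ltry.
Qed.

Lemma continuous_sqr (f : V -> R) : continuous f -> continuous (fun x => f x ^+ 2).
Proof. by move=> cf x; apply: (@continuousM _ _ f f); exact: cf. Qed.

(** The main term keeps a factor close to [1], the large factor falling on the error; the sharp
    constant thus survives the passage to the limit. *)
Lemma dot_sqr_lin v w (e : R) : 0 < e ->
  dot v v <= (1 + e) * dot w w + (1 + e^-1) * dot (w - v) (w - v).
Proof.
move=> e0; have := cauchy_schwarz2 w (v - w) e0.
have -> : dot (w - v) (w - v) = dot (v - w) (v - w).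
  by rewrite -(opprB v w) dotNl dotNr opprK.
have -> : dot v v = dot w w + 2 * dot w (v - w) + dot (v - w) (v - w).
  have {1 2}-> : v = w + (v - w) by rewrite addrC subrK.
  by move: (v - w) => d; rewrite dotDl !dotDr (dotC d w); ring.
move: (dot w w) (dot w (v - w)) (dot (v - w) (v - w)) => a b c.
move=> h; rewrite -subr_ge0.
have -> : (1 + e) * a + (1 + e^-1) * c - (a + 2 * b + c) = e * a + e^-1 * c - 2 * b by ring.
by rewrite subr_ge0.
Qed.

Lemma sqr_lin (a b e : R) : 0 < e -> a ^+ 2 <= (1 + e) * b ^+ 2 + (1 + e^-1) * (b - a) ^+ 2.
Proof.
move=> e0; rewrite -subr_ge0.
have -> : (1 + e) * b ^+ 2 + (1 + e^-1) * (b - a) ^+ 2 - a ^+ 2 = e^-1 * (e * b + (b - a)) ^+ 2.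
  by field; rewrite gt_eqF.
by rewrite mulr_ge0 ?sqr_ge0// invr_ge0 ltW.
Qed.


Lemma H10_lty U u g : H10 U u g -> (Int (fun x => u x ^+ 2) < +oo)%E /\ (Int (fun x => dot (g x) (g x)) < +oo)%E.
Proof.
move=> H; have [mu mg _] := H.
have [phi [[sphi _] h1 h2]] := H10_approx H ltr01.
have mphi := smooth_measurable sphi; have mgr := measurable_sphere_grad sphi.
have md := measurable_subv mgr mg.
have l0 : (0 <= 1 + 1 :> R) by rewrite addr_ge0.
have l0' : (0 <= 1 + 1^-1 :> R) by rewrite addr_ge0// invr_ge0.
split.
- apply: (@le_lt_trans _ _ ((1 + 1)%:E * Int (fun x => phi x ^+ 2) + (1 + 1^-1)%:E * Int (fun x => (phi x - u x) ^+ 2))%E).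
    apply: le_Int_lincomb => //; try (by move=> x; exact: sqr_ge0).
    - exact: measurable_funX.
    - exact: measurable_funX.
    - by apply: measurable_funX; exact: measurable_funB.
    - by move=> x _; exact: sqr_lin.
  apply: lte_add_pinfty; rewrite lte_mul_pinfty ?lee_fin//.
    by apply: Int_continuous_lty; apply: continuous_sqr; exact: C1_continuous (C1_smooth sphi).
  exact: le_lt_trans h1 (ltry _).
- apply: (@le_lt_trans _ _ ((1 + 1)%:E * Int (fun x => dot (sphere_grad phi x) (sphere_grad phi x)) +
     (1 + 1^-1)%:E * Int (fun x => dot (sphere_grad phi x - g x) (sphere_grad phi x - g x)))%E).
    apply: le_Int_lincomb => //; try (by move=> x; exact: dotxx_ge0).
    - exact: measurable_dot.
    - exact: measurable_dot.
    - exact: measurable_dot.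
    - by move=> x _; exact: dot_sqr_lin.
  apply: lte_add_pinfty; rewrite lte_mul_pinfty ?lee_fin//.
    apply: Int_continuous_lty; apply: continuous_dot_fun => i; exact: continuous_sphere_grad.
  exact: le_lt_trans h2 (ltry _).
Qed.

(** Replacing [u] and [g] by a test function at distance [d] costs factors [1 + e] and errors of
    order [(1 + 1 / e) d]; hence [d] tends to [0] first, with [e] fixed, and [e] afterwards. *)
Lemma rayleigh_closure (mu : R) U u g : 0 <= mu ->
  (forall phi, test_function U phi -> (mu%:E * Int (fun x => phi x ^+ 2) <=
     Int (fun x => dot (sphere_grad phi x) (sphere_grad phi x)))%E) ->
  H10 U u g -> (mu%:E * Int (fun x => u x ^+ 2) <= Int (fun x => dot (g x) (g x)))%E.
Proof.
move=> mu0 hmu H; have [mu_ mg _] := H.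
have [fu fg] := H10_lty H.
pose A := fine (Int (fun x => u x ^+ 2)); pose B := fine (Int (fun x => dot (g x) (g x))).
have AE : Int (fun x => u x ^+ 2) = A%:E.
  by rewrite fineK// ge0_fin_numE// integral_ge0// => x _; rewrite lee_fin sqr_ge0.
have BE : Int (fun x => dot (g x) (g x)) = B%:E.
  by rewrite fineK// ge0_fin_numE// integral_ge0// => x _; rewrite lee_fin dotxx_ge0.
have B0 : 0 <= B by apply: fine_ge0; apply: integral_ge0 => x _; rewrite lee_fin dotxx_ge0.
rewrite AE BE -EFinM lee_fin.
have key (e d : R) : 0 < e -> 0 < d -> mu * A <= (1 + e) ^+ 2 * B + ((1 + e) * (1 + e^-1) + mu * (1 + e^-1)) * d.
  move=> e0 d0; have [phi [tphi h1 h2]] := H10_approx H d0.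
  have [sphi _] := tphi.
  have mphi := smooth_measurable sphi; have mgr := measurable_sphere_grad sphi.
  have md := measurable_subv mgr mg.
  have e1 : 0 <= 1 + e by rewrite addr_ge0// ltW.
  have e2 : 0 <= 1 + e^-1 by rewrite addr_ge0// invr_ge0 ltW.
  have c1 : (Int (fun x => u x ^+ 2) <= (1 + e)%:E * Int (fun x => phi x ^+ 2) + (1 + e^-1)%:E * Int (fun x => (phi x - u x) ^+ 2))%E.
    apply: le_Int_lincomb => //; try (by move=> x; exact: sqr_ge0).
    - exact: measurable_funX.
    - exact: measurable_funX.
    - by apply: measurable_funX; exact: measurable_funB.
    - by move=> x _; exact: sqr_lin.
  have c2 : (Int (fun x => dot (sphere_grad phi x) (sphere_grad phi x)) <= (1 + e)%:E * Int (fun x => dot (g x) (g x)) +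
     (1 + e^-1)%:E * Int (fun x => dot (sphere_grad phi x - g x) (sphere_grad phi x - g x)))%E.
    apply: le_Int_lincomb => //; try (by move=> x; exact: dotxx_ge0).
    - exact: measurable_dot.
    - exact: measurable_dot.
    - exact: measurable_dot.
    - move=> x _; have := dot_sqr_lin (sphere_grad phi x) (g x) e0.
      by rewrite -(opprB (sphere_grad phi x)) dotNl dotNr opprK.
  have c3 := hmu _ tphi.
  have fphi : (Int (fun x => phi x ^+ 2) < +oo)%E.
    by apply: Int_continuous_lty; apply: continuous_sqr; exact: C1_continuous (C1_smooth sphi).
  move: c1 c2 c3 h1 h2; rewrite AE BE.
  have : (0 <= Int (fun x => (phi x - u x) ^+ 2))%E by apply: integral_ge0 => x _; rewrite lee_fin sqr_ge0.
  have : (0 <= Int (fun x => dot (sphere_grad phi x - g x) (sphere_grad phi x - g x)))%E.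
    by apply: integral_ge0 => x _; rewrite lee_fin dotxx_ge0.
  have : (0 <= Int (fun x => phi x ^+ 2))%E by apply: integral_ge0 => x _; rewrite lee_fin sqr_ge0.
  have : (0 <= Int (fun x => dot (sphere_grad phi x) (sphere_grad phi x)))%E.
    by apply: integral_ge0 => x _; rewrite lee_fin dotxx_ge0.
  have fgr : (Int (fun x => dot (sphere_grad phi x) (sphere_grad phi x)) < +oo)%E.
    by apply: Int_continuous_lty; apply: continuous_dot_fun => i; exact: continuous_sphere_grad.
  move: fphi fgr.
  case: (Int (fun x => phi x ^+ 2)) => [a| |]//; case: (Int (fun x => dot (sphere_grad phi x) _)) => [b| |]//.
  case: (Int (fun x => (phi x - u x) ^+ 2)) => [c| |]//; case: (Int (fun x => dot (sphere_grad phi x - _) _)) => [c'| |]//.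
  rewrite ?lee_fin -?EFinM -?EFinD ?lee_fin => _ _ b0 a0 c'0 c0 i1 i2 i3 i4 i5.
  have j1 : mu * A <= (1 + e) * (mu * a) + mu * ((1 + e^-1) * c).
    by rewrite mulrCA -mulrDr; apply: ler_wpM2l.
  have j2 : (1 + e) * (mu * a) <= (1 + e) * ((1 + e) * B + (1 + e^-1) * c').
    by apply: ler_wpM2l => //; exact: le_trans i2.
  have j3 : mu * ((1 + e^-1) * c) <= mu * ((1 + e^-1) * d) by do 2 apply: ler_wpM2l => //.
  have j4 : (1 + e) * ((1 + e^-1) * c') <= (1 + e) * ((1 + e^-1) * d) by do 2 apply: ler_wpM2l => //.
  apply: (le_trans j1); apply: (le_trans (lerD j2 j3)).
  rewrite mulrDr; apply: (le_trans (lerD (lerD (lexx _) j4) (lexx _))).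
  by rewrite le_eqVlt; apply/orP; left; apply/eqP; ring.
have key2 (e : R) : 0 < e -> mu * A <= (1 + e) ^+ 2 * B.
  move=> e0; apply/ler_addgt0Pr => d d0.
  pose k := (1 + e) * (1 + e^-1) + mu * (1 + e^-1) + 1.
  have e1 : 0 <= 1 + e by rewrite addr_ge0// ltW.
  have e2 : 0 <= 1 + e^-1 by rewrite addr_ge0// invr_ge0 ltW.
  have k0 : 0 < k by rewrite ltr_wpDl// addr_ge0// mulr_ge0.
  apply: (le_trans (key e (d / k) e0 (divr_gt0 d0 k0))); rewrite lerD2l.
  by rewrite mulrCA ler_piMr ?(ltW d0)// ler_pdivrMr// mul1r /k lerDl.
apply/ler_addgt0Pr => d d0.
have [d1|d1] := leP B 0.
  have B00 : B = 0 by apply/eqP; rewrite eq_le d1 B0.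
  by have := key2 1 ltr01; rewrite B00 mulr0 add0r => /le_trans; apply; exact: ltW.
(* For [e <= 1] the excess [(1 + e)^2 - 1] is at most [3 e]. *)
pose e := Num.min 1 (d / (3 * B)).
have e0 : 0 < e by rewrite lt_min ltr01 divr_gt0// mulr_gt0.
have e1 : e <= 1 by rewrite ge_min lexx.
have e2 : e * (3 * B) <= d by rewrite -ler_pdivlMr ?mulr_gt0// ge_min lexx orbT.
apply: (le_trans (key2 e e0)); nra.
Qed.

(** The weak equation tested with [u] itself gives energy equal to [lam] times the squared norm, and
    this norm is positive because [u] is not almost everywhere zero. *)
Lemma eigenvalue_ge (mu lam : R) U : 0 <= mu ->
  (forall phi, test_function U phi -> (mu%:E * Int (fun x => phi x ^+ 2) <=
     Int (fun x => dot (sphere_grad phi x) (sphere_grad phi x)))%E) ->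
  dirichlet_eigenvalue U lam -> mu <= lam.
Proof.
move=> mu0 hmu [u [g [H unz weak]]].
have le := rayleigh_closure mu0 hmu H; have [mu_ mg _] := H; have [fu fg] := H10_lty H.
have := weak u g H; rewrite /Rintegral.
pose A := fine (Int (fun x => u x ^+ 2)); pose B := fine (Int (fun x => dot (g x) (g x))).
have AE : Int (fun x => u x ^+ 2) = A%:E.
  by rewrite fineK// ge0_fin_numE// integral_ge0// => x _; rewrite lee_fin sqr_ge0.
have BE : Int (fun x => dot (g x) (g x)) = B%:E.
  by rewrite fineK// ge0_fin_numE// integral_ge0// => x _; rewrite lee_fin dotxx_ge0.
rewrite -/B (_ : fine _ = A); last by congr fine; apply: eq_integral => x _; rewrite expr2.
move=> E; rewrite AE BE -EFinM lee_fin E in le.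
have A0 : 0 < A.
  rewrite lt_neqAle fine_ge0 ?andbT; last by apply: integral_ge0 => x _; rewrite lee_fin sqr_ge0.
  apply/eqP => A00; apply: unz.
  have mu2 : measurable_fun sphere (fun x => (u x ^+ 2)%:E).
    by apply/measurable_EFinP; exact: measurable_funX.
  have [+ _] := @ae_eq_integral_abs _ _ R sigma sphere (@measurable_sphere R n) _ mu2.
  have -> : (\int[sigma]_(x in sphere) `|(u x ^+ 2)%:E| = 0)%E.
    rewrite -A00 in AE; rewrite -[RHS]AE; apply: eq_integral => x _.
    by rewrite gee0_abs// lee_fin sqr_ge0.
  move=> /(_ erefl); apply: filterS => x h xs.
  by have := h xs => /= -[] /eqP; rewrite sqrf_eq0 => /eqP.
by rewrite ler_pM2r in le.
Qed.

End rayleigh.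

(** * The radial eigenfunction *)

Section weak_formulation.
Context {R : realType} {n : nat}.
Notation V := 'rV[R]_n.+1.
Notation sigma := (@sphere_measure R n).
Notation "'Int' f" := (\int[sigma]_(x in sphere) (f x)%:E)%E (at level 10, f at level 8).
Implicit Types (x y p v w : V) (U : set V) (u : V -> R) (g h : V -> V).

(* [phi] is controlled on the sphere only, so differentiate its extension
   constant along rays. *)
Lemma tangential_derive_near0 (phi : V -> R) dphi x v : C1_rV phi dphi -> sphere x ->
  dot x v = 0 -> (\forall y \near x, sphere y -> phi y = 0) -> dphi x v = 0.
Proof.
move=> Cphi xs xv phi0.
have h12 : 2^-1 < 2 :> R by lra.
have h0 : 0 < 2^-1 :> R by lra.
have [m [dm [Cm mE]]] := inv_sqrt_extension h0 h12.
pose M y : V := m (dot y y) *: y.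
have Cg k : C1_rV (fun y => M y ord0 k) (fun x v => m (dot x x) * v ord0 k + x ord0 k * (dm (dot x x) * (2 * dot x v))).
  have -> : (fun x => M x ord0 k) = (fun x => m (dot x x) * x ord0 k).
    by apply/funext => y; rewrite mxE.
  exact: (C1_mul (C1_comp_real Cm (C1_dotxx n)) (C1_coord k)).
have CM := C1_comp Cphi Cg.
have m1 : m 1 = 1 by rewrite mE ?sqrtr1 ?invr1//; lra.
have Mx : M x = x by rewrite /M xs m1 scale1r.
have cM : continuous M by apply: continuous_rV => k; exact: C1_continuous (Cg k).
have [_ E _] := CM.
have : 'D_v (phi \o M) x = 0.
  apply: derive_near0.
  have n1 : \forall y \near x, sphere (M y) -> phi (M y) = 0.
    by have := cM x; rewrite /continuous_at Mx => /(_ _ phi0).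
  have n2 : \forall y \near x, 2^-1 < dot y y.
    have c : (fun y : V => dot y y) @ x --> (1 : R) by rewrite -xs; exact: continuous_dotxx.
    by move/cvgr_gt : c; apply; lra.
  have n3 : \forall y \near x, dot y y < 2.
    have c : (fun y : V => dot y y) @ x --> (1 : R) by rewrite -xs; exact: continuous_dotxx.
    by move/cvgr_lt : c; apply; lra.
  near=> y; rewrite /=.
  have y1 : 2^-1 < dot y y by near: y.
  have y2 : dot y y < 2 by near: y.
  have y0 : 0 < dot y y by exact: lt_trans y1.
  have : sphere (M y) -> phi (M y) = 0 by near: y.
  apply; rewrite /M mE ?ltW//; exact: sphere_normalize.
(* Since [m 1 = 1] and [v] is orthogonal to [x], the derivative of [M] at [x] along [v] is [v]. *)
rewrite E Mx => <-; rewrite (C1_linear x v Cphi); apply: eq_bigr => k _.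
by rewrite xs m1 xv !mulr0 addr0 mul1r.
Unshelve. all: by end_near. Qed.

Definition area : R := fine (sigma sphere).

Lemma areaE : sigma sphere = area%:E.
Proof. by rewrite fineK// ge0_fin_numE//; exact: sphere_measure_fin. Qed.

Lemma area_ge0 : 0 <= area.
Proof. exact: fine_ge0. Qed.

(** The pointwise bound is the outcome of Young's inequality for a bounded factor against an error
    of squared size [D]; with [d = e^2] the integral is of order [e]. *)
Lemma small_Int (f D : V -> R) (e C d : R) : 0 <= C -> 0 < e -> 0 <= d ->
  measurable_fun sphere f -> measurable_fun sphere D -> (forall x, 0 <= D x) ->
  (Int D <= d%:E)%E ->
  (forall x, sphere x -> `|f x| <= e * C + e^-1 * D x) ->
  sigma.-integrable sphere (EFin \o f) /\
  `| (\int[sigma]_(x in sphere) f x)%R | <= e * C * area + e^-1 * d.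
Proof.
move=> C0 e0 d0 mf mD D0 Dd fD; have mS := @measurable_sphere R n.
have ei : 0 <= e^-1 by rewrite invr_ge0 ltW.
have le : (Int (fun x => `|f x|) <= (e * C * area + e^-1 * d)%:E)%E.
  apply: (@le_trans _ _ ((e * C)%:E * Int (fun _ => 1%R) + (e^-1)%:E * Int D)%E).
    apply: le_Int_lincomb => //.
    - by rewrite mulr_ge0// ltW.
    - exact: measurableT_comp.
    - by move=> x xs; rewrite mulr1; exact: fD.
  have -> : Int (fun _ => 1%R) = area%:E.
    by rewrite -areaE -[RHS]mul1e -integral_cst.
  by rewrite EFinD !(EFinM _ area, EFinM _ d) leeD2l// lee_wpmul2l// lee_fin.
have i : sigma.-integrable sphere (EFin \o f).
  apply/integrableP; split; first exact/measurable_EFinP.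
  by apply: le_lt_trans le _; rewrite ltry.
split => //; apply: (le_trans (le_normr_Rintegral mS i)).
rewrite /Rintegral -lee_fin fineK//.
by rewrite ge0_fin_numE ?integral_ge0//; apply: le_lt_trans le _; rewrite ltry.
Qed.

Lemma weak_formulation_closure U u g (mu C : R) : 0 <= mu -> 0 <= C ->
  measurable_fun sphere u -> measurable_fun sphere g ->
  (forall x, sphere x -> u x ^+ 2 <= C) -> (forall x, sphere x -> dot (g x) (g x) <= C) ->
  (forall phi, test_function U phi ->
     (\int[sigma]_(x in sphere) (dot (g x) (sphere_grad phi x) - mu * (u x * phi x))%:E = 0)%E) ->
  forall (v : V -> R) h, H10 U v h ->
    \int[sigma]_(x in sphere) dot (g x) (h x) = mu * \int[sigma]_(x in sphere) (u x * v x).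
Proof.
move=> mu0 C0 mu_ mg uC gC weak v h H.
have [mv mh _] := H; have mS := @measurable_sphere R n.
apply/eqP; rewrite -subr_eq0 -normr_le0; apply/ler_addgt0Pr => eps eps0; rewrite add0r.
(* The two errors add up to [(1 + mu) (e C area + e)], that is [e * K], which is [eps]. *)
pose K := (1 + mu) * (C * area + 1).
have a0 := area_ge0.
have K0 : 0 < K.
  by apply: mulr_gt0; [exact: ltr_pwDl|apply: ltr_wpDl => //; exact: mulr_ge0].
pose e := eps / K; have e0 : 0 < e by rewrite divr_gt0.
have d0 : 0 < e ^+ 2 by rewrite exprn_gt0.
have [phi [tphi h1 h2]] := H10_approx H d0; have [sphi _] := tphi.
have mphi := smooth_measurable sphi; have mgr := measurable_sphere_grad sphi.
pose gr := sphere_grad phi.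
have md := measurable_subv mgr mh.
have msub : measurable_fun sphere (fun x => h x - gr x) by exact: measurable_subv.
have [i1 b1] : sigma.-integrable sphere (EFin \o (fun x => dot (g x) (h x - gr x))) /\
    `| (\int[sigma]_(x in sphere) (dot (g x) (h x - gr x)))%R | <= e * C * area + e^-1 * e ^+ 2.
  apply: (small_Int C0 e0 (ltW d0) _ _ _ h2).
  - exact: measurable_dot.
  - exact: measurable_dot.
  - by move=> x; exact: dotxx_ge0.
  - move=> x xs; have c1 := cauchy_schwarz2 (g x) (h x - gr x) e0.
    have c2 := cauchy_schwarz2 (- g x) (h x - gr x) e0.
    rewrite !dotNl dotNr opprK in c2.
    have E : dot (h x - gr x) (h x - gr x) = dot (gr x - h x) (gr x - h x).
      by rewrite -(opprB (h x)) dotNl dotNr opprK.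
    rewrite E in c1 c2; have := gC x xs; have D0 : 0 <= e^-1 * dot (gr x - h x) (gr x - h x).
      by rewrite mulr_ge0 ?dotxx_ge0// invr_ge0 ltW.
    have := dotxx_ge0 (g x).
    rewrite ler_norml; move: c1 c2 D0; rewrite -/gr.
    move: (dot (g x) (g x)) (dot (g x) (h x - gr x)) (e^-1 * _) => A B D c1 c2 D0 A0 AC.
    have : e * A <= e * C by rewrite ler_wpM2l// ltW.
    have : 0 <= e * C by rewrite mulr_ge0// ltW.
    by lra.
have [i2 b2] : sigma.-integrable sphere (EFin \o (fun x => u x * (v x - phi x))) /\
    `| (\int[sigma]_(x in sphere) (u x * (v x - phi x)))%R | <= e * C * area + e^-1 * e ^+ 2.
  apply: (small_Int C0 e0 (ltW d0) _ _ _ h1).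
  - by apply: measurable_funM => //; exact: measurable_funB.
  - by apply: measurable_funX; exact: measurable_funB.
  - by move=> x; exact: sqr_ge0.
  - move=> x xs; have := uC x xs.
    have D0 : 0 <= e^-1 * (phi x - v x) ^+ 2 by rewrite mulr_ge0 ?sqr_ge0// invr_ge0 ltW.
    have q (s : R) : 2 * (s * (u x * (v x - phi x))) <= e * (u x ^+ 2) + e^-1 * (s ^+ 2 * (phi x - v x) ^+ 2).
      rewrite -subr_ge0.
      have -> : e * u x ^+ 2 + e^-1 * (s ^+ 2 * (phi x - v x) ^+ 2) - 2 * (s * (u x * (v x - phi x))) =
         e^-1 * (e * u x + s * (phi x - v x)) ^+ 2 by field; rewrite gt_eqF.
      by rewrite mulr_ge0 ?sqr_ge0// invr_ge0 ltW.
    have := q 1; have := q (-1); rewrite ler_norml; move: D0; rewrite sqrrN !expr1n !mul1r mulN1r.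
    have := sqr_ge0 (u x).
    move: (u x ^+ 2) (u x * (v x - phi x)) (e^-1 * _) => A B D A0 D0 c1 c2 AC.
    have : e * A <= e * C by rewrite ler_wpM2l// ltW.
    have : 0 <= e * C by rewrite mulr_ge0// ltW.
    by lra.
have ig : sigma.-integrable sphere (EFin \o (fun x => dot (g x) (gr x))).
  have [B [B0 hB]] := sphere_bounded (continuous_dot_fun (fun i => continuous_sphere_grad (i := i) sphi) (fun i => continuous_sphere_grad (i := i) sphi)).
  apply: (@integrable_sphere_bounded _ _ _ (C + B)); first exact: measurable_dot.
  move=> x xs; have c1 := cauchy_schwarz2 (g x) (gr x) ltr01.
  have c2 := cauchy_schwarz2 (- g x) (gr x) ltr01.
  rewrite !dotNl dotNr opprK in c2.
  have := hB x xs; have := gC x xs; rewrite ger0_norm ?dotxx_ge0// -/gr.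
  have := dotxx_ge0 (g x); have := dotxx_ge0 (gr x).
  rewrite ler_norml; move: c1 c2; rewrite invr1 !mul1r.
  by move: (dot (g x) (g x)) (dot (g x) (gr x)) (dot (gr x) (gr x)) => a b c; lra.
have iu : sigma.-integrable sphere (EFin \o (fun x => u x * phi x)).
  have [B [B0 hB]] := sphere_bounded (C1_continuous (C1_smooth sphi)).
  apply: (@integrable_sphere_bounded _ _ _ (C + B ^+ 2)); first exact: measurable_funM.
  move=> x xs; have := uC x xs; have q1 := hB x xs.
  have q2 : phi x ^+ 2 <= B ^+ 2 by rewrite -real_normK ?num_real// lerXn2r// nnegrE.
  have := sqr_ge0 (u x + phi x); have := sqr_ge0 (u x - phi x); rewrite sqrrB sqrrD.
  have := sqr_ge0 (u x); have := sqr_ge0 (phi x); rewrite ler_norml; move: q2.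
  by move: (u x ^+ 2) (phi x ^+ 2) (u x * phi x) (B ^+ 2) => a b c d; lra.
have e1 : (\int[sigma]_(x in sphere) dot (g x) (h x) =
  \int[sigma]_(x in sphere) dot (g x) (gr x) + \int[sigma]_(x in sphere) dot (g x) (h x - gr x))%R.
  rewrite -RintegralD//; apply: eq_Rintegral => x _.
  by rewrite dotDr dotNr addrC subrK.
have e2 : (\int[sigma]_(x in sphere) (u x * v x) =
  \int[sigma]_(x in sphere) (u x * phi x) + \int[sigma]_(x in sphere) (u x * (v x - phi x)))%R.
  by rewrite -RintegralD//; apply: eq_Rintegral => x _; rewrite -mulrDr addrC subrK.
have e3 : (\int[sigma]_(x in sphere) dot (g x) (gr x) = mu * \int[sigma]_(x in sphere) (u x * phi x))%R.
  apply/eqP; rewrite -subr_eq0 -RintegralZl// -RintegralB//; last first.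
    exact: (integrableZl mS mu iu).
  by rewrite /Rintegral weak.
rewrite e1 e2 e3 mulrDr opprD addrACA subrr add0r.
apply: (le_trans (ler_normB _ _)); rewrite normrM (ger0_norm mu0).
apply: (le_trans (lerD b1 (ler_wpM2l mu0 b2))).
have -> : e^-1 * e ^+ 2 = e by rewrite expr2 mulrA mulVf ?mul1r// gt_eqF.
have -> : e * C * area + e + mu * (e * C * area + e) = e * K by rewrite /K; ring.
by rewrite /e divfK// gt_eqF.
Qed.

End weak_formulation.

(** * Smooth ramps with quantitative bounds *)

Section cutoff.
Context {R : realType}.
Implicit Types (c d t y z : R).

Definition dflat1 : R -> R := flat ('X^2 * (1 - 1^`())).

Lemma dflat1E z : 0 < z -> dflat1 z = z^-1 ^+ 2 * expR (- z^-1).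
Proof. by move=> z0; rewrite /dflat1 /flat z0 derivC subr0 mulr1 hornerXn. Qed.

Lemma dflat1_le0 z : z <= 0 -> dflat1 z = 0.
Proof. by rewrite /dflat1 /flat ltNge => ->. Qed.

Lemma dflat1_ge0 z : 0 <= dflat1 z.
Proof.
have [z0|z0] := ltP 0 z; last by rewrite dflat1_le0.
by rewrite dflat1E// mulr_ge0 ?sqr_ge0 ?expR_ge0.
Qed.

(** With [w = 1 / z] the claim is [(1 + w)^2 <= 4 exp w], which follows from
    [exp w >= (1 + w / 2)^2]. *)
Lemma dflat1_le z : 0 < z -> dflat1 z <= 4 / (1 + z) ^+ 2.
Proof.
move=> z0; have zi : 0 < z^-1 by rewrite invr_gt0.
rewrite dflat1E// expRN ler_pdivlMr; last by rewrite exprn_gt0// addr_gt0.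
rewrite mulrAC ler_pdivrMr ?expR_gt0// -exprMn mulrDr mulr1 mulVf ?gt_eqF//.
have h : (1 + z^-1 / 2) ^+ 2 <= expR z^-1.
  have -> : expR z^-1 = expR (z^-1 / 2) ^+ 2 by rewrite -expRM_natl mulrC divfK.
  by rewrite lerXn2r ?nnegrE ?expR_ge0 ?expR_ge1Dx// addr_ge0// divr_ge0 ?ltW.
by move: (z^-1) zi h => w w0; move: (expR w) => E; nra.
Qed.

Lemma flat1_ge2 z : 0 < z -> 1 - flat1 z <= 2 / (1 + z).
Proof.
move=> z0; have z1 : 0 < 1 + z by rewrite addr_gt0.
rewrite ler_pdivlMr//; have h1 := flat1_ge0 z.
have [zl|zl] := leP z 1; first by nra.
have h2 := flat1_ge z0.
have h3 : z^-1 * (1 + z) <= 2.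
  by rewrite mulrDr mulr1 mulVf ?gt_eqF// (_ : 2 = 1 + 1 :> R)// lerD2r invf_le1// ltW.
apply: le_trans h3; rewrite ler_wpM2r ?(ltW z1)//; lra.
Qed.

(** The argument is [(t - c - d) / d], in the affine form of [Ck_affine]. The ramp vanishes up to
    [c + d] and never reaches [1]; its defect decays like [d / (t - c)] and its slope like
    [d / (t - c)^2]. *)
Definition ramp c d t := flat1 (d^-1 * t + (- (c + d) / d)).
Definition dramp c d t := dflat1 (d^-1 * t + (- (c + d) / d)) * d^-1.

Lemma ramp_arg c d t : 0 < d -> d^-1 * t + (- (c + d) / d) = (t - c - d) / d.
Proof. by move=> d0; field; rewrite gt_eqF. Qed.

Lemma ramp_smooth c d : smooth_real (ramp c d).
Proof. by move=> k; apply: Ck_affine; exact: flat_smooth. Qed.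

Lemma ramp_derive c d t : is_derive t 1 (ramp c d) (dramp c d t).
Proof.
apply: (@is_derive1_comp _ flat1 (fun t => d^-1 * t + _)); first exact: flat_derive.
by apply: is_derive_eq; rewrite addr0 [LHS]mulr1.
Qed.

Lemma ramp_ge0 c d t : 0 <= ramp c d t. Proof. exact: flat1_ge0. Qed.
Lemma ramp_le1 c d t : ramp c d t <= 1. Proof. exact: flat1_le1. Qed.
Lemma dramp_ge0 c d t : 0 < d -> 0 <= dramp c d t.
Proof. by move=> d0; rewrite mulr_ge0 ?dflat1_ge0// invr_ge0 ltW. Qed.

Lemma ramp_eq0 c d t : 0 < d -> t <= c + d -> ramp c d t = 0 /\ dramp c d t = 0.
Proof.
move=> d0 tc; have h : (t - c - d) / d <= 0 by rewrite ler_pdivrMr// mul0r; lra.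
by rewrite /ramp /dramp ramp_arg// flat1_le0// dflat1_le0// mul0r.
Qed.

Lemma ramp_bound c d t : 0 < d -> c <= t -> 1 - ramp c d t <= 4 * (d / (t - c + d)).
Proof.
move=> d0 ct; have p0 : 0 < t - c + d by lra.
rewrite mulrA ler_pdivlMr//.
have [tc|tc] := leP t (c + d); first by rewrite (ramp_eq0 d0 tc).1; lra.
have z0 : 0 < (t - c - d) / d by rewrite divr_gt0//; lra.
have := flat1_ge2 z0; rewrite -ramp_arg// -/(ramp c d t) ramp_arg//.
have -> : 1 + (t - c - d) / d = (t - c) / d by field; rewrite gt_eqF.
rewrite invf_div mulrA ler_pdivlMr; last lra.
have := ramp_le1 c d t; move: (ramp c d t) => E; nra.
Qed.

Lemma dramp_bound c d t : 0 < d -> c <= t -> dramp c d t <= 16 * (d / (t - c + d) ^+ 2).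
Proof.
move=> d0 ct; have p0 : 0 < t - c + d by lra.
have [tc|tc] := leP t (c + d).
  by rewrite (ramp_eq0 d0 tc).2 mulr_ge0// divr_ge0 ?sqr_ge0// ltW.
have z0 : 0 < (t - c - d) / d by rewrite divr_gt0//; lra.
have y0 : 0 < t - c by lra.
have := dflat1_le z0; rewrite -ramp_arg// => h.
have {}h : dramp c d t <= 4 * (d / (t - c) ^+ 2).
  rewrite /dramp ler_pdivrMr//; apply: (le_trans h); rewrite ramp_arg//.
  have -> : 1 + (t - c - d) / d = (t - c) / d by field; rewrite gt_eqF.
  rewrite le_eqVlt; apply/orP; left; apply/eqP; field.
  by rewrite !gt_eqF.
apply: (le_trans h).
rewrite (_ : 16 * _ = 4 * (4 * d / (t - c + d) ^+ 2)); last by field; rewrite gt_eqF.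
rewrite ler_pM2l// ler_pdivlMr ?exprn_gt0// mulrAC ler_pdivrMr ?exprn_gt0//.
have hy : (t - c + d) ^+ 2 <= 4 * (t - c) ^+ 2.
  have : d < t - c by lra.
  by move: (t - c) y0 => y y0 dy; nra.
by rewrite [leRHS](_ : _ = d * (4 * (t - c) ^+ 2)) ?ler_pM2l//; ring.
Qed.

End cutoff.

Section radial_test.
Context {R : realType} {m : nat}.
Notation V := 'rV[R]_m.+2.
Notation sigma := (@sphere_measure R m.+1).
Notation "'Int' f" := (\int[sigma]_(x in sphere) (f x)%:E)%E (at level 10, f at level 8).
Implicit Types (x y p : V).

Lemma radial_test_function p r c (F : R -> R) : sphere p -> 0 <= r -> r <= pi ->
  smooth_real F -> cos r < c -> (forall t, t <= c -> F t = 0) ->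
  test_function (geodesic_ball p r) (fun x => F (dot x p)).
Proof.
move=> ps r0 rpi sF rc F0; split; first exact: radial_smooth.
exists [set x | sphere x /\ c <= dot x p]; split.
- apply: bounded_closed_compact.
    exists 1; split; first exact: num_real.
    move=> M M1 x [xs _]; rewrite /= [leLHS]/Num.Def.normr/= mx_normrE.
    apply: bigmax_le => [|[i j] _]; first by rewrite ltW// (lt_trans _ M1).
    by rewrite (ord1 i) (le_trans (sphere_coord j xs))// ltW.
  apply: closedI.
    rewrite (_ : sphere = (fun x => dot x x) @^-1` [set 1])//.
    apply: preimage_closed => [x _|]; last exact: closed_eq.
    exact: continuous_dotxx.
  apply: (preimage_closed (f := fun x => dot x p) (D := [set t | c <= t])) => [x _|]; last exact: closed_ge.
  exact: (C1_continuous (C1_dot p)).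
- move=> x [xs xc]; split => //; rewrite geodesic_ballE//.
  exact: lt_le_trans xc.
- move=> x xs nx; apply: F0; rewrite leNgt; apply/negP => h; apply: nx; split => //.
  exact: ltW.
Qed.

Definition cap p c : set V := [set x | c < dot x p].

Lemma open_cap p c : open (cap p c).
Proof.
rewrite (_ : cap p c = (fun x => dot x p) @^-1` [set t | c < t])//.
apply: open_comp => [x _|]; last exact: open_gt.
exact: (C1_continuous (C1_dot p)).
Qed.

Lemma measurable_cap p c : measurable (cap p c).
Proof. by apply: open_measurable_rV; exact: open_cap. Qed.

(** The cone over the cap inside the unit ball contains the open set [O], which is nonempty since
    [p / 2] belongs to it. *)
Lemma sphere_cap_gt0 p c : sphere p -> c < 1 -> (0 < sigma (sphere `&` cap p c))%E.
Proof.
move=> ps c1; have mS := @measurable_sphere R m.+1.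
have mc := measurable_cap p c.
have mind (A : set V) : measurable A -> measurable_fun setT (fun x : V => (\1_A x : R)%:E).
  move=> mA; have h : measurable_fun setT (\1_A : V -> R) by exact: measurable_indic.
  by move/measurable_EFinP : h.
have mi := mind _ mc.
have i0 (x : V) : (0 <= (\1_(cap p c) x : R)%:E)%E by rewrite lee_fin.
have := ge0_integral_sphere mi i0; rewrite integral_indic// setIC => ->.
rewrite mule_gt0 ?lte_fin//.
pose O : set V := [set x | 0 < dot x x] `&` [set x | dot x x < 1] `&`
  [set x | 0 < dot x p - c * Num.sqrt (dot x x)].
have cd := @continuous_dotxx R m.+1.
have oO : open O.
  apply: openI; first apply: openI.
  - by apply: (open_comp (f := fun x : V => dot x x) (D := [set t | 0 < t])) => [x _|]; [exact: cd|exact: open_gt].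
  - by apply: (open_comp (f := fun x : V => dot x x) (D := [set t | t < 1])) => [x _|]; [exact: cd|exact: open_lt].
  - apply: (open_comp (f := fun x : V => dot x p - c * Num.sqrt (dot x x)) (D := [set t | 0 < t])) => [x _|]; last exact: open_gt.
    apply: (@continuousB _ _ _ (fun x => dot x p) (fun x => c * Num.sqrt (dot x x))).
      exact: (C1_continuous (C1_dot p)).
    apply: (@continuousM _ _ (cst c) (fun x => Num.sqrt (dot x x))); first exact: cst_continuous.
    by apply: (@continuous_comp _ _ _ (fun x => dot x x) (@Num.sqrt R)); [exact: cd|exact: sqrt_continuous].
have Op : O (2^-1 *: p).
  rewrite /O /= !dotZl !dotZr ps !mulr1; split; first by split; lra.
  have -> : 2^-1 * 2^-1 = (2^-1) ^+ 2 :> R by rewrite expr2.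
  by rewrite sqrtr_sqr ger0_norm; lra.
have := open_lebesgue_rV_gt0 oO Op; move/lt_le_trans; apply.
have mO : measurable O by exact: open_measurable_rV.
have mB := @measurable_punctured_ball R m.+1.
have OB : O `&` punctured_ball = O.
  by apply: setIidl => x [[h1 h2] _]; rewrite /punctured_ball/= h1 ltW.
have -> : (lebesgue_rV m.+2 O = \int[lebesgue_rV m.+2]_(x in punctured_ball) (\1_O x)%:E)%E.
  by rewrite -[in LHS]OB; apply/esym; exact: integral_indic.
apply: ge0_le_integral => //.
- by apply: measurable_funTS; exact: mind.
- apply: measurable_funTS; apply: (measurableT_comp mi); exact: measurable_normalize.
- move=> x _; rewrite lee_fin !indicE.
  have [xO|xO] := pselect (O x); last by rewrite memNset.
  rewrite (mem_set xO) mem_set//; move: xO => [[x0 _] h].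
  rewrite /cap /= /normalize dotZl mulrC ltr_pdivlMr ?sqrtr_gt0//.
  by move: h; rewrite /= subr_gt0.
Qed.

End radial_test.

Section ball_eigenvalue.
Context {R : realType} {m : nat}.
Notation V := 'rV[R]_m.+2.
Notation sigma := (@sphere_measure R m.+1).
Notation "'Int' f" := (\int[sigma]_(x in sphere) (f x)%:E)%E (at level 10, f at level 8).
Implicit Types (x y p : V).

(** Boundary layer of width [d] at the edge of the cap, dominating the errors made by a ramp; the
    maximum keeps the denominator positive on the whole space. *)
Definition layer p c (d : R) x : R := d / (Num.max (dot x p - c) 0 + d) * \1_(cap p c) x.

Lemma layer_bounds p c d x : 0 < d -> 0 <= layer p c d x <= 1.
Proof.
move=> d0; rewrite /layer.
have h : 0 < Num.max (dot x p - c) 0 + d by rewrite ltr_wpDl// le_max lexx orbT.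
have h2 : d / (Num.max (dot x p - c) 0 + d) <= 1.
  by rewrite ler_pdivrMr// mul1r lerDr le_max lexx orbT.
have h3 : 0 <= d / (Num.max (dot x p - c) 0 + d) by rewrite divr_ge0// ltW.
rewrite indicE; case: (x \in _); rewrite ?mulr1 ?mulr0 ?lexx ?ler01 ?h2 ?h3//.
Qed.

Lemma measurable_layer p c d : 0 < d -> measurable_fun setT (layer p c d).
Proof.
move=> d0; apply: measurable_funM; last first.
  by apply: measurable_indic; exact: measurable_cap.
apply: continuous_measurable_rV => x.
apply: (@continuousM _ _ (cst d) (fun x : V => (Num.max (dot x p - c) 0 + d)^-1)); first exact: cst_continuous.
apply: (@continuousV _ _ (fun x : V => Num.max (dot x p - c) 0 + d)).
  by rewrite gt_eqF// ltr_wpDl// le_max lexx orbT.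
apply: (@continuousD _ _ _ (fun x : V => Num.max (dot x p - c) 0) (cst d)); last exact: cst_continuous.
apply: continuous_max; last exact: cst_continuous.
apply: (@continuousB _ _ _ (fun x : V => dot x p) (cst c)); last exact: cst_continuous.
exact: (C1_continuous (C1_dot p)).
Qed.

(** Dominated convergence: in the cap the layer is at most [d / (dot x p - c)], and on the edge
    itself the indicator of the open cap is zero. *)
Lemma Int_layer_small p c (e : R) : 0 < e -> exists2 d, 0 < d <= 1 & (Int (layer p c d) <= e%:E)%E.
Proof.
move=> e0; have mS := @measurable_sphere R m.+1.
have k0 k : 0 < k.+1%:R^-1 :> R by rewrite invr_gt0.
have cv : (fun k => Int (layer p c k.+1%:R^-1)) @ \oo --> (\int[sigma]_(x in sphere) (cst 0 x))%E.
  apply: (@dominated_cvg _ _ _ sigma sphere mS _ _ (cst 1%E)) => //.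
  - by move=> k; apply/measurable_EFinP/measurable_funTS; exact: measurable_layer.
  - move=> x _ /=; apply: cvg_EFin; first by near=> k.
    have [xc|xc] := pselect (cap p c x); last first.
      rewrite (_ : (fun k => _) = cst 0); first exact: cvg_cst.
      by apply/funext => k; rewrite /layer /= indicE memNset// mulr0.
    have y0 : 0 < dot x p - c by rewrite subr_gt0.
    apply: (squeeze_cvgr (f := cst 0) (h := fun k => k.+1%:R^-1 * (dot x p - c)^-1)).
    - near=> k; rewrite /= (andP (layer_bounds p c x (k0 k))).1 /layer indicE mem_set// mulr1.
      rewrite ler_wpM2l ?(ltW (k0 k))// lef_pV2 ?posrE//; last by rewrite addr_gt0// max_l// ltW.
      by rewrite max_l ?ltW// ltrDl.
    - exact: cvg_cst.
    - rewrite -[X in _ --> X](mul0r (dot x p - c)^-1); apply: cvgM; last exact: cvg_cst.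
      exact: cvg_harmonic.
  - apply: (integrable_sphere_bounded (f := cst 1) (C := 1)); first exact: measurable_cst.
    by move=> x _; rewrite normr1.
  - move=> k x _; rewrite abse_EFin lee_fin ger0_norm.
      by have /andP[] := layer_bounds p c x (k0 k).
    by have /andP[] := layer_bounds p c x (k0 k).
rewrite integral0 in cv; move/fine_cvgP : cv => [fc /cvgr0Pnorm_le/(_ _ e0) h].
have [k [h1 h2]] : exists k, (Int (layer p c k.+1%:R^-1) \is a fin_num) /\ `|fine (Int (layer p c k.+1%:R^-1))| <= e.
  by apply: (@filter_ex _ (nbhs \oo) _); near=> k; split; near: k.
exists k.+1%:R^-1; first by rewrite k0 invf_le1// ler1n.
by rewrite -(fineK h1) lee_fin (le_trans (ler_norm _)).
Unshelve. all: by end_near. Qed.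

(** The eigenfunction is [f (dot x p)] extended by zero, approximated in [H10] by a ramp times a
    polynomial close to [f]. The critical gradient term is the polynomial times the slope of the
    ramp; it stays bounded because [f] vanishes linearly at the edge. *)
Lemma ball_eigenvalue p r mu f df f1 f2 : sphere p -> 0 < r -> r < pi -> 0 <= mu ->
  radial_eigenpair m mu (cos r) f df f1 f2 ->
  (forall e : R, 0 < e -> exists P : {poly R}, forall t, cos r <= t <= 1 ->
     `|P.[t] - f t| <= e /\ `|P^`().[t] - f1 t| <= e) ->
  dirichlet_eigenvalue (geodesic_ball p r) mu.
Proof.
move=> ps r0 rpi mu0 [[Df cdf] [Df1 cf2] E f0 fp] hP.
have mS := @measurable_sphere R m.+1.
have cp := C1_continuous (C1_dot p).
have cf : continuous f by exact: derive_continuous Df.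
have cf1 : continuous f1 by exact: derive_continuous Df1.
pose c := cos r.
have c1 : c < 1 by rewrite /c -cos0 ltr_cos_pi// ltW.
have cN1 : -1 <= c by exact: cos_geN1.
pose ind : V -> R := \1_(cap p c).
have mind : measurable_fun setT ind by apply: measurable_indic; exact: measurable_cap.
have ind1 x : c < dot x p -> ind x = 1 by move=> h; rewrite /ind indicE mem_set.
have ind0 x : dot x p <= c -> ind x = 0.
  by move=> h; rewrite /ind indicE memNset// /cap/= => /(le_lt_trans h); rewrite ltxx.
pose u x := ind x * f (dot x p).
pose g x : V := (ind x * f1 (dot x p)) *: tangent p x.
have [C [C0 fC f1C]] : exists C, [/\ 0 <= C, (forall t, c <= t <= 1 -> `|f t| <= C * (t - c)) & forall t, c <= t <= 1 -> `|f1 t| <= C].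
  have [|y ycc hy] := @EVT_max R (fun t => `|f1 t|) c 1 (ltW c1).
    apply: continuous_subspaceT => t.
    by apply: (@continuous_comp _ _ _ f1 (@Num.norm R R)); [exact: cf1|exact: norm_continuous].
  have h1 t : c <= t <= 1 -> `|f1 t| <= `|f1 y| by move=> ht; apply: hy; rewrite in_itv.
  exists `|f1 y|; split => // t /andP[]; rewrite le_eqVlt => /predU1P[<-|ct] t1.
    by rewrite f0 normr0 subrr mulr0.
  have [w /andP[w1 w2] Ew] := mvt_derive ct (fun z _ => Df z).
  have tc0 : 0 <= t - c by rewrite subr_ge0 ltW.
  rewrite f0 subr0 in Ew; rewrite Ew normrM (ger0_norm tc0).
  have wc : c <= w <= 1 by rewrite (ltW w1) (le_trans (ltW w2)).
  have [-> _] := E w wc.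
  by rewrite ler_wpM2r// h1.
have ccomp (k : R -> R) : continuous k -> continuous (fun x : V => k (dot x p)).
  by move=> ck x; apply: (@continuous_comp _ _ _ (fun x => dot x p) k); [exact: cp|exact: ck].
have mcomp (k : R -> R) : continuous k -> measurable_fun setT (fun x : V => k (dot x p)).
  by move=> ck; apply: continuous_measurable_rV; exact: ccomp.
have mu_ : measurable_fun sphere u.
  by apply: measurable_funTS; apply: measurable_funM => //; exact: mcomp.
have mg : measurable_fun sphere g.
  apply: measurable_fun_rV_on => i.
  rewrite (_ : (fun x => _) = (fun x => (ind x * f1 (dot x p)) * (p ord0 i - dot x p * x ord0 i))); last first.
    by apply/funext => x; rewrite !mxE.
  apply: measurable_funTS; apply: measurable_funM.
    by apply: measurable_funM => //; exact: mcomp.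
  apply: measurable_funB; first exact: measurable_cst.
  by apply: measurable_funM; [exact: (continuous_measurable_rV cp)|exact: measurable_coord].
have HU : H10 (geodesic_ball p r) u g.
  apply: H10_intro => // e e0.
  (* With [q = d / (y + d)] and [y] the height above the edge, the error in value is at most
     [(3 + 8 C) q] and the error in slope at most [3 q + 4 C q + 16 (C + 1) q]. *)
  pose K := 20 + 20 * C.
  have K0 : 0 < K by rewrite /K; lra.
  have [|d /andP[d0 d1] hd] := @Int_layer_small p c (e / K ^+ 2).
    by rewrite divr_gt0// exprn_gt0.
  (* An accuracy [d^2 <= d] is dominated by [3 d / (y + d)], as [y + d <= 3]. *)
  have [P hPd] := hP (d ^+ 2) (exprn_gt0 2 d0).
  pose F t := ramp c d t * P.[t].
  pose dF t := ramp c d t * P^`().[t] + P.[t] * dramp c d t.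
  have sF : smooth_real F by move=> k; apply: CkM; [exact: ramp_smooth|exact: Ck_horner].
  have DF (t : R) : is_derive t 1 F (dF t).
    have DP : is_derive t 1 (horner P) P^`().[t].
      apply: DeriveDef; first exact: derivable_horner.
      by rewrite -derive1E -derivE.
    exact: (is_deriveM (ramp_derive c d t) DP).
  have CF := smooth_C1 sF DF.
  have bound (x : V) : sphere x -> `|F (dot x p) - u x| <= K * layer p c d x /\
       `|dF (dot x p) - ind x * f1 (dot x p)| <= K * layer p c d x.
    move=> xs; have /andP[t1 t2] := sphere_dot_bound xs ps.
    rewrite /u; move: t1 t2; set t := dot x p => t1 t2.
    have [tc|tc] := leP t c.
      have tcd : t <= c + d by rewrite (le_trans tc)// lerDl ltW.
      rewrite ind0// /layer -/(ind x) ind0// !(mul0r, mulr0, subr0).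
      by rewrite /F /dF (ramp_eq0 d0 tcd).1 (ramp_eq0 d0 tcd).2 !(mul0r, mulr0, add0r) normr0.
    rewrite ind1// /layer -/(ind x) ind1// !(mul1r, mulr1).
    have tt : c <= t <= 1 by rewrite (ltW tc).
    have [h1 h2] := hPd t tt; have h3 := fC t tt; have h4 := f1C t tt.
    have b1 := ramp_bound d0 (ltW tc); have b2 := dramp_bound d0 (ltW tc).
    have e1 := ramp_le1 c d t; have e2 := ramp_ge0 c d t; have e3 := dramp_ge0 c t d0.
    rewrite max_l ?subr_ge0 ?(ltW tc)//.
    have y0 : 0 < t - c by rewrite subr_gt0.
    have y2 : t - c <= 2 by lra.
    have s0 : 0 < t - c + d by rewrite addr_gt0.
    have q3 : d <= 3 * (d / (t - c + d)).
      by rewrite mulrA ler_pdivlMr//; nra.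
    have dq : dramp c d t * (t - c + d) <= 16 * (d / (t - c + d)).
      rewrite -ler_pdivlMr//; apply: (le_trans b2); rewrite le_eqVlt; apply/orP; left; apply/eqP.
      by field; rewrite gt_eqF.
    have q0 : 0 <= d / (t - c + d) by rewrite divr_ge0// ltW.
    rewrite /F /dF /K; move: h1 h2 h3 h4 b1 e1 e2 e3 dq q0 q3.
    move: (t - c) y0 y2 s0 => y y0 y2 s0.
    move: (d / (y + d)) (ramp c d t) (dramp c d t) P.[t] P^`().[t] (f t) (f1 t) => q et de p0 p1 F0 F1.
    move=> h1 h2 h3 h4 b1 e1 e2 e3 dq q0 q3.
    have dd : d ^+ 2 <= 3 * q by apply: le_trans q3; rewrite expr2 ler_piMl// ltW.
    have et1 : 0 <= 1 - et by rewrite subr_ge0.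
    split.
      have -> : et * p0 - F0 = et * (p0 - F0) - (1 - et) * F0 by ring.
      apply: (le_trans (ler_normB _ _)); rewrite !normrM (ger0_norm e2) (ger0_norm et1).
      have i1 : et * `|p0 - F0| <= 3 * q.
        by apply: le_trans dd; apply: le_trans h1; rewrite ler_piMl.
      have i2 : (1 - et) * `|F0| <= (4 * q) * (C * 2).
        by apply: ler_pM => //; apply: (le_trans h3); rewrite ler_wpM2l.
      have : 0 <= C * q by rewrite mulr_ge0.
      move: i1 i2; lra.
    have -> : et * p1 + p0 * de - F1 = et * (p1 - F1) - (1 - et) * F1 + p0 * de by ring.
    apply: (le_trans (ler_normD _ _)); apply: (le_trans (lerD (ler_normB _ _) (lexx _))).
    rewrite !normrM (ger0_norm e2) (ger0_norm et1) (ger0_norm e3).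
    have i1 : et * `|p1 - F1| <= 3 * q.
      by apply: le_trans dd; apply: le_trans h2; rewrite ler_piMl.
    have i2 : (1 - et) * `|F1| <= (4 * q) * C by apply: ler_pM.
    have p0b : `|p0| <= (C + 1) * (y + d).
      have -> : p0 = (p0 - F0) + F0 by rewrite subrK.
      apply: (le_trans (ler_normD _ _)); apply: (le_trans (lerD h1 h3)).
      have : d ^+ 2 <= d by rewrite expr2 ler_piMl// ltW.
      have : 0 <= C * d by rewrite mulr_ge0// ltW.
      by move: (d ^+ 2) => d2; nra.
    have i3 : `|p0| * de <= (C + 1) * (16 * q).
      apply: (@le_trans _ _ ((C + 1) * (y + d) * de)); first by rewrite ler_wpM2r.
      by rewrite -mulrA ler_wpM2l ?addr_ge0// mulrC.
    have : 0 <= C * q by rewrite mulr_ge0.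
    move: i1 i2 i3; lra.
  (* As [l <= 1], squares are controlled by [l] itself, so the plain integral of the layer is
     enough. The null term fits [le_Int_lincomb]. *)
  have sqb (a l : R) : `|a| <= K * l -> 0 <= l <= 1 -> a ^+ 2 <= K ^+ 2 * l + 0 * 0.
    move=> h /andP[l0 l1]; rewrite mul0r addr0 -real_normK ?num_real//.
    apply: (@le_trans _ _ ((K * l) ^+ 2)); first by rewrite lerXn2r// nnegrE mulr_ge0// ltW.
    by rewrite exprMn ler_wpM2l ?sqr_ge0// expr2 ler_piMl.
  have IK : ((K ^+ 2)%:E * Int (layer p c d) + 0%:E * Int (fun _ => 0%R) <= e%:E)%E.
    rewrite mul0e adde0.
    apply: (@le_trans _ _ ((K ^+ 2)%:E * (e / K ^+ 2)%:E)%E).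
      by rewrite lee_wpmul2l// lee_fin sqr_ge0.
    by rewrite -EFinM lee_fin mulrC divfK// expf_neq0// gt_eqF.
  have ml : measurable_fun sphere (layer p c d) by apply: measurable_funTS; exact: measurable_layer.
  have l0 x : 0 <= layer p c d x by have /andP[] := layer_bounds p c x d0.
  exists (fun x => F (dot x p)); split.
  - apply: (@radial_test_function _ _ p r (c + d)) => //; rewrite ?ltW//.
      by rewrite ltrDl.
    by move=> t tcd; rewrite /F (ramp_eq0 d0 tcd).1 mul0r.
  - apply: le_trans IK; apply: le_Int_lincomb => //.
    + exact: sqr_ge0.
    + by apply: measurable_funX; apply: measurable_funB => //; apply: measurable_funTS; apply: mcomp; exact: derive_continuous DF.
    + by move=> x; exact: sqr_ge0.
    + by move=> x xs; apply: sqb; [exact: (bound x xs).1|exact: layer_bounds].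
  - apply: le_trans IK; apply: le_Int_lincomb => //.
    + exact: sqr_ge0.
    + have sm := radial_smooth p sF.
      by apply: measurable_dot; apply: measurable_subv => //; exact: measurable_sphere_grad.
    + by move=> x; exact: dotxx_ge0.
    + move=> x xs; rewrite (sphere_grad_radial _ _ CF) /g -scalerBl dotZl dotZr tangent_sqr//.
      apply: le_trans (sqb _ _ (bound x xs).2 (layer_bounds p c x d0)).
      rewrite mulrA -expr2 ler_piMr ?sqr_ge0//.
      by rewrite gerBl sqr_ge0.
exists u, g; split => //.
- move=> [N [mN N0 uN]].
  have := sphere_cap_gt0 ps c1; rewrite ltNge => /negP; apply.
  rewrite -N0; apply: le_measure; rewrite ?inE//.
    by apply: measurableI => //; exact: measurable_cap.
  move=> x [xs xc]; apply: uN => /= /(_ xs); rewrite /u ind1// mul1r => fx.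
  have : 0 < f (dot x p) by apply: fp; rewrite xc; have /andP[] := sphere_dot_bound xs ps.
  by rewrite fx ltxx.
- have tc2 (x : V) : sphere x -> c < dot x p -> c <= dot x p <= 1.
    by move=> xs h; rewrite (ltW h); have /andP[] := sphere_dot_bound xs ps.
  apply: (@weak_formulation_closure _ _ _ _ _ _ (4 * C ^+ 2)) => //.
  + by rewrite mulr_ge0// sqr_ge0.
  + move=> x xs; rewrite /u; have [xc|xc] := ltP c (dot x p); last first.
      by rewrite ind0// mul0r expr0n/= mulr_ge0// sqr_ge0.
    rewrite ind1// mul1r; have ht := tc2 x xs xc; have := fC _ ht.
    move=> h; rewrite -real_normK ?num_real//.
    have -> : 4 * C ^+ 2 = (C * 2) ^+ 2 by ring.
    rewrite lerXn2r ?nnegrE ?mulr_ge0//; apply: (le_trans h).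
    by rewrite ler_wpM2l//; move: ht cN1; lra.
  + move=> x xs; rewrite /g dotZl dotZr tangent_sqr// mulrA -expr2.
    have [xc|xc] := ltP c (dot x p); last first.
      by rewrite ind0// mul0r expr0n/= mul0r mulr_ge0// sqr_ge0.
    rewrite ind1// mul1r; have ht := tc2 x xs xc; have h := f1C _ ht.
    have h2 : f1 (dot x p) ^+ 2 <= C ^+ 2.
      by rewrite -real_normK ?num_real// lerXn2r// nnegrE.
    have h3 := sqr_ge0 (f1 (dot x p)).
    apply: (@le_trans _ _ (f1 (dot x p) ^+ 2)).
      by rewrite ler_piMr// gerBl sqr_ge0.
    by apply: (le_trans h2); rewrite ler_peMl ?sqr_ge0// ler1n.
  + move=> phi tphi; have [sphi _] := tphi; have Cphi := C1_smooth sphi.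
    have [tau /andP[tau1 tau2] [K clK [phi0 Ktau]]] := test_function_support r0 (ltW rpi) ps tphi.
    rewrite -(sphere_ibp ps Cphi (conj Df1 cf2)).
    apply: eq_integral => x; rewrite inE => xs; congr EFin.
    rewrite /g dotZl (dotC (tangent p x)) sphere_grad_tangent// /u.
    have [xc|xc] := ltP c (dot x p).
      have [_ ode] := E _ (tc2 x xs xc); rewrite ind1// !mul1r.
      have -> : f2 (dot x p) * (1 - dot x p ^+ 2) - m.+1%:R * dot x p * f1 (dot x p) = - (mu * f (dot x p)).
        by apply/eqP; rewrite -addr_eq0 [f2 _ * _]mulrC ode.
      ring.
    (* Outside the cap the extension of [f1] satisfies no equation, but [phi] vanishes on the sphere
       near [x], so both integrands are zero there. *)
    have nK : ~ K x by move=> /Ktau/(lt_le_trans tau1)/(le_lt_trans xc); rewrite ltxx.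
    have -> : 'D_(tangent p x) phi x = 0.
      apply: (tangential_derive_near0 Cphi xs (dot_tangent p xs)).
      have : \forall y \near x, (~` K) y by apply: open_nbhs_nbhs; split => //; exact: closed_openC.
      by apply: filterS => y nKy ys; exact: phi0.
    by rewrite (phi0 _ xs nK) ind0// !(mul0r, mulr0) addr0 subr0.
Qed.

End ball_eigenvalue.

(** * The sphere minus a point *)

Section punctured_sphere.
Context {R : realType} {m : nat}.
Notation V := 'rV[R]_m.+2.
Notation sigma := (@sphere_measure R m.+1).
Notation "'Int' f" := (\int[sigma]_(x in sphere) (f x)%:E)%E (at level 10, f at level 8).
Implicit Types (x y p : V).

(* [1 + dot x p] is half the squared chordal distance to the antipode of [p]. *)
Definition concentrated p (d : R) x : R := d / (1 + dot x p + d) ^+ 2.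

Lemma concentrated_ge0 p d x : 0 < d -> 0 <= concentrated p d x.
Proof. by move=> d0; rewrite divr_ge0 ?sqr_ge0// ltW. Qed.

Lemma concentrated_sqr p d x : 0 < 1 + dot x p + d ->
  16 * d * concentrated p d x = (4 * (d / (1 + dot x p + d))) ^+ 2.
Proof. by rewrite /concentrated => h; field; rewrite gt_eqF. Qed.

(** Take [G t = - 1 / (1 + t + d)] in Green's formula with [psi = 1]: the divergence [I] integrates
    to zero, and [N * concentrated + I <= N] pointwise. With [r = 1 + t] the gap is
    [r^2 + (N - 2) r + N d r + N d^2] over [(r + d)^2], and dimension at least two makes it
    nonnegative. *)
Lemma concentrated_bound p d : (0 < m)%N -> sphere p -> 0 < d ->
  measurable_fun sphere (concentrated p d) /\ (Int (concentrated p d) <= (@area R m.+1)%:E)%E.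
Proof.
move=> hm ps d0; have mS := @measurable_sphere R m.+1.
have cp := C1_continuous (C1_dot p).
have h11 : -1 < 1 :> R by lra.
have pos (t : R) : -1 <= t <= 1 -> 0 < 1 + t + d by move=> /andP[]; lra.
have [||G [dG [CG EG]]] := @C1_extension R (-1) 1 (fun t => - (1 + t + d)^-1)
   (fun t => (1 + t + d) ^- 2) h11.
- move=> t /pos ht.
  have Dl : is_derive t 1 (fun t : R => 1 + t + d) 1 by apply: is_derive_eq; rewrite add0r addr0.
  have nz : 1 + t + d != 0 by rewrite gt_eqF.
  have Di : is_derive t 1 (fun t : R => (1 + t + d)^-1) (- (1 + t + d) ^- 2 *: (1 : R)).
    have [D1 D2] := Dl; apply: DeriveDef; first exact: (@derivableV _ _ (fun t : R => 1 + t + d) t 1 nz D1).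
    by rewrite (@deriveV _ _ (fun t : R => 1 + t + d) t 1 nz D1) D2.
  apply: (is_derive_eq (is_deriveN Di)).
  by rewrite /GRing.scale/= mulr1 opprK.
- move=> t /pos ht; apply: (@continuousV _ _ (fun t : R => (1 + t + d) ^+ 2)).
    by rewrite expf_neq0// gt_eqF.
  have cl : {for t, continuous (fun t : R => 1 + t + d)}.
    apply: (@continuousD _ _ _ (fun t : R => 1 + t) (cst d)); last exact: cst_continuous.
    by apply: (@continuousD _ _ _ (cst (1 : R)) (fun t : R => t)); [exact: cst_continuous|exact: cvg_id].
  exact: (@continuousM _ _ (fun t : R => 1 + t + d) (fun t : R => 1 + t + d)).
have ccomp (k : R -> R) : continuous k -> continuous (fun x : V => k (dot x p)).
  by move=> ck x; apply: (@continuous_comp _ _ _ (fun x => dot x p) k); [exact: cp|exact: ck].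
have sp x : sphere x -> -1 <= dot x p <= 1 by move=> xs; exact: sphere_dot_bound.
have cG := derive_continuous CG.1; have cdG := CG.2.
pose w x := d * dG (dot x p).
have wE x : sphere x -> w x = concentrated p d x.
  by move=> xs; rewrite /w; have [_ ->] := EG _ (sp x xs).
have cM (k l : V -> R) : continuous k -> continuous l -> continuous (fun x => k x * l x).
  by move=> h1 h2 x; exact: (continuousM (h1 x) (h2 x)).
have cB (k l : V -> R) : continuous k -> continuous l -> continuous (fun x => k x - l x).
  by move=> h1 h2 x; exact: (continuousB (h1 x) (h2 x)).
have cc (a : R) : continuous (fun _ : V => a) by exact: cst_continuous.
have cw : continuous w by apply: (cM _ _ (cc d)); exact: ccomp.
split.
  apply: (eq_measurable_fun w) => [x|]; first by rewrite inE; exact: wE.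
  exact: (measurable_funTS (continuous_measurable_rV cw)).
pose N : R := m.+1%:R.
pose I y := dG (dot y p) * (1 - dot y p ^+ 2) - N * dot y p * G (dot y p).
have I0 : (Int I = 0)%E.
  rewrite -(sphere_ibp ps (C1_cst m.+2 1) CG); apply: eq_integral => y _.
  by rewrite mulr0 add0r mul1r.
have cI : continuous I.
  apply: (cB _ _ _ _); last by apply: (cM _ _ _ (ccomp _ cG)); exact: (cM _ _ (cc _)).
  by apply: (cM _ _ (ccomp _ cdG)); apply: (cB _ _ (cc _)); exact: (cM _ _ cp cp).
pose w2 x := N * w x.
have cw2 : continuous w2 by exact: (cM _ _ (cc _)).
have iw := integrable_sphere_continuous cw.
have iw2 := integrable_sphere_continuous cw2; have iI := integrable_sphere_continuous cI.
have N2 : 2 <= N by rewrite /N ler_nat ltnS.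
have N0 : 0 < N by lra.
have le : (Int w2 <= (N * @area R m.+1)%:E)%E.
  rewrite -[leLHS]adde0 -I0 -(integralD mS iw2 iI).
  have -> : (N * @area R m.+1)%:E = (\int[sigma]_(x in sphere) (cst N%:E x))%E.
    by rewrite integral_cst// EFinM -areaE.
  apply: le_integral => //.
  - exact: integrableD.
  - exact: (integrable_sphere_continuous (cc N)).
  - move=> x; rewrite inE => xs; rewrite -EFinD lee_fin /w2 /w /I.
    have [-> ->] := EG _ (sp x xs); have p0 := pos _ (sp x xs).
    have /andP[t1 t2] := sp x xs.
    move: p0 t1 t2; move: (dot x p) => t p0 t1 t2.
    have -> : N * (d * (1 + t + d) ^- 2) + ((1 + t + d) ^- 2 * (1 - t ^+ 2) - N * t * - (1 + t + d)^-1)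
      = (N * d + (1 - t ^+ 2) + N * t * (1 + t + d)) / (1 + t + d) ^+ 2 by field; rewrite gt_eqF.
    rewrite ler_pdivrMr ?exprn_gt0//.
    have -> : t = (1 + t) - 1 by ring.
    move: p0; have : 0 <= 1 + t by lra.
    move: (1 + t) => r r0 p0.
    have -> : 1 + (r - 1) = r by ring.
    rewrite -subr_ge0.
    have -> : N * (r + d) ^+ 2 - (N * d + (1 - (r - 1) ^+ 2) + N * (r - 1) * (r + d)) =
      r ^+ 2 + (N - 2) * r + N * d * r + N * d ^+ 2 by ring.
    by rewrite !addr_ge0 ?mulr_ge0 ?sqr_ge0 ?subr_ge0// ?(ltW d0) ?(ltW N0).
have eqw : Int (concentrated p d) = Int w by apply: eq_integral => x; rewrite inE => xs; rewrite wE.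
have eqw2 : Int w2 = (N%:E * Int w)%E by rewrite -(integralZl mS iw); apply: eq_integral.
rewrite eqw; rewrite eqw2 EFinM in le.
by rewrite lee_pmul2l// in le; rewrite ?lte_fin.
Qed.

Lemma Int_sum_concentrated p (k : nat) (d : nat -> R) : (0 < m)%N -> sphere p -> (forall i, 0 < d i) ->
  measurable_fun sphere (fun x => \sum_(i < k) concentrated p (d i) x) /\
  (Int (fun x => (\sum_(i < k) concentrated p (d i) x)%R) <= (k%:R * @area R m.+1)%:E)%E.
Proof.
move=> hm ps d0; elim: k => [|k [mk IH]].
  split.
    rewrite (_ : (fun x => _) = cst 0); first exact: measurable_cst.
    by apply/funext => x; rewrite big_ord0.
  rewrite mul0r (eq_integral (cst 0%E)) ?integral0// => x _.
  by rewrite big_ord0.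
have [mc Ic] := concentrated_bound hm ps (d0 k).
have E : (fun x => \sum_(i < k.+1) concentrated p (d i) x) =
    (fun x => \sum_(i < k) concentrated p (d i) x + concentrated p (d k) x).
  by apply/funext => x; rewrite big_ord_recr.
have mE : measurable_fun sphere (fun x => \sum_(i < k.+1) concentrated p (d i) x).
  by rewrite E; exact: measurable_funD.
split; first exact: mE.
have ge (j : nat) x : 0 <= \sum_(i < j) concentrated p (d i) x.
  by apply: sumr_ge0 => i _; exact: concentrated_ge0.
apply: (@le_trans _ _ (1%:E * Int (fun x => (\sum_(i < k) concentrated p (d i) x)%R) + 1%:E * Int (concentrated p (d k)))%E).
  apply: le_Int_lincomb => //.
  - by move=> x; exact: concentrated_ge0.
  - by move=> x _; rewrite !mul1r big_ord_recr.
rewrite !mul1e -natr1 mulrDl mul1r EFinD; exact: leeD.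
Qed.

Lemma Ck_sum j k (f : nat -> R -> R) : (forall i, Ck j (f i)) ->
  Ck j (fun t => \sum_(i < k) f i t).
Proof.
move=> cf; elim: k => [|k IH].
  rewrite (_ : (fun t => _) = cst 0); first exact: Ck_cst.
  by apply/funext => t; rewrite big_ord0.
rewrite (_ : (fun t => _) = (fun t => \sum_(i < k) f i t) \+ f k); first exact: CkD.
by apply/funext => t; rewrite big_ord_recr.
Qed.

Lemma is_derive_sumr k (f df : nat -> R -> R) (t : R) : (forall i, is_derive t 1 (f i) (df i t)) ->
  is_derive t 1 (fun t => \sum_(i < k) f i t) (\sum_(i < k) df i t).
Proof.
move=> Df; elim: k => [|k IH].
  rewrite big_ord0 (_ : (fun t => _) = cst 0); first exact: is_derive_cst.
  by apply/funext => s; rewrite big_ord0.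
rewrite big_ord_recr (_ : (fun t => _) = (fun t => \sum_(i < k) f i t) \+ f k); first exact: is_deriveD.
by apply/funext => s; rewrite big_ord_recr.
Qed.

(* Cutoffs at dyadic scales have essentially disjoint gradients, so that the
   energy of their average tends to [0]; this telescoping sum makes it precise. *)
Lemma telescoping_bound (k : nat) (d : nat -> R) (r : R) : 0 <= r -> (forall i, 0 < d i) ->
  (forall i, d i.+1 = d i / 2) ->
  \sum_(i < k) d i / (r + d i) ^+ 2 * r <= 2 * (d 0%N / (r + d 0%N) - d k / (r + d k)).
Proof.
move=> r0 d0 dS; elim: k => [|k IH]; first by rewrite big_ord0 subrr mulr0.
rewrite big_ord_recr/=; apply: (le_trans (lerD IH (lexx _))).
rewrite -lerBrDl -mulrBr.
have -> : d 0%N / (r + d 0%N) - d k.+1 / (r + d k.+1) - (d 0%N / (r + d 0%N) - d k / (r + d k)) =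
  d k / (r + d k) - d k.+1 / (r + d k.+1) by ring.
rewrite dS; have := d0 k; move: (d k) => e e0.
have p1 : 0 < r + e by rewrite ltr_wpDl.
have p2 : 0 < r + e / 2 by rewrite ltr_wpDl// divr_gt0.
have -> : 2 * (e / (r + e) - e / 2 / (r + e / 2)) = e * r / (r + e) * (r + e / 2)^-1.
  by field; rewrite !gt_eqF//; lra.
rewrite (_ : e / (r + e) ^+ 2 * r = e * r / (r + e) * (r + e)^-1); last by field; rewrite gt_eqF.
rewrite ler_wpM2l// ?divr_ge0 ?mulr_ge0 ?(ltW e0) ?(ltW p1)//.
by rewrite lef_pV2 ?posrE//; lra.
Qed.

(** Here [1 - (r - 1)^2 = r (2 - r)]. One factor [S] is bounded by [16 T], and the other absorbs
    [r], giving [r S <= 32]; the energy density becomes linear in [T], so it can be integrated scale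
    by scale. *)
Lemma gradient_square_le (a r S T : R) : 0 <= r -> r <= 2 -> 0 <= S -> S <= 16 * T -> T * r <= 2 ->
  (a * S) ^+ 2 * (1 - (r - 1) ^+ 2) <= 32 ^+ 2 * a ^+ 2 * T.
Proof.
move=> r0 r2 S0 ST Tr; have T0 : 0 <= T by lra.
have Sr : r * S <= 32 by apply: (@le_trans _ _ (r * (16 * T))); [exact: ler_wpM2l|lra].
have h : S * (r * S) <= 16 * T * 32 by apply: ler_pM => //; exact: mulr_ge0.
have h' : S * (r * S) * (2 - r) <= 16 * T * 32 * 2.
  by apply: ler_pM => //; [rewrite !mulr_ge0|lra|lra].
have -> : (a * S) ^+ 2 * (1 - (r - 1) ^+ 2) = a ^+ 2 * (S * (r * S) * (2 - r)) by ring.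
have -> : 32 ^+ 2 * a ^+ 2 * T = a ^+ 2 * (16 * T * 32 * 2) by ring.
by rewrite ler_wpM2l// sqr_ge0.
Qed.

(** In dimension two the energy of one ramp does not shrink with its width. The average of [N] ramps
    at dyadic widths has energy at most [32^2 / N^2] times [N] bounded integrals, that is
    [O(1 / N)]. *)
Lemma one_H10 p : (0 < m)%N -> sphere p -> H10 (geodesic_ball p pi) (fun _ : V => 1%R) (fun _ => 0).
Proof.
move=> hm ps; apply: H10_intro.
- exact: measurable_cst.
- by apply: measurable_fun_rV_on => i; exact: measurable_cst.
move=> e e0; have a0 := @area_ge0 R m.+1.
pose A := 32 ^+ 2 * @area R m.+1 + 1.
have A0 : 0 < A by rewrite /A; lra.
have eA : 0 < e / A by rewrite divr_gt0.
have [N' hN] := ltr_add_invr eA; rewrite add0r in hN.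
pose N := N'.+1; pose Nr : R := N%:R.
have Nr0 : 0 < Nr by rewrite ltr0n.
have small : 32 ^+ 2 * @area R m.+1 / Nr <= e.
  apply: (@le_trans _ _ (A / Nr)); first by rewrite ler_wpM2r ?invr_ge0 ?(ltW Nr0)// /A lerDl.
  by rewrite mulrC -ler_pdivlMr// ltW.
(* The scales start at [2^-N <= 1 / N], which makes the [L^2] error [O(1 / N)] too. *)
pose d (i : nat) : R := 2^-1 ^+ (N + i).
have d0 i : 0 < d i by rewrite exprn_gt0// invr_gt0.
have dS i : d i.+1 = d i / 2 by rewrite /d addnS exprSr.
have dle i j : (i <= j)%N -> d j <= d i.
  by move=> ij; rewrite /d ler_wiXn2l ?invr_ge0 ?invf_le1 ?ler1n ?leq_add2l.
have d0N : d 0%N <= Nr^-1.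
  rewrite /d addn0 exprVn lef_pV2 ?posrE ?exprn_gt0// /Nr -natrX ler_nat.
  exact/ltnW/ltn_expl.
pose F t := Nr^-1 * \sum_(i < N) ramp (-1) (d i) t.
pose dF t := Nr^-1 * \sum_(i < N) dramp (-1) (d i) t.
have sF : smooth_real F.
  move=> k; apply: (@CkM _ k (cst Nr^-1)); first exact: Ck_cst.
  by apply: (@Ck_sum k N (fun i => ramp (-1) (d i))) => i; exact: ramp_smooth.
have DF (t : R) : is_derive t 1 F (dF t).
  have D := @is_derive_sumr N (fun i => ramp (-1) (d i)) (fun i => dramp (-1) (d i)) t
    (fun i => ramp_derive (-1) (d i) t).
  exact: (is_deriveZ Nr^-1 D).
have CF := smooth_C1 sF DF.
have r0 (x : V) : sphere x -> 0 <= 1 + dot x p <= 2.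
  by move=> xs; have := sphere_dot_bound xs ps; lra.
have rE (x : V) : dot x p - -1 = 1 + dot x p by rewrite opprK addrC.
have [mT IT] := Int_sum_concentrated N hm ps d0.
exists (fun x => F (dot x p)); split.
- have c1 : cos pi < -1 + d N :> R by rewrite cospi ltrDl d0.
  apply: (radial_test_function ps (pi_ge0 R) (lexx pi) sF c1) => t tc.
  rewrite /F big1 ?mulr0// => i _.
  apply: (ramp_eq0 (d0 i) _).1; rewrite (le_trans tc)// lerD2l dle//.
  exact/ltnW.
- have [mc Ic] := concentrated_bound hm ps (d0 0%N).
  apply: (@le_trans _ _ ((16 * d 0%N)%:E * Int (concentrated p (d 0%N)) + 0%:E * Int (fun _ => 0%R))%E).
    apply: le_Int_lincomb => //.
    + by rewrite mulr_ge0// ltW.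
    + apply: measurable_funX; apply: measurable_funB; last exact: measurable_cst.
      apply: measurable_funTS; apply: continuous_measurable_rV.
      exact: (C1_continuous (C1_comp_real CF (C1_dot p))).
    + by move=> x; exact: sqr_ge0.
    + by move=> x; exact: concentrated_ge0.
    move=> x xs; rewrite mul0r addr0.
    have /andP[x0 x2] := r0 x xs; have p0 : 0 < 1 + dot x p + d 0%N by rewrite ltr_wpDl.
    have xm1 : -1 <= dot x p by move: x0; clear; lra.
    have h1 : F (dot x p) <= 1.
      rewrite /F ler_pdivrMl// mulr1.
      apply: (@le_trans _ _ (\sum_(i < N) 1)); first by apply: ler_sum => i _; exact: ramp_le1.
      by rewrite sumr_const card_ord.
    have h2 : 1 - F (dot x p) <= 4 * (d 0%N / (1 + dot x p + d 0%N)).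
      rewrite -(ler_pM2l Nr0) mulrBr mulr1 /F mulVKf ?gt_eqF//.
      have -> : Nr - \sum_(i < N) ramp (-1) (d i) (dot x p) = \sum_(i < N) (1 - ramp (-1) (d i) (dot x p)).
        by rewrite sumrB sumr_const card_ord.
      apply: (@le_trans _ _ (\sum_(i < N) 4 * (d 0%N / (1 + dot x p + d 0%N)))); last first.
        by rewrite sumr_const card_ord [leRHS]mulr_natl.
      apply: ler_sum => i _; apply: (le_trans (ramp_bound (d0 i) xm1)); rewrite rE.
      have pi0 : 0 < 1 + dot x p + d i by rewrite ltr_wpDl.
      rewrite ler_pM2l// ler_pdivrMr// mulrAC ler_pdivlMr//.
      by rewrite [leLHS]mulrDr [leRHS]mulrDr (mulrC (d i) (d 0%N)) lerD2r ler_wpM2r// dle.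
    rewrite (concentrated_sqr p0).
    rewrite -sqrrN opprB lerXn2r// ?nnegrE ?subr_ge0//.
    by rewrite mulr_ge0// divr_ge0// ltW.
  rewrite mul0e adde0; apply: (@le_trans _ _ ((16 * d 0%N)%:E * (@area R m.+1)%:E)%E).
    by rewrite lee_wpmul2l// lee_fin mulr_ge0// ltW.
  rewrite -EFinM lee_fin; apply: le_trans small.
  have : d 0%N * @area R m.+1 <= Nr^-1 * @area R m.+1 by rewrite ler_wpM2r.
  have : 0 <= Nr^-1 * @area R m.+1 by rewrite mulr_ge0// invr_ge0 ltW.
  rewrite -[32 ^+ 2 * _ * _]mulrA (mulrC area) -mulrA; move: (Nr^-1 * _) (d 0%N * _) => a b; clear; lra.
- apply: (@le_trans _ _ ((32 ^+ 2 / Nr ^+ 2)%:E * Int (fun x => (\sum_(i < N) concentrated p (d i) x)%R) + 0%:E * Int (fun _ => 0%R))%E).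
    apply: le_Int_lincomb => //.
    + by rewrite divr_ge0// sqr_ge0.
    + have sm := radial_smooth p sF.
      have mz : measurable_fun sphere (fun _ : V => 0 : V) by apply: measurable_fun_rV_on => i; exact: measurable_cst.
      by apply: measurable_dot; apply: measurable_subv => //; exact: measurable_sphere_grad.
    + by move=> x; exact: dotxx_ge0.
    + by move=> x; apply: sumr_ge0 => i _; exact: concentrated_ge0.
    move=> x xs; rewrite mul0r addr0 subr0 (sphere_grad_test_radial xs ps CF) /dF.
    have /andP[x0 x2] := r0 x xs; have xm1 : -1 <= dot x p by move: x0; clear; lra.
    have tel := telescoping_bound N x0 d0 dS.
    pose S := \sum_(i < N) dramp (-1) (d i) (dot x p).
    pose T := \sum_(i < N) concentrated p (d i) x.
    have S0 : 0 <= S by apply: sumr_ge0 => i _; exact: dramp_ge0.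
    have ST : S <= 16 * T.
      rewrite /T mulr_sumr; apply: ler_sum => i _.
      by have := dramp_bound (d0 i) xm1; rewrite rE.
    have Tr : T * (1 + dot x p) <= 2.
      rewrite /T mulr_suml; apply: (le_trans tel).
      have h1 : d 0%N / (1 + dot x p + d 0%N) <= 1.
        by rewrite ler_pdivrMr ?ltr_wpDl// mul1r lerDr.
      have h2 : 0 <= d N / (1 + dot x p + d N) by rewrite divr_ge0 ?(ltW (d0 N))// addr_ge0// ltW.
      by move: h1 h2; clear; lra.
    have := gradient_square_le Nr^-1 x0 x2 S0 ST Tr.
    by rewrite -/S -/T (addrC 1 (dot x p)) addrK exprVn.
  rewrite mul0e adde0; apply: (@le_trans _ _ ((32 ^+ 2 / Nr ^+ 2)%:E * (Nr * @area R m.+1)%:E)%E).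
    by rewrite lee_wpmul2l// lee_fin divr_ge0// sqr_ge0.
  rewrite -EFinM lee_fin; apply: le_trans small; rewrite le_eqVlt; apply/orP; left; apply/eqP.
  by field; rewrite gt_eqF.
Qed.

Lemma zero_eigenvalue p : (0 < m)%N -> sphere p -> dirichlet_eigenvalue (geodesic_ball p pi) 0.
Proof.
move=> hm ps; exists (fun _ => 1), (fun _ => 0); split.
- exact: one_H10.
- move=> [N [mN N0 uN]].
  have h11 : -1 < 1 :> R by lra.
  have := sphere_cap_gt0 ps h11; rewrite ltNge => /negP; apply.
  rewrite -N0; apply: le_measure; rewrite ?inE//.
    by apply: measurableI; [exact: measurable_sphere|exact: measurable_cap].
  move=> x [xs _]; apply: uN => /= /(_ xs) /eqP; by rewrite oner_eq0.
- move=> v h _; rewrite mul0r.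
  rewrite /Rintegral integral0_eq// => x _.
  by rewrite /dot big1// => i _; rewrite mxE mul0r.
Qed.

End punctured_sphere.

(** * First eigenvalues of the balls, and their comparison *)

Lemma first_eigenvalueP (R : realType) n (U : set 'rV[R]_n.+1) lam :
  dirichlet_eigenvalue U lam -> (forall mu, dirichlet_eigenvalue U mu -> lam <= mu) ->
  first_dirichlet_eigenvalue U = lam.
Proof.
move=> ev lb; rewrite /first_dirichlet_eigenvalue; apply/eqP; rewrite eq_le; apply/andP; split.
  by apply: ge_inf => //; exists lam => mu; exact: lb.
by apply: lb_le_inf; [exists lam|move=> mu; exact: lb].
Qed.

Lemma first_eigenvalue_ball (R : realType) m (p : 'rV[R]_m.+2) r : sphere p -> 0 < r -> r < pi ->
  exists mu f df f1 f2, [/\ 0 < mu, radial_eigenpair m mu (cos r) f df f1 f2 &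
    first_dirichlet_eigenvalue (geodesic_ball p r) = mu].
Proof.
move=> ps r0 rpi; have [mu [f [df [f1 [f2 [mu0 ef hP]]]]]] := radial_eigenpair_exists m r0 rpi.
exists mu, f, df, f1, f2; split => //; apply: first_eigenvalueP.
  exact: (ball_eigenvalue ps r0 rpi (ltW mu0) ef hP).
move=> lam; apply: eigenvalue_ge (ltW mu0) _ => phi tphi.
exact: (barta_test ps r0 rpi (ltW mu0) ef tphi).
Qed.

Lemma first_eigenvalue_punctured (R : realType) m (p : 'rV[R]_m.+2) : (0 < m)%N -> sphere p ->
  first_dirichlet_eigenvalue (geodesic_ball p pi) = 0.
Proof.
move=> m0 ps; apply: first_eigenvalueP; first exact: zero_eigenvalue.
move=> lam; apply: eigenvalue_ge (lexx 0) _ => phi _.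
by rewrite mul0e integral_ge0// => x _; rewrite lee_fin dotxx_ge0.
Qed.

Local Close Scope classical_set_scope.

Theorem theorem1p2 (R : realType) (n : nat) (hn : (2 <= n)%N)
    (p : 'rV[R]_n.+1) (hp : sphere p) (theta1 theta2 : R)
    (h0 : 0 < theta1) (h12 : theta1 < theta2) (hpi : theta2 <= pi) :
  theta2 ^+ 2 * first_dirichlet_eigenvalue (geodesic_ball p theta2)
    < theta1 ^+ 2 * first_dirichlet_eigenvalue (geodesic_ball p theta1).
Proof.
(* For [n = k.+2] the cap lemmas apply with [m = k.+1 > 0], and [sturm_comparison] with [k], where
   the drift coefficient is [k + 1 > 0]. *)
case: n hn p hp => [|[|k]]// _ p hp.
have [mu1 [f [df [f1 [f2 [mu10 ef ->]]]]]] := first_eigenvalue_ball hp h0 (lt_le_trans h12 hpi).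
move: hpi; rewrite le_eqVlt => /predU1P[->|hpi].
  by rewrite first_eigenvalue_punctured// mulr0 mulr_gt0// exprn_gt0.
have [mu2 [h [dh [h1 [h2 [mu20 eh ->]]]]]] := first_eigenvalue_ball hp (lt_trans h0 h12) hpi.
exact: (sturm_comparison h0 h12 hpi (ltW mu10) mu20 ef eh).
Qed.
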